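(* There exists a 4-connected planar triangulation $G$ with maximum degree $7$ that has no plane $\delta_2$-obstacle embedding.
   Context: Graphs are finite, simple and undirected. A (planar) triangulation is a planar graph all of whose faces, including the outer face, are bounded by triangles. For $x\in\mathbb{R}^2$ and $i\in\{0,1,2,3\}$ let $Q^2_i(x)=x+\{r(\cos\theta,\sin\theta): r\ge 0,\ i\pi/2\le\theta\le (i+1)\pi/2\}$ be the $i$-th closed quadrant at $x$. A curve is a continuous map $f:[0,1]\to\mathbb{R}^2$; it is $\delta_2$-monotone if for some $i$ we have $f(b)\in Q^2_i(f(a))$ for all $0\le a\le b\le 1$ (these are the geodesics of the $L_1$ distance $\delta_2$). A plane $\delta_2$-obstacle embedding of $G$ is a pair $(\varphi,c)$, where $\varphi:V(G)\to\mathbb{R}^2$ is injective and $c$ assigns to each edge $uw$ a $\delta_2$-monotone curve with endpoints $\varphi(u),\varphi(w)$, such that the drawing is plane (edge curves are simple, contain no vertex points other than their endpoints, and two distinct edge curves meet only at a common endpoint), and such that whenever there is a path in $G$ with distinct end vertices $u,w$ whose edge curves concatenate to a $\delta_2$-monotone curve, then $uw\in E(G)$. *)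

(* Defs.v *)
From HB Require Import structures.
From mathcomp Require Import all_boot all_order all_algebra.
From mathcomp Require Import all_classical all_reals all_analysis.
Set Implicit Arguments.
Unset Strict Implicit.
Unset Printing Implicit Defensive.
Import Order.TTheory GRing.Theory Num.Theory.
Import numFieldNormedType.Exports.

Local Open Scope classical_set_scope.
Local Open Scope ring_scope.

Record sgraph := SGraph {
  vertex :> finType;
  adj : rel vertex;
  adj_sym : symmetric adj;
  adj_irrefl : irreflexive adj }.

Definition degree (G : sgraph) (v : G) : nat := #|[pred w | adj v w]|.

Definition max_degree (G : sgraph) : nat := (\max_(v : G) degree v)%N.

Definition adj_avoid (G : sgraph) (S : {set G}) : rel G :=
  [rel x y | [&& x \notin S, y \notin S & adj x y]].

(* More than k vertices, and deleting fewer than k of them never disconnects. *)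
Definition k_connected (k : nat) (G : sgraph) : Prop :=
  (k < #|G|)%N /\
  forall S : {set G}, (#|S| < k)%N ->
    forall x y : G, x \notin S -> y \notin S -> connect (adj_avoid S) x y.

Section Drawings.
Context {R : realType}.

Notation plane := (R * R)%type.

(* A curve is a map on R of which only the restriction to [0, 1] matters. *)
Notation I01 := `[0%R, 1%R]%classic.

Definition curve_image (f : R -> plane) : set plane := f @` I01.

Definition quadrant (i : 'I_4) (x : plane) : set plane :=
  [set y | exists r theta : R,
    [/\ 0 <= r,
        i%:R * (pi / 2) <= theta <= i.+1%:R * (pi / 2) &
        y = (x.1 + r * cos theta, x.2 + r * sin theta)]].

Definition monotone_curve (f : R -> plane) : Prop :=
  exists i : 'I_4, forall a b : R,
    0 <= a -> a <= b -> b <= 1 -> quadrant i (f a) (f b).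

Section OnGraph.
Variable G : sgraph.

(* [c u w] is the curve of the edge uw traversed from u to w, so each edge
   carries a single curve, up to reversal; [c] is unconstrained on non-edges. *)
Record plane_drawing (phi : G -> plane) (c : G -> G -> R -> plane) : Prop := {
  drawing_vertex_inj : injective phi;
  drawing_continuous : forall u w, adj u w -> {within I01, continuous (c u w)};
  drawing_start : forall u w, adj u w -> c u w 0 = phi u;
  drawing_end : forall u w, adj u w -> c u w 1 = phi w;
  drawing_reverse : forall u w, adj u w ->
    forall t, I01 t -> c w u t = c u w (1 - t);
  drawing_simple : forall u w, adj u w ->
    forall s t, I01 s -> I01 t -> c u w s = c u w t -> s = t;
  drawing_vertex_avoid : forall u w, adj u w ->
    forall t z, I01 t -> c u w t = phi z -> z = u \/ z = w;
  drawing_noncrossing : forall u w u' w', adj u w -> adj u' w' ->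
    [set u; w]%SET != [set u'; w']%SET ->
    forall s t, I01 s -> I01 t -> c u w s = c u' w' t ->
    exists z, [/\ z \in [set u; w]%SET, z \in [set u'; w']%SET
                & c u w s = phi z] }.

Definition drawing_support (phi : G -> plane) (c : G -> G -> R -> plane) :
    set plane :=
  range phi `|` [set p | exists u w, adj u w /\ curve_image (c u w) p].

Definition face (phi : G -> plane) (c : G -> G -> R -> plane)
    (F : set plane) : Prop :=
  exists2 p, (~` drawing_support phi c) p &
    F = connected_component (~` drawing_support phi c) p.

Definition bounded_by_triangle (c : G -> G -> R -> plane)
    (F : set plane) : Prop :=
  exists u v w : G, [/\ adj u v, adj v w, adj w u &
    closure F `\` interior F =
      curve_image (c u v) `|` curve_image (c v w) `|` curve_image (c w u)].

Definition planar_triangulation : Prop :=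
  exists (phi : G -> plane) (c : G -> G -> R -> plane),
    plane_drawing phi c /\
    forall F, face phi c F -> bounded_by_triangle c F.

Definition concat_curve (f g : R -> plane) : R -> plane :=
  fun t => if t <= 1 / 2 then f (2 * t) else g (2 * t - 1).

(* Concatenation along the walk [u :: p]; the parametrization is irrelevant to
   monotonicity. *)
Fixpoint walk_curve (phi : G -> plane) (c : G -> G -> R -> plane)
    (u : G) (p : seq G) {struct p} : R -> plane :=
  match p with
  | [::] => fun=> phi u
  | [:: v] => c u v
  | v :: p' => concat_curve (c u v) (walk_curve phi c v p')
  end.

Definition plane_obstacle_embedding (phi : G -> plane)
    (c : G -> G -> R -> plane) : Prop :=
  [/\ plane_drawing phi c,
      forall u w, adj u w -> monotone_curve (c u w) &
      forall (u : G) (p : seq G),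
        path (@adj G) u p -> uniq (u :: p) -> u != last u p ->
        monotone_curve (walk_curve phi c u p) -> adj u (last u p)].

End OnGraph.
End Drawings.

Arguments planar_triangulation R G : clear implicits.

(* Main.v *)
(* Geometry.  In an obstacle embedding, neighbours of v in opposite quadrants are
   adjacent, since the path through v is monotone.  Let v be a vertex with neighbours
   in every open half plane bounded by an axis.  Every triangle keeps all other vertices
   on one side, because G is 4-connected; applied to the triangles formed by v and two
   adjacent neighbours in opposite quadrants, this forces v to have exactly two such
   neighbours a and b, and all its other neighbours to lie in a single one of the two
   remaining quadrants.  The same separation argument shows that the vertices for which
   some half plane is empty all lie in one triangle.

   Combinatorics.  Cut G along the 4-cycle 1, 2, 12, 11: each side is a disc with 11
   interior vertices.  The exceptional triangle misses the interior of one of the discs, so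
   the directions of the edges there form a labelling with the local structure just
   described, and an exhaustive search shows that neither disc has one.

   Planarity.  G is the vertical projection of a convex surface with integer vertices,
   given by explicit coordinates; the faces are the triangles that support the surface. *)
From Stdlib Require Import BinInt.
Require Import Defs.
From mathcomp Require Import all_boot all_order all_algebra.
From mathcomp Require Import all_classical all_reals all_analysis.
From mathcomp Require Import ring lra ssrZ.

Set Implicit Arguments.
Unset Strict Implicit.
Unset Printing Implicit Defensive.
Import Order.TTheory GRing.Theory Num.Theory.
Import numFieldNormedType.Exports.

(** * Crossing parity of monotone curves *)

Section Parity.
Context {R : realType}.
Local Open Scope classical_set_scope.
Local Open Scope ring_scope.
Notation plane := (R * R)%type.
Notation I01 := `[0%R, 1%R]%classic.

(** No Jordan curve theorem is used. Since edges are monotone in both coordinates, the two sides of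
    a triangle can be told apart by the parity of the number of its edges that pass below a point.
    This parity is locally constant off the triangle, which suffices to carry it along paths of $G$;
    its value is computed only near a vertex. There, the cyclic order of the edges is replaced by
    the order in which edges leaving towards the northeast meet a short antidiagonal. Two discs are
    needed because a single one could contain the exceptional triangle, where nothing is known about
    the directions. A triangle is a clique and no edge joins the two interiors, so it cannot meet
    both. *)

Definition monotone_on (h : R -> R) : Prop :=
  (forall s t, 0 <= s -> s <= t -> t <= 1 -> h s <= h t) \/
  (forall s t, 0 <= s -> s <= t -> t <= 1 -> h t <= h s).

Definition passes_below (f : R -> plane) (p : plane) : Prop :=
  exists t, [/\ 0 <= t <= 1, (f t).1 = p.1 & (f t).2 < p.2].

(* The half-open test at the two ends makes the curves around a closed polygon count a
   common vertex consistently. *)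
Definition crosses_below (f : R -> plane) (p : plane) : bool :=
  (((f 0).1 <= p.1) (+) ((f 1).1 <= p.1)) && `[< passes_below f p >].

Definition near_box (d : R) (p q : plane) : bool :=
  (`|p.1 - q.1| < d) && (`|p.2 - q.2| < d).

Lemma continuous_fst_on (A : set R) (f : R -> plane) :
  {within A, continuous f} -> {within A, continuous (fun t => (f t).1)}.
Proof. by move=> fc x; apply: cvg_comp (fc x) _; apply: cvg_fst. Qed.

Lemma continuous_snd_on (A : set R) (f : R -> plane) :
  {within A, continuous f} -> {within A, continuous (fun t => (f t).2)}.
Proof. by move=> fc x; apply: cvg_comp (fc x) _; apply: cvg_snd. Qed.

Lemma monotone_on_ivt (h : R -> R) (s t y : R) :
  {within I01, continuous h} -> 0 <= s -> s <= t -> t <= 1 ->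
  h s <= y <= h t \/ h t <= y <= h s -> exists2 r, s <= r <= t & h r = y.
Proof.
move=> hc s0 st t1 hy.
have hc' : {within `[s, t], continuous h}.
  apply: continuous_subspaceW hc => r /=; rewrite !in_itv /= => /andP[sr rt].
  by rewrite (le_trans s0 sr) (le_trans rt t1).
have [|r] := IVT st hc' (v := y).
  by rewrite ge_min le_max; case: hy => /andP[-> ->]; rewrite ?orbT.
by rewrite in_itv /= => rst hr; exists r.
Qed.

(** The image of a compact interval is closed, so a whole box around [q] lies in its complement. *)
Lemma curve_avoid_box (f : R -> plane) (q : plane) :
  {within I01, continuous f} -> ~ curve_image f q ->
  exists2 d, 0 < d & forall t p, 0 <= t <= 1 -> f t = p -> ~~ near_box d p q.
Proof.
move=> fc nq.
have cpt : compact (curve_image f).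
  by apply: continuous_compact => //; apply: segment_compact.
have cl : closed (curve_image f).
  by apply: compact_closed => //; apply: norm_hausdorff.
have /nbhs_ballP[d d0 dP] : nbhs q (~` curve_image f).
  by apply: open_nbhs_nbhs; split => //; apply: closed_openC.
exists d => // t p t01 fp; apply/negP => /andP[b1 b2].
apply: (dP p); last by exists t => //=; rewrite in_itv.
by split; rewrite /ball /= distrC.
Qed.

Lemma connected_locally_constant (P : R -> bool) (s t : R) :
  s <= t ->
  (forall r, s <= r <= t -> exists2 d, 0 < d &
     forall r', s <= r' <= t -> `|r - r'| < d -> P r' = P r) ->
  P s = P t.
Proof.
move=> st loc.
have {}loc r : exists d : R, s <= r <= t -> 0 < d /\
     forall r', s <= r' <= t -> `|r - r'| < d -> P r' = P r.
  have [/loc[d d0 dP]|] := boolP (s <= r <= t); first by exists d.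
  by exists 0.
have [d dP] := choice loc.
(* [U true] and [U false] are open and split the segment according to the value of [P], which makes
   each value set both relatively open and relatively closed. *)
pose U b := \bigcup_(r in [set r | (s <= r <= t) && (P r == b)]) ball r (d r).
have Uo b : open (U b) by apply: bigcup_open => r _; exact: ball_open.
have UP b r : s <= r <= t -> U b r -> P r = b.
  move=> rst [r' /= /andP[r'st /eqP <-]] hb.
  by have [_] := dP _ r'st; apply.
have PU r : s <= r <= t -> U (P r) r.
  move=> rst; exists r => /=; first by rewrite rst eqxx.
  by apply: ballxx; case: (dP _ rst).
have E : [set r | (s <= r <= t) && (P r == P s)] = `[s, t]%classic.
  apply: (@segment_connected R s t).
  - by exists s => /=; rewrite lexx st eqxx.
  - exists (U (P s)) => //; apply/seteqP; split => r /=.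
      by case/andP=> rst /eqP <-; split; rewrite ?in_itv //=; apply: PU.
    by case; rewrite in_itv /= => rst /UP -> //; rewrite rst eqxx.
  - exists (~` U (~~ P s)); first exact: open_closedC.
    apply/seteqP; split => r /=.
      case/andP=> rst /eqP h; split; rewrite ?in_itv //= => /UP; rewrite h => /(_ rst).
      by case: (P s).
    case; rewrite in_itv /= => rst h; rewrite rst /=; apply/negPn/negP => nP.
    by apply: h; have := PU _ rst; congr (U _ _); move: nP; case: (P r); case: (P s).
have : `[s, t]%classic t by rewrite /= in_itv /= lexx st.
by rewrite -E /= => /andP[_ /eqP].
Qed.

Lemma between_addb (x a b : R) :
  (x <= a) (+) (x <= b) -> (a <= x <= b) || (b <= x <= a).
Proof. by case: leP => h1; case: leP => h2 //= _; rewrite ?h1 ?h2 ?(ltW h1) ?(ltW h2) ?orbT. Qed.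

Lemma between_convex (x y z a b : R) :
  (a <= x <= b) || (b <= x <= a) -> (a <= z <= b) || (b <= z <= a) ->
  x <= y -> y <= z -> (a <= y <= b) || (b <= y <= a).
Proof. by case/orP=> /andP[? ?] /orP[] /andP[? ?] ? ?; apply/orP; lra. Qed.

(* Only an end of [f] that lies below the move changes the crossing, and the corrections of
   consecutive curves cancel around a triangle. *)
Lemma crosses_below_move (f : R -> plane) (p q : plane) :
  {within I01, continuous f} ->
  monotone_on (fun t => (f t).1) ->
  (forall t, 0 <= t <= 1 -> (p.1 <= (f t).1 <= q.1) || (q.1 <= (f t).1 <= p.1) ->
     (f t).2 = q.2 -> False) ->
  (forall t, 0 <= t <= 1 -> (f t).1 = p.1 ->
     (p.2 <= (f t).2 <= q.2) || (q.2 <= (f t).2 <= p.2) -> False) ->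
  crosses_below f p (+) crosses_below f q =
    (((f 0).1 <= p.1) (+) ((f 0).1 <= q.1)) && ((f 0).2 < q.2) (+)
    (((f 1).1 <= p.1) (+) ((f 1).1 <= q.1)) && ((f 1).2 < q.2).
Proof.
move=> fc fm hor ver.
(* The point moves vertically from [p] to the corner [q'], which changes nothing, and then
   horizontally to [q]. *)
pose q' := (p.1, q.2).
have -> : crosses_below f p = crosses_below f q'.
  rewrite /crosses_below /=; congr (_ && _).
  by apply/asboolP/asboolP => -[t [tI e lt]]; exists t; split => //; rewrite ltNge;
    apply/negP => le; apply: (ver t tI e); rewrite /= in le lt *; rewrite le (ltW lt) ?orbT.
pose mid x := (p.1 <= x <= q.1) || (q.1 <= x <= p.1).
(* Inside the vertical strip between [p] and [q] the curve stays on one side of the height [q.2]: by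
   monotonicity it does not leave the strip in between, so a change of side would meet the
   horizontal part of the move. *)
have consist t1 t2 : 0 <= t1 <= 1 -> 0 <= t2 <= 1 -> mid (f t1).1 -> mid (f t2).1 ->
    (f t1).2 < q.2 -> (f t2).2 < q.2.
  move=> t1I t2I m1 m2 l1; rewrite ltNge; apply/negP => l2.
  have fc2 := continuous_snd_on fc.
  have [r rI [er mr]] : exists2 r, 0 <= r <= 1 & (f r).2 = q.2 /\ mid (f r).1.
    have pass s t : 0 <= s -> s <= t -> t <= 1 -> mid (f s).1 -> mid (f t).1 ->
        (f s).2 <= q.2 <= (f t).2 \/ (f t).2 <= q.2 <= (f s).2 ->
        exists2 r, 0 <= r <= 1 & (f r).2 = q.2 /\ mid (f r).1.
      move=> s0 st t1' ms mt hq.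
      have [r /andP[sr rt] e] := monotone_on_ivt fc2 s0 st t1' hq.
      exists r; first by rewrite (le_trans s0 sr) (le_trans rt t1').
      split=> //; case: fm => fm; have hs := fm _ _ s0 sr (le_trans rt t1');
        have ht := fm _ _ (le_trans s0 sr) rt t1'.
        exact: between_convex ms mt hs ht.
      exact: between_convex mt ms ht hs.
    move/andP: t1I t2I => [? ?] /andP[? ?].
    have [le|/ltW le] := leP t1 t2; [apply: (pass t1 t2)|apply: (pass t2 t1)] => //;
      [left|right]; by rewrite (ltW l1) l2.
  exact: hor rI mr er.
have fiber x : ((f 0).1 <= x) (+) ((f 1).1 <= x) -> exists2 t, 0 <= t <= 1 & (f t).1 = x.
  move=> h; apply: (monotone_on_ivt (continuous_fst_on fc)); rewrite ?lexx ?ler01 //.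
  by move: h; case: leP => h1; case: leP => h2 //= _; [left|right]; rewrite ?h1 ?h2 ltW.
have [[t0 t0I m0]|none] := pselect (exists2 t, 0 <= t <= 1 & mid (f t).1).
  pose b := (f t0).2 < q.2.
  have bE t : 0 <= t <= 1 -> mid (f t).1 -> ((f t).2 < q.2) = b.
    by move=> tI mt; apply/idP/idP; apply: consist.
  have cE x : mid x -> crosses_below f (x, q.2) = (((f 0).1 <= x) (+) ((f 1).1 <= x)) && b.
    move=> mx; rewrite /crosses_below /=; case E: (_ (+) _) => //=.
    have [t tI et] := fiber _ E.
    apply/asboolP/idP => [[r [rI /= er lt]]|hb]; first by rewrite -(bE r) ?er.
    by exists t; split => //=; rewrite bE ?et.
  have hE (t : R) : 0 <= t <= 1 -> (((f t).1 <= p.1) (+) ((f t).1 <= q.1)) && ((f t).2 < q.2) =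
    (((f t).1 <= p.1) (+) ((f t).1 <= q.1)) && b.
    move=> tI; case E: (_ (+) _) => //=; apply: bE => //.
    exact: between_addb.
  have mp : mid p.1 by rewrite /mid lexx; case: leP => //= /ltW ->.
  have mq : mid q.1 by rewrite /mid lexx !andbT; case: leP => //= /ltW ->.
  have -> : crosses_below f q = (((f 0).1 <= q.1) (+) ((f 1).1 <= q.1)) && b.
    by rewrite [in LHS](surjective_pairing q) cE.
  rewrite cE // !hE ?lexx ?ler01 //.
  by do 4!case: (_ <= _); rewrite /= ?addbF; case: (b).
have nb (t : R) : 0 <= t <= 1 -> ((f t).1 <= p.1) (+) ((f t).1 <= q.1) = false.
  move=> tI; apply/negP => h; apply: none; exists t => //; exact: between_addb.
rewrite !nb ?lexx ?ler01 //=.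
suff c0 x : mid x -> crosses_below f (x, q.2) = false.
  have mp : mid p.1 by rewrite /mid lexx; case: leP => //= /ltW ->.
  have mq : mid q.1 by rewrite /mid lexx !andbT; case: leP => //= /ltW ->.
  by rewrite c0 // [in LHS](surjective_pairing q) c0.
move=> mx; apply/negP => /andP[/fiber[t tI e] _]; apply: none; exists t => //.
by rewrite e.
Qed.

End Parity.

(** * Parity with respect to a closed triangle of curves *)

Section TriangleParity.
Context {R : realType}.
Local Open Scope classical_set_scope.
Local Open Scope ring_scope.
Notation plane := (R * R)%type.
Notation I01 := `[0%R, 1%R]%classic.
Implicit Types (f g h : R -> plane) (p q : plane).

(** A box that the curve avoids contains the vertical and the horizontal part of the move from [p]
    to [q]. *)
Lemma crosses_below_near f q :
  {within I01, continuous f} -> monotone_on (fun t => (f t).1) ->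
  ~ curve_image f q ->
  exists2 d, 0 < d & forall p, near_box d p q ->
  crosses_below f p (+) crosses_below f q =
    (((f 0).1 <= p.1) (+) ((f 0).1 <= q.1)) && ((f 0).2 < q.2) (+)
    (((f 1).1 <= p.1) (+) ((f 1).1 <= q.1)) && ((f 1).2 < q.2).
Proof.
move=> fc fm nq; have [d d0 dP] := curve_avoid_box fc nq.
exists d => // p /andP[b1 b2]; apply: crosses_below_move => //.
- move=> t tI xb y; apply/negP: (dP t (f t) tI erefl); rewrite negbK /near_box y subrr normr0 d0 andbT.
  by move: b1; case/orP: xb => /andP[? ?]; rewrite !ltr_norml => /andP[? ?]; apply/andP; split; lra.
- move=> t tI x yb; apply/negP: (dP t (f t) tI erefl); rewrite negbK /near_box x b1 /=.
  by move: b2; case/orP: yb => /andP[? ?]; rewrite !ltr_norml => /andP[? ?]; apply/andP; split; lra.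
Qed.

Definition triangle_parity f g h p : bool :=
  crosses_below f p (+) crosses_below g p (+) crosses_below h p.

Lemma near_box_min d d' p q : near_box (Num.min d d') p q -> near_box d p q /\ near_box d' p q.
Proof. by rewrite /near_box !lt_min => /andP[/andP[-> ->] /andP[-> ->]]. Qed.

Record x_monotone_curve f : Prop := {
  xcurve_continuous : {within I01, continuous f};
  xcurve_monotone : monotone_on (fun t => (f t).1) }.

Lemma triangle_parity_near f g h q :
  x_monotone_curve f -> x_monotone_curve g -> x_monotone_curve h ->
  f 1 = g 0 -> g 1 = h 0 -> h 1 = f 0 ->
  ~ curve_image f q -> ~ curve_image g q -> ~ curve_image h q ->
  exists2 d, 0 < d & forall p, near_box d p q ->
    triangle_parity f g h p = triangle_parity f g h q.
Proof.
move=> [fc fm] [gc gm] [hc hm] fg gh hf nf ng nh.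
have [d1 d10 h1] := crosses_below_near fc fm nf.
have [d2 d20 h2] := crosses_below_near gc gm ng.
have [d3 d30 h3] := crosses_below_near hc hm nh.
exists (Num.min d1 (Num.min d2 d3)); first by rewrite !lt_min d10 d20.
move=> p /near_box_min[/h1 {}h1 /near_box_min[/h2 {}h2 /h3 {}h3]].
move: h1 h2 h3; rewrite fg gh hf /triangle_parity.
have key : forall X1 Y1 X2 Y2 X3 Y3 a b c, X1 (+) Y1 = a (+) b -> X2 (+) Y2 = b (+) c ->
  X3 (+) Y3 = c (+) a -> X1 (+) X2 (+) X3 = Y1 (+) Y2 (+) Y3 by do 9!case.
exact: key.
Qed.

Lemma curve_near (c : R -> plane) (r d : R) :
  {within I01, continuous c} -> 0 <= r <= 1 -> 0 < d ->
  exists2 e, 0 < e & forall t, 0 <= t <= 1 -> `|r - t| < e -> near_box d (c t) (c r).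
Proof.
move=> cc rI d0.
have comp (k : R -> R) : {within I01, continuous k} ->
    exists2 e, 0 < e & forall t, 0 <= t <= 1 -> `|r - t| < e -> `|k t - k r| < d.
  move=> kc; have /cvgrPdist_lt /(_ d d0) := kc r.
  rewrite /prop_near1 /nbhs /= -nbhs_subspace_in /=; last by rewrite /= in_itv.
  move=> /nbhs_ballP[e e0 eP]; exists e => // t tI rt.
  by rewrite distrC; apply: eP => //=; rewrite in_itv.
have [e1 e10 h1] := comp _ (continuous_fst_on cc).
have [e2 e20 h2] := comp _ (continuous_snd_on cc).
exists (Num.min e1 e2); first by rewrite lt_min e10.
by move=> t tI; rewrite lt_min => /andP[? ?]; rewrite /near_box h1 ?h2.
Qed.

Lemma triangle_parity_path f g h (c : R -> plane) (s t : R) :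
  x_monotone_curve f -> x_monotone_curve g -> x_monotone_curve h ->
  f 1 = g 0 -> g 1 = h 0 -> h 1 = f 0 ->
  {within I01, continuous c} -> 0 <= s -> s <= t -> t <= 1 ->
  (forall r, s <= r <= t -> [/\ ~ curve_image f (c r), ~ curve_image g (c r) &
     ~ curve_image h (c r)]) ->
  triangle_parity f g h (c s) = triangle_parity f g h (c t).
Proof.
move=> fm gm hm fg gh hf cc s0 st t1 av.
apply: (@connected_locally_constant _ (fun r => triangle_parity f g h (c r))) => // r rst.
have [nf ng nh] := av r rst.
have [d d0 dP] := triangle_parity_near fm gm hm fg gh hf nf ng nh.
have rI : 0 <= r <= 1 by case/andP: rst => h1 h2; rewrite (le_trans s0 h1) (le_trans h2 t1).
have [e e0 eP] := curve_near cc rI d0.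
exists e => // r' /andP[h1 h2] lt; apply: dP; apply: eP => //.
by rewrite (le_trans s0 h1) (le_trans h2 t1).
Qed.

End TriangleParity.

(** * The side of a triangle in a monotone drawing *)

Section MonotoneDrawings.
Context {R : realType} {G : sgraph}.
Local Open Scope classical_set_scope.
Local Open Scope ring_scope.
Notation plane := (R * R)%type.
Notation I01 := `[0%R, 1%R]%classic.
Implicit Types (phi : G -> plane) (c : G -> G -> R -> plane) (u v w a b d : G).

(** Reflections and the exchange of the axes preserve this structure, so that one direction can
    stand for all four. *)
Record monotone_drawing phi c : Prop := {
  mdrawing_plane : plane_drawing phi c;
  mdrawing_x : forall u w, adj u w -> monotone_on (fun t => (c u w t).1);
  mdrawing_y : forall u w, adj u w -> monotone_on (fun t => (c u w t).2) }.

Lemma in_I01 (t : R) : 0 <= t <= 1 -> I01 t.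
Proof. by rewrite /= in_itv. Qed.

Lemma curve_imageP (f : R -> plane) p : curve_image f p -> exists2 t, 0 <= t <= 1 & f t = p.
Proof. by case=> t /=; rewrite in_itv /= => tI <-; exists t. Qed.

Lemma monotone_on_nondecreasing (h : R -> R) : monotone_on h -> h 0 <= h 1 ->
  forall s t, 0 <= s -> s <= t -> t <= 1 -> h s <= h t.
Proof.
case=> // hn h01 s t s0 st t1.
have t0 := le_trans s0 st.
by apply: le_trans (hn 0 s _ _ _) (le_trans h01 (hn t 1 _ _ _)); rewrite ?(le_trans st).
Qed.

Lemma monotone_on_min (h : R -> R) (m t : R) : monotone_on h -> m <= h 0 -> m <= h 1 ->
  0 <= t <= 1 -> m <= h t.
Proof.
case=> hm m0 m1 /andP[t0 t1]; first by apply: (le_trans m0); apply: hm.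
by apply: (le_trans m1); apply: hm.
Qed.

Lemma monotone_on_opp (h : R -> R) : monotone_on h -> monotone_on (fun t => - h t).
Proof. by case=> hm; [right|left] => s t ? ? ?; rewrite lerN2; apply: hm. Qed.

Lemma monotone_on_max (h : R -> R) (m t : R) : monotone_on h -> h 0 <= m -> h 1 <= m ->
  0 <= t <= 1 -> h t <= m.
Proof.
move=> hm h0 h1 tI; rewrite -lerN2; apply: (monotone_on_min (monotone_on_opp hm)) => //;
  by rewrite lerN2.
Qed.

Section OneDrawing.
Variables (phi : G -> plane) (c : G -> G -> R -> plane).
Hypothesis D : plane_drawing phi c.

(** The edge [xw] may start at an end of [ab]; this start is the only point that can be shared,
    hence the condition [0 < t]. *)
Lemma edge_avoid x w a b (t : R) : adj x w -> adj a b -> w != a -> w != b ->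
  0 <= t <= 1 -> (x \in [:: a; b] -> 0 < t) -> ~ curve_image (c a b) (c x w t).
Proof.
move=> xw ab wa wb tI tx [s sI /esym e].
have neq : [set x; w]%SET != [set a; b]%SET.
  apply/eqP => /setP/(_ w); rewrite !inE eqxx orbT (negPf wa) (negPf wb); by [].
have [z [zxw zab ez]] := drawing_noncrossing D xw ab neq (in_I01 tI) sI e.
move: zab zxw; rewrite !inE => zab.
case/orP=> /eqP zE; last by move: zab; rewrite zE (negPf wa) (negPf wb).
have t0 : 0 < t by apply: tx; rewrite -zE !inE.
move: ez; rewrite zE -(drawing_start D xw) => /(drawing_simple D xw (in_I01 tI)) ez.
by move: t0; rewrite ez ?ltxx //=; rewrite in_itv /= lexx ler01.
Qed.

Lemma vertex_off_edge w a b : adj a b -> w != a -> w != b -> ~ curve_image (c a b) (phi w).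
Proof.
by move=> ab wa wb [t tI /(drawing_vertex_avoid D ab tI)[] E]; move: wa wb; rewrite E eqxx.
Qed.

Section SameSide.
Variable L : plane -> plane.
Hypothesis Linj : injective L.
Hypothesis Lcont : forall f : R -> plane, {within I01, continuous f} -> {within I01, continuous (L \o f)}.

(** The coordinate change [L] is the identity for tests along vertical lines and [shear] for tests
    along antidiagonals. *)
Definition triangle_side a b d (p : plane) : bool :=
  triangle_parity (L \o c a b) (L \o c b d) (L \o c d a) (L p).

Definition x_monotone_triangle a b d : Prop :=
  [/\ adj a b, adj b d, adj d a &
   [/\ monotone_on (fun t => (L (c a b t)).1), monotone_on (fun t => (L (c b d t)).1) &
     monotone_on (fun t => (L (c d a t)).1)]].

Lemma triangle_side_path a b d x w (t : R) : x_monotone_triangle a b d ->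
  adj x w -> w \notin [:: a; b; d] -> 0 <= t <= 1 -> (x \in [:: a; b; d] -> 0 < t) ->
  triangle_side a b d (c x w t) = triangle_side a b d (phi w).
Proof.
move=> [ab bd da [m1 m2 m3]] xw wT tI tx.
have /and3P[wa wb wd] : [&& w != a, w != b & w != d] by rewrite -!negb_or; move: wT; rewrite !inE.
rewrite -(drawing_end D xw) /triangle_side.
have cL u v : adj u v -> {within I01, continuous (L \o c u v)}.
  by move=> uv; apply: Lcont; apply: drawing_continuous D _ _ uv.
have [t0 t1] := andP tI.
apply: (triangle_parity_path (c := L \o c x w)) => //; rewrite /= ?(drawing_end D) ?(drawing_start D) //;
  try by [split => //; apply: cL]; try exact: cL.
move=> r /andP[tr r1].
have rI : 0 <= r <= 1 by rewrite (le_trans t0 tr).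
have av u v : adj u v -> w != u -> w != v -> u \in [:: a; b; d] -> v \in [:: a; b; d] ->
    ~ curve_image (L \o c u v) (L (c x w r)).
  move=> uv wu wv uT vT [s sI /= /Linj e]; apply: (edge_avoid xw uv wu wv rI) => [|]; last by exists s.
  by rewrite !inE => /orP[] /eqP xE; apply: (lt_le_trans _ tr); apply: tx; rewrite xE.
by split; apply: av; rewrite // !inE eqxx ?orbT.
Qed.

Hypothesis conn : forall S : {set G}, (#|S| < 4)%N ->
  forall x y : G, x \notin S -> y \notin S -> connect (adj_avoid S) x y.

Lemma triangle_side_const a b d w w' : x_monotone_triangle a b d ->
  w \notin [:: a; b; d] -> w' \notin [:: a; b; d] ->
  triangle_side a b d (phi w) = triangle_side a b d (phi w').
Proof.
move=> T wT w'T.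
pose S := [set x in [:: a; b; d]]%SET.
have memS z : (z \in S) = (z \in [:: a; b; d]) by rewrite inE.
have S3 : (#|S| < 4)%N.
  by rewrite cardsE; apply: leq_ltn_trans (card_size _) _.
have := conn S3; move=> /(_ w w'); rewrite !memS => /(_ wT w'T) /connectP[p].
elim: p w wT => [|x p IHp] w wT /=; first by move=> _ ->.
move=> /andP[/and3P[_ xS wx] pth] e.
rewrite memS in xS.
rewrite -(IHp x xS pth e) -(drawing_start D wx); apply: (triangle_side_path T wx xS).
  by rewrite lexx ler01.
by rewrite (negPf wT).
Qed.

End SameSide.
End OneDrawing.
End MonotoneDrawings.

(** * Edges near a common endpoint *)

Section Spokes.
Context {R : realType} {G : sgraph}.
Local Open Scope classical_set_scope.
Local Open Scope ring_scope.
Notation plane := (R * R)%type.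
Notation I01 := `[0%R, 1%R]%classic.

(** Lets a single small level serve all edges and all pairs of vertices at once. *)
Lemma finite_small (I : finType) (P : I -> R -> Prop) :
  (forall i, exists2 d, 0 < d & forall e, 0 < e -> e <= d -> P i e) ->
  exists2 d, 0 < d & forall i, P i d.
Proof.
move=> h.
suff [d d0 dP] : exists2 d, 0 < d & forall i, i \in enum I -> forall e, 0 < e -> e <= d -> P i e.
  by exists d => // i; apply: dP => //; rewrite mem_enum.
elim: (enum I) => [|j s [d d0 dP]]; first by exists 1.
have [d' d'0 d'P] := h j.
exists (Num.min d d'); first by rewrite lt_min d0.
move=> i; rewrite inE => /orP[/eqP ->|/dP {}dP] e e0; rewrite le_min => /andP[h1 h2]; [exact: d'P|exact: dP].
Qed.

Variables (phi : G -> plane) (c : G -> G -> R -> plane).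
Hypothesis D : monotone_drawing phi c.
Implicit Types (u v w a b m : G).

Let DP := mdrawing_plane D.

Lemma spoke_x v w s t : adj v w -> (phi v).1 <= (phi w).1 ->
  0 <= s -> s <= t -> t <= 1 -> (c v w s).1 <= (c v w t).1.
Proof.
move=> vw le; apply: (monotone_on_nondecreasing (mdrawing_x D vw)).
by rewrite (drawing_start DP vw) (drawing_end DP vw).
Qed.

Lemma spoke_y v w s t : adj v w -> (phi v).2 <= (phi w).2 ->
  0 <= s -> s <= t -> t <= 1 -> (c v w s).2 <= (c v w t).2.
Proof.
move=> vw le; apply: (monotone_on_nondecreasing (mdrawing_y D vw)).
by rewrite (drawing_start DP vw) (drawing_end DP vw).
Qed.

(** The antidiagonal at distance [tau] from [v], measured by the sum of the coordinates, is a
    transversal for the edges that leave [v] towards the northeast; the abscissa on it records their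
    angular order. *)
Definition level_point v w (tau : R) (t : R) : Prop :=
  0 <= t <= 1 /\ (c v w t).1 + (c v w t).2 = (phi v).1 + (phi v).2 + tau.

Lemma level_point_exists v w tau : adj v w -> 0 <= tau ->
  tau <= ((phi w).1 + (phi w).2) - ((phi v).1 + (phi v).2) ->
  exists t, level_point v w tau t.
Proof.
move=> vw t0 t1.
have cc := drawing_continuous DP vw.
have hc : {within I01, continuous (fun t => (c v w t).1 + (c v w t).2)}.
  by move=> x; apply: cvgD; [apply: (continuous_fst_on cc)|apply: (continuous_snd_on cc)].
have [|t tI e] := monotone_on_ivt (y := (phi v).1 + (phi v).2 + tau) hc (lexx 0) ler01 (lexx 1).
  by left; rewrite (drawing_start DP vw) (drawing_end DP vw) lerDl t0 /=; lra.
by exists t.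
Qed.

(** Exactly one edge of the triangle passes below the chosen point of [vm]. The edge [bv] does,
    being further to the right on the antidiagonal. The edge [va] stays to the left or passes above.
    The edge [ab] avoids a box around [v] which contains everything at that abscissa between the
    height of [v] and the point. *)
Lemma between_spokes v a m b (tau d tm tb : R) :
  adj v a -> adj v m -> adj v b -> adj a b ->
  (phi v).2 <= (phi a).2 -> (phi v).2 <= (phi b).2 -> (phi v).2 <= (phi m).2 ->
  (phi v).1 <= (phi b).1 -> (phi v).1 <= (phi m).1 ->
  tau < d -> (forall t, 0 <= t <= 1 -> ~~ near_box d (c a b t) (phi v)) ->
  level_point v m tau tm -> level_point v b tau tb -> (c v m tm).1 < (c v b tb).1 ->
  (phi a).1 <= (phi v).1 \/
    (phi v).1 <= (phi a).1 /\
    (exists2 ta, level_point v a tau ta & (c v a ta).1 < (c v m tm).1) ->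
  triangle_parity (c v a) (c a b) (c b v) (c v m tm) = true.
Proof.
move=> va vm vb ab ya yb ym xb xm td box [/andP[tm0 tm1] em] [/andP[tb0 tb1] eb] lt ha.
have pmx := spoke_x vm xm (lexx 0) tm0 tm1; rewrite (drawing_start DP vm) in pmx.
have pmy := spoke_y vm ym (lexx 0) tm0 tm1; rewrite (drawing_start DP vm) in pmy.
have pbx := spoke_x vb xb tb0 tb1 (lexx 1); rewrite (drawing_end DP vb) in pbx.
set p := c v m tm in em lt pmx pmy ha *.
have cb : crosses_below (c b v) p = true.
  have bv : adj b v by rewrite adj_sym.
  rewrite /crosses_below (drawing_start DP bv) (drawing_end DP bv) pmx.
  rewrite leNgt (lt_le_trans lt pbx) /=; apply/asboolP.
  have cc := continuous_fst_on (drawing_continuous DP vb).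
  have [|r /andP[r0 r1] er] := monotone_on_ivt (y := p.1) cc (lexx 0) tb0 tb1.
    by left; rewrite (drawing_start DP vb) pmx ltW.
  have rI : I01 r by rewrite /= in_itv /= r0 (le_trans r1).
  (* The triangle traverses this edge from [b] to [v], hence the reversed parameter. *)
  exists (1 - r); split; first by move: rI; rewrite /= in_itv /= => /andP[? ?]; lra.
    have rI' : I01 (1 - r) by move: rI; rewrite /= !in_itv /= => /andP[? ?]; lra.
    by rewrite (drawing_reverse DP vb rI') subKr.
  have rI' : I01 (1 - r) by move: rI; rewrite /= !in_itv /= => /andP[? ?]; lra.
  rewrite (drawing_reverse DP vb rI') subKr.
  have := spoke_y vb yb r0 r1 tb1; lra.
have ca : crosses_below (c v a) p = false.
  rewrite /crosses_below (drawing_start DP va) (drawing_end DP va).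
  case: ha => [xa|[xa [ta [/andP[ta0 ta1] ea] lta]]]; first by rewrite pmx (le_trans xa pmx).
  apply/negP => /andP[_ /asboolP[t [/andP[t0 t1] et lty]]].
  have [le|/ltW le] := leP t ta; first by have := spoke_x va xa t0 le ta1; lra.
  by have := spoke_y va ya ta0 le t1; lra.
have cab : crosses_below (c a b) p = false.
  apply/negP => /andP[_ /asboolP[t [tI et lty]]].
  have := box t tI; rewrite /near_box et negb_and => /orP[].
    by rewrite ger0_norm ?subr_ge0 // => /negP; apply; lra.
  have yt : (phi v).2 <= (c a b t).2.
    by apply: (monotone_on_min (mdrawing_y D ab)) => //; rewrite ?(drawing_start DP ab) ?(drawing_end DP ab).
  by rewrite ger0_norm ?subr_ge0 // => /negP; apply; lra.
by rewrite /triangle_parity ca cab cb.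
Qed.

End Spokes.

(** * Extreme vertices *)

Section Enclosing.
Context {R : realType} {G : sgraph}.
Local Open Scope classical_set_scope.
Local Open Scope ring_scope.
Notation plane := (R * R)%type.
Notation I01 := `[0%R, 1%R]%classic.
Implicit Types (phi : G -> plane) (c : G -> G -> R -> plane) (u v w a b d m : G).

Definition enclosing phi c a b d : Prop :=
  [/\ adj a b, adj b d, adj d a & forall w, w \notin [:: a; b; d] ->
    triangle_parity (c a b) (c b d) (c d a) (phi w) = true].

(* Only the neighbours of [v] are compared; [lowest_global] is the global version. *)
Definition lowest phi v : Prop := forall w, adj v w -> (phi v).2 <= (phi w).2.

Hypothesis conn : forall S : {set G}, (#|S| < 4)%N ->
  forall x y : G, x \notin S -> y \notin S -> connect (adj_avoid S) x y.
Hypothesis link : forall v u, adj v u -> exists u1 u2,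
  [/\ u1 != u2, adj v u1, adj v u2, adj u u1 & adj u u2].
Hypothesis has_neighbor : forall v, exists w, adj v w.

Lemma id_cont (f : R -> plane) : {within I01, continuous f} -> {within I01, continuous (idfun \o f)}.
Proof. by []. Qed.

Lemma adj_neq u w : adj u w -> u != w.
Proof. by apply: contraTneq => ->; rewrite adj_irrefl. Qed.

Section Level.
Variables (phi : G -> plane) (c : G -> G -> R -> plane) (v : G).
Hypothesis D : monotone_drawing phi c.
Hypothesis low : lowest phi v.
Let DP := mdrawing_plane D.

(** Each requirement holds for all sufficiently small positive levels. The first one uses that a
    neighbour which is neither below nor to the left of [v] has a strictly larger coordinate sum, as
    the points differ. *)
Lemma good_level : exists tau (t : G -> R),
  (forall w, adj v w -> (phi v).1 <= (phi w).1 -> level_point phi c v w tau (t w) /\ 0 < t w) /\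
  (forall a b, adj v a -> adj v b -> adj a b ->
     exists2 d, tau < d & forall s, 0 <= s <= 1 -> ~~ near_box d (c a b s) (phi v)).
Proof.
pose P (ab : G * G) (tau : R) :=
  (adj v ab.1 -> (phi v).1 <= (phi ab.1).1 ->
     tau <= ((phi ab.1).1 + (phi ab.1).2) - ((phi v).1 + (phi v).2)) /\
  (adj v ab.1 -> adj v ab.2 -> adj ab.1 ab.2 ->
     exists2 d, tau < d & forall s, 0 <= s <= 1 -> ~~ near_box d (c ab.1 ab.2 s) (phi v)).
have [tau tau0 tauP] : exists2 tau, 0 < tau & forall ab, P ab tau.
  apply: finite_small => -[a b].
  have [d1 d10 h1] : exists2 d1, 0 < d1 & forall e, 0 < e -> e <= d1 ->
      adj v a -> (phi v).1 <= (phi a).1 -> e <= ((phi a).1 + (phi a).2) - ((phi v).1 + (phi v).2).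
    have [[va xa]|nh] := pselect (adj v a /\ (phi v).1 <= (phi a).1); last first.
      by exists 1 => // e _ _ va xa; case: nh.
    exists ((phi a).1 + (phi a).2 - ((phi v).1 + (phi v).2)); last by [].
    have ya := low va.
    rewrite lt_neqAle; apply/andP; split; last lra.
    apply/eqP => e; have : phi a = phi v.
      by rewrite (surjective_pairing (phi a)) (surjective_pairing (phi v)); congr (_, _); lra.
    by move/(drawing_vertex_inj DP) => av; move: va; rewrite av adj_irrefl.
  have [d2 d20 h2] : exists2 d2, 0 < d2 & adj v a -> adj v b -> adj a b ->
      forall s, 0 <= s <= 1 -> ~~ near_box d2 (c a b s) (phi v).
    have [[va [vb ab]]|nh] := pselect (adj v a /\ adj v b /\ adj a b); last first.
      by exists 1 => // *; case: nh.
    have off := vertex_off_edge DP ab (adj_neq va) (adj_neq vb).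
    have [d d0 dP] := curve_avoid_box (drawing_continuous DP ab) off.
    by exists d => // _ _ _ s sI; apply: dP sI _.
  exists (Num.min d1 (d2 / 2)); first by rewrite lt_min d10; lra.
  move=> e e0; rewrite le_min => /andP[e1 e2]; split; first exact: h1.
  by move=> va vb ab; exists d2; [lra|exact: h2].
have lev w : exists t, adj v w -> (phi v).1 <= (phi w).1 -> level_point phi c v w tau t /\ 0 < t.
  have [[vw xw]|nh] := pselect (adj v w /\ (phi v).1 <= (phi w).1); last by exists 0 => vw xw; case: nh.
  have [t tP] := level_point_exists D vw (ltW tau0) ((tauP (w, w)).1 vw xw).
  exists t => _ _; split=> //; case: tP => /andP[t0 _] e.
  rewrite lt_neqAle t0 andbT; apply/eqP => t00; move: e; rewrite -t00 (drawing_start DP vw); lra.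
have [t tP] := choice lev.
exists tau, t; split=> [w|a b]; first exact: tP.
exact: (tauP (a, b)).2.
Qed.

(** The edge [vm] starts inside the triangle, so [m] is enclosed, and every other vertex off the
    triangle is on the same side as [m]. *)
Lemma enclosing_between tau (t : G -> R) a m b :
  (forall w, adj v w -> (phi v).1 <= (phi w).1 -> level_point phi c v w tau (t w) /\ 0 < t w) ->
  (forall a b, adj v a -> adj v b -> adj a b ->
     exists2 d, tau < d & forall s, 0 <= s <= 1 -> ~~ near_box d (c a b s) (phi v)) ->
  adj v a -> adj v m -> adj v b -> adj a b -> m != a ->
  (phi v).1 <= (phi m).1 -> (phi v).1 <= (phi b).1 ->
  (c v m (t m)).1 < (c v b (t b)).1 ->
  (phi a).1 <= (phi v).1 \/ (phi v).1 <= (phi a).1 /\ (c v a (t a)).1 < (c v m (t m)).1 ->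
  enclosing phi c v a b.
Proof.
move=> lev box va vm vb ab ma xm xb lt ha.
have [lm tm0] := lev m vm xm; have [lb tb0] := lev b vb xb.
have [d td dP] := box a b va vb ab.
have near : triangle_parity (c v a) (c a b) (c b v) (c v m (t m)) = true.
  apply: (between_spokes D va vm vb ab _ _ _ _ _ td dP lm lb lt) => //; try exact: low.
  case: ha => [|[xa h]]; [by left|right; split=> //; exists (t a) => //].
  by have [] := lev a va xa.
have mb : m != b by apply: contraTneq lt => ->; rewrite ltxx.
have bv : adj b v by rewrite adj_sym.
have T : x_monotone_triangle c idfun v a b.
  by split=> //; split; apply: (mdrawing_x D).
have mT : m \notin [:: v; a; b].
  by rewrite !inE !negb_or ma mb eq_sym adj_neq.
have tmI : 0 <= t m <= 1 by case: lm.
split=> // w wT.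
have id_inj : injective (idfun : plane -> plane) by [].
have E1 := triangle_side_const DP id_inj id_cont conn T mT wT.
have E2 := triangle_side_path DP id_inj id_cont T vm mT tmI (fun=> tm0).
exact: etrans (esym E1) (etrans (esym E2) near).
Qed.

(** On one antidiagonal equal abscissas mean equal points, and two edges at [v] share only [v]
    itself. *)
Lemma level_inj tau (t : G -> R) a b :
  (forall w, adj v w -> (phi v).1 <= (phi w).1 -> level_point phi c v w tau (t w) /\ 0 < t w) ->
  adj v a -> adj v b -> (phi v).1 <= (phi a).1 -> (phi v).1 <= (phi b).1 -> a != b ->
  (c v a (t a)).1 != (c v b (t b)).1.
Proof.
move=> lev va vb xa xb nab; apply/eqP => e.
have [[aI ea] ta0] := lev a va xa; have [[bI eb] tb0] := lev b vb xb.
have av : a != v by rewrite eq_sym adj_neq.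
apply: (edge_avoid DP va vb av nab aI) => //.
exists (t b); first exact: in_I01.
by rewrite (surjective_pairing (c v b _)) (surjective_pairing (c v a _)); congr (_, _); lra.
Qed.

End Level.

Definition map_vertices (L : plane -> plane) phi : G -> plane := fun u => L (phi u).
Definition map_edges (L : plane -> plane) c : G -> G -> R -> plane := fun u w t => L (c u w t).

Lemma plane_drawing_map (L : plane -> plane) phi c :
  injective L ->
  (forall f : R -> plane, {within I01, continuous f} -> {within I01, continuous (L \o f)}) ->
  plane_drawing phi c -> plane_drawing (map_vertices L phi) (map_edges L c).
Proof.
move=> Linj Lcont D; split.
- by move=> u w /Linj /(drawing_vertex_inj D).
- by move=> u w uw; apply: Lcont; exact: (drawing_continuous D uw).
- by move=> u w uw; rewrite /map_edges (drawing_start D uw).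
- by move=> u w uw; rewrite /map_edges (drawing_end D uw).
- by move=> u w uw t tI; rewrite /map_edges (drawing_reverse D uw tI).
- by move=> u w uw s t sI tI /Linj; exact: (drawing_simple D uw sI tI).
- by move=> u w uw t z tI /Linj; exact: (drawing_vertex_avoid D uw tI).
- move=> u w u' w' uw uw' neq s t sI tI /Linj e.
  have [z [z1 z2 e']] := drawing_noncrossing D uw uw' neq sI tI e.
  by exists z; split=> //; rewrite /map_edges e'.
Qed.

Definition flip_x (p : plane) : plane := (- p.1, p.2).
Definition flip_y (p : plane) : plane := (p.1, - p.2).
Definition swap_xy (p : plane) : plane := (p.2, p.1).

Lemma pair_cont (h k : R -> R) : {within I01, continuous h} -> {within I01, continuous k} ->
  {within I01, continuous (fun t => (h t, k t))}.
Proof. by move=> hc kc x; exact: (cvg_pair (hc x) (kc x)). Qed.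

Lemma opp_cont (h : R -> R) : {within I01, continuous h} -> {within I01, continuous (fun t => - h t)}.
Proof. by move=> hc x; apply: cvgN; apply: hc. Qed.

Lemma monotone_flip_x phi c : monotone_drawing phi c ->
  monotone_drawing (map_vertices flip_x phi) (map_edges flip_x c).
Proof.
move=> D; split.
- apply: plane_drawing_map (mdrawing_plane D).
    by move=> [x y] [x' y'] [/oppr_inj -> ->].
  move=> f fc; apply: pair_cont; [apply: opp_cont; exact: continuous_fst_on|exact: continuous_snd_on].
- by move=> u w uw; apply: monotone_on_opp; exact: (mdrawing_x D uw).
- by move=> u w uw; exact: (mdrawing_y D uw).
Qed.

Lemma monotone_flip_y phi c : monotone_drawing phi c ->
  monotone_drawing (map_vertices flip_y phi) (map_edges flip_y c).
Proof.
move=> D; split.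
- apply: plane_drawing_map (mdrawing_plane D).
    by move=> [x y] [x' y'] [-> /oppr_inj ->].
  move=> f fc; apply: pair_cont; [exact: continuous_fst_on|apply: opp_cont; exact: continuous_snd_on].
- by move=> u w uw; exact: (mdrawing_x D uw).
- by move=> u w uw; apply: monotone_on_opp; exact: (mdrawing_y D uw).
Qed.

Lemma monotone_swap_xy phi c : monotone_drawing phi c ->
  monotone_drawing (map_vertices swap_xy phi) (map_edges swap_xy c).
Proof.
move=> D; split.
- apply: plane_drawing_map (mdrawing_plane D).
    by move=> [x y] [x' y'] [-> ->].
  move=> f fc; apply: pair_cont; [exact: continuous_snd_on|exact: continuous_fst_on].
- by move=> u w uw; exact: (mdrawing_y D uw).
- by move=> u w uw; exact: (mdrawing_x D uw).
Qed.

(** The half-open convention in [crosses_below] distinguishes left from right, so the test in the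
    mirror image is not literally the same; both versions are carried along instead of being
    compared. *)
Definition enclosing_up_to_flip phi c a b d : Prop :=
  enclosing phi c a b d \/ enclosing (map_vertices flip_x phi) (map_edges flip_x c) a b d.

(** The last spoke [m0] on the right forms triangles with [v] and two further neighbours. The one of
    them that lies between [m0] and the other is enclosed by the triangle on [m0] and that other
    one. *)
Lemma lowest_enclosed_half phi c v u0 : monotone_drawing phi c -> lowest phi v ->
  adj v u0 -> (phi v).1 <= (phi u0).1 -> exists a b, enclosing_up_to_flip phi c v a b.
Proof.
move=> D low vu0 xu0.
have [tau [t [lev box]]] := good_level D low.
pose NE w := adj v w && ((phi v).1 <= (phi w).1).
have NE0 : NE u0 by rewrite /NE vu0.
case: (@Order.TotalTheory.arg_maxP _ _ _ u0 NE (fun w => (c v w (t w)).1) NE0) => m0 /andP[vm0 xm0] max.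
have {}max w : adj v w -> (phi v).1 <= (phi w).1 -> w != m0 -> (c v w (t w)).1 < (c v m0 (t m0)).1.
  move=> vw xw wm; rewrite lt_neqAle (level_inj D lev vw vm0 xw xm0 wm) /=.
  by apply: max; rewrite /NE vw.
have [c1 [c2 [c12 vc1 vc2 mc1 mc2]]] := link vm0.
have c1m : c1 != m0 by rewrite eq_sym adj_neq.
have c2m : c2 != m0 by rewrite eq_sym adj_neq.
have [x1|/ltW x1] := leP (phi v).1 (phi c1).1.
  have [x2|/ltW x2] := leP (phi v).1 (phi c2).1.
    have := level_inj D lev vc1 vc2 x1 x2 c12; rewrite neq_lt => /orP[] lt.
      exists c1, m0; left; apply: (enclosing_between D low lev box vc1 vc2 vm0) => //.
      - by rewrite adj_sym.
      - by rewrite eq_sym.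
      - exact: max.
      - by right.
    exists c2, m0; left; apply: (enclosing_between D low lev box vc2 vc1 vm0) => //.
    - by rewrite adj_sym.
    - exact: max.
    - by right.
  exists c2, m0; left; apply: (enclosing_between D low lev box vc2 vc1 vm0) => //.
  - by rewrite adj_sym.
  - exact: max.
  - by left.
have [x2|/ltW x2] := leP (phi v).1 (phi c2).1.
  exists c1, m0; left; apply: (enclosing_between D low lev box vc1 vc2 vm0) => //.
  - by rewrite adj_sym.
  - by rewrite eq_sym.
  - exact: max.
  - by left.
(* Both common neighbours lie to the left. In the mirror image they lie to the right, where their
   order can be read off, and [m0] plays the left corner. *)
have D' := monotone_flip_x D.
have low' : lowest (map_vertices flip_x phi) v by [].
have [tau' [t' [lev' box']]] := good_level D' low'.
have x1' : (map_vertices flip_x phi v).1 <= (map_vertices flip_x phi c1).1 by rewrite /= lerN2.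
have x2' : (map_vertices flip_x phi v).1 <= (map_vertices flip_x phi c2).1 by rewrite /= lerN2.
have xm' : (map_vertices flip_x phi m0).1 <= (map_vertices flip_x phi v).1 by rewrite /= lerN2.
have := level_inj D' lev' vc1 vc2 x1' x2' c12; rewrite neq_lt => /orP[] lt.
  exists m0, c2; right; apply: (enclosing_between D' low' lev' box' vm0 vc1 vc2) => //.
  by left.
exists m0, c1; right; apply: (enclosing_between D' low' lev' box' vm0 vc2 vc1) => //.
by left.
Qed.

Lemma flip_xK : involutive flip_x.
Proof. by case=> x y; rewrite /flip_x /= opprK. Qed.

Lemma lowest_enclosed phi c v : monotone_drawing phi c -> lowest phi v ->
  exists a b, enclosing_up_to_flip phi c v a b.
Proof.
move=> D low; have [u vu] := has_neighbor v.
have [x|/ltW x] := leP (phi v).1 (phi u).1; first exact: (lowest_enclosed_half D low vu).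
have low' : lowest (map_vertices flip_x phi) v by [].
have [|a [b [E|E]]] := lowest_enclosed_half (monotone_flip_x D) low' vu.
- by rewrite /= lerN2.
- by exists a, b; right.
exists a, b; left; move: E.
have -> : map_vertices flip_x (map_vertices flip_x phi) = phi.
  by apply/funext => w; rewrite /map_vertices flip_xK.
suff -> : map_edges flip_x (map_edges flip_x c) = c by [].
by apply/funext => w; apply/funext => w'; apply/funext => s; rewrite /map_edges flip_xK.
Qed.

End Enclosing.

(** * Locally extreme vertices and the exceptional triangle *)

Section Extremes.
Context {R : realType} {G : sgraph}.
Local Open Scope classical_set_scope.
Local Open Scope ring_scope.
Notation plane := (R * R)%type.
Notation I01 := `[0%R, 1%R]%classic.
Implicit Types (phi : G -> plane) (c : G -> G -> R -> plane) (u v w a b d m : G).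

Lemma crosses_below_above phi c a b (y : R) (p : plane) : monotone_drawing phi c -> adj a b ->
  y <= (phi a).2 -> y <= (phi b).2 -> crosses_below (c a b) p -> y < p.2.
Proof.
move=> D ab ya yb /andP[_ /asboolP[t [tI _ lt]]]; apply: le_lt_trans lt.
by apply: (monotone_on_min (mdrawing_y D ab)) => //;
  rewrite ?(drawing_start (mdrawing_plane D) ab) ?(drawing_end (mdrawing_plane D) ab).
Qed.

(** An odd parity means that some edge passes below the vertex, and a monotone edge never goes below
    both of its ends. *)
Lemma enclosing_above phi c a b d w (y : R) : monotone_drawing phi c ->
  enclosing phi c a b d -> w \notin [:: a; b; d] ->
  y <= (phi a).2 -> y <= (phi b).2 -> y <= (phi d).2 -> y < (phi w).2.
Proof.
move=> D [ab bd da enc] /enc; rewrite /triangle_parity => par ya yb yd.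
have h u v := @crosses_below_above phi c u v y (phi w) D.
move: par; case E1: (crosses_below (c a b) _); first by move=> _; apply: (h a b).
case E2: (crosses_below (c b d) _); first by move=> _; apply: (h b d).
by case E3: (crosses_below (c d a) _) => // _; apply: (h d a).
Qed.

Lemma enclosing_interior phi c a b d v : monotone_drawing phi c ->
  enclosing phi c a b d -> v \notin [:: a; b; d] ->
  [/\ ~ (forall w, (phi v).2 <= (phi w).2), ~ (forall w, (phi w).2 <= (phi v).2),
      ~ (forall w, (phi v).1 <= (phi w).1) & ~ (forall w, (phi w).1 <= (phi v).1)].
Proof.
move=> D E vT; have [ab bd da enc] := E; have par := enc v vT.
have DP := mdrawing_plane D.
move: (vT); rewrite !inE !negb_or => /and3P[va vb vd].
have S u w : adj u w -> c u w 0 = phi u := drawing_start DP (u := u) (w := w).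
have F u w : adj u w -> c u w 1 = phi w := drawing_end DP (u := u) (w := w).
split=> ext.
- by have := enclosing_above D E vT (ext a) (ext b) (ext d); rewrite ltxx.
(* Every edge is below a vertex of maximal height, so a crossing only records a change of side with
   respect to its abscissa; around a triangle such changes are even in number. *)
- have cE u w : adj u w -> v != u -> v != w ->
      crosses_below (c u w) (phi v) = ((phi u).1 <= (phi v).1) (+) ((phi w).1 <= (phi v).1).
    move=> uw vu vw; rewrite /crosses_below S ?F //; case B: (_ (+) _) => //=.
    have cc := continuous_fst_on (drawing_continuous DP uw).
    have [|t tI et] := monotone_on_ivt (y := (phi v).1) cc (lexx 0) ler01 (lexx 1).
      rewrite S ?F //.
      by move: B; case: leP => h1; case: leP => h2 //= _; [left|right]; rewrite ltW.
    apply/asboolP; exists t; split=> //; rewrite lt_neqAle; apply/andP; split.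
      apply/eqP => e; apply: (vertex_off_edge DP uw vu vw); exists t; first exact: in_I01.
      by rewrite (surjective_pairing (c u w t)) et e -surjective_pairing.
    by apply: (monotone_on_max (mdrawing_y D uw)) => //; rewrite ?S ?F.
  move: par; rewrite /triangle_parity !cE //.
  by do 3!case: (_ <= _).
- have xc u w : adj u w -> x_monotone_curve (c u w).
    by move=> uw; split; [exact: (drawing_continuous DP uw)|exact: (mdrawing_x D uw)].
  have [|||||||||e e0 eP] := @triangle_parity_near _ (c a b) (c b d) (c d a) (phi v);
    try exact: xc; try exact: vertex_off_edge; try by rewrite S // F.
  (* Corners with the same abscissa as [v] count as lying to its left. A small shift to the left
     keeps the parity and puts all corners strictly to the right. *)
  have := eP ((phi v).1 - e / 2, (phi v).2); rewrite par.
  have -> : near_box e ((phi v).1 - e / 2, (phi v).2) (phi v).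
    rewrite /near_box /= subrr normr0 e0 andbT addrAC subrr add0r normrN ger0_norm; lra.
  move=> /(_ isT); rewrite /triangle_parity /crosses_below !S ?F //=.
  have lf u : ((phi u).1 <= (phi v).1 - e / 2) = false.
    by apply/negbTE; rewrite -ltNge; have := ext u; lra.
  by rewrite !lf.
- move: par; rewrite /triangle_parity /crosses_below !S ?F //=.
  by rewrite !ext.
Qed.

(** In order: no neighbour lies strictly below, above, to the left, to the right. *)
Definition extreme phi v : Prop :=
  [\/ lowest phi v, lowest (map_vertices flip_y phi) v, lowest (map_vertices swap_xy phi) v
    | lowest (map_vertices flip_y (map_vertices swap_xy phi)) v].

Hypothesis conn : forall S : {set G}, (#|S| < 4)%N ->
  forall x y : G, x \notin S -> y \notin S -> connect (adj_avoid S) x y.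
Hypothesis link : forall v u, adj v u -> exists u1 u2,
  [/\ u1 != u2, adj v u1, adj v u2, adj u u1 & adj u u2].
Hypothesis has_neighbor : forall v, exists w, adj v w.

(** A triangle at [v] encloses all vertices off it, and its other two corners are neighbours of
    [v]. *)
Lemma lowest_global phi c v : monotone_drawing phi c -> lowest phi v ->
  forall w, (phi v).2 <= (phi w).2.
Proof.
move=> D low w.
have [a [b E]] := lowest_enclosed conn link has_neighbor D low.
have [|wT] := boolP (w \in [:: v; a; b]).
  have [va bv] : adj v a /\ adj b v by case: E => -[].
  by rewrite !inE => /or3P[] /eqP -> //; apply: low => //; rewrite adj_sym.
have [va bv] : adj v a /\ adj b v by case: E => -[].
have ya := low a va; have yb : (phi v).2 <= (phi b).2 by apply: low; rewrite adj_sym.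
apply/ltW; case: E => E; first exact: (enclosing_above D E wT).
exact: (enclosing_above (monotone_flip_x D) E wT).
Qed.

(** The triangle is the one at a lowest vertex. It encloses all vertices off it, and an enclosed
    vertex is globally extreme in no direction, hence not locally extreme either. *)
Lemma extremes_in_triangle phi c : G -> monotone_drawing phi c -> exists a b d,
  [/\ adj a b, adj b d, adj d a & forall v, extreme phi v -> v \in [:: a; b; d]].
Proof.
move=> x0 D.
have [v _ vmin] : exists2 v : G, true & forall w, (phi v).2 <= (phi w).2.
  by case: (@Order.TotalTheory.arg_minP _ _ _ x0 predT (fun w => (phi w).2) isT) => v _ h;
    exists v => // w; apply: h.
have [a [b E]] := lowest_enclosed conn link has_neighbor D (fun w _ => vmin w).
exists v, a, b.
have [va ab bv] : [/\ adj v a, adj a b & adj b v] by case: E => -[].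
split=> // w ext; apply/negPn/negP => wT.
have glob : [\/ forall u, (phi w).2 <= (phi u).2, forall u, (phi u).2 <= (phi w).2,
    forall u, (phi w).1 <= (phi u).1 | forall u, (phi u).1 <= (phi w).1].
  have Dy := monotone_flip_y D; have Ds := monotone_swap_xy D; have Dsy := monotone_flip_y Ds.
  case: ext => low.
  - by apply: Or41 => u; apply: (lowest_global D low).
  - by apply: Or42 => u; have := lowest_global Dy low u; rewrite /= lerN2.
  - by apply: Or43 => u; have := lowest_global Ds low u.
  - by apply: Or44 => u; have := lowest_global Dsy low u; rewrite /= lerN2.
case: E => E.
  by have [n1 n2 n3 n4] := enclosing_interior D E wT; case: glob.
have [n1 n2 n3 n4] := enclosing_interior (monotone_flip_x D) E wT.
case: glob => // g; [apply: n4|apply: n3] => u; by rewrite /= lerN2.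
Qed.

End Extremes.

(** * The neighbours of a non-extreme vertex *)

Section Lens.
Context {R : realType} {G : sgraph}.
Local Open Scope classical_set_scope.
Local Open Scope ring_scope.
Notation plane := (R * R)%type.
Notation I01 := `[0%R, 1%R]%classic.
Implicit Types (u v w a b : G) (p : plane).

Hypothesis conn : forall S : {set G}, (#|S| < 4)%N ->
  forall x y : G, x \notin S -> y \notin S -> connect (adj_avoid S) x y.

(* The new abscissa [x + y] is monotone along a southwest-northeast edge, so the parity
   argument applies along antidiagonals. *)
Definition shear p : plane := (p.1 + p.2, - p.1).

Lemma shear_inj : injective shear.
Proof. by move=> [x y] [x' y'] [/= e1 /oppr_inj e2]; move: e1; rewrite e2 => /addrI ->. Qed.

Lemma shear_cont (f : R -> plane) :
  {within I01, continuous f} -> {within I01, continuous (shear \o f)}.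
Proof.
move=> fc; apply: pair_cont; last by apply: opp_cont; exact: continuous_fst_on.
by move=> x; apply: cvgD; [exact: (continuous_fst_on fc)|exact: (continuous_snd_on fc)].
Qed.

Variables (phi : G -> plane) (c : G -> G -> R -> plane).
Hypothesis D : monotone_drawing phi c.
Let DP := mdrawing_plane D.

Definition southwest (p q : plane) : Prop := p.1 <= q.1 /\ p.2 <= q.2.
Definition northwest (p q : plane) : Prop := p.1 <= q.1 /\ q.2 <= p.2.

Lemma southwest_edge u w s t : adj u w -> southwest (phi u) (phi w) ->
  0 <= s -> s <= t -> t <= 1 -> southwest (c u w s) (c u w t).
Proof. by move=> uw [x y] s0 st t1; split; [exact: (spoke_x D uw)|exact: (spoke_y D uw)]. Qed.

Lemma southwest_diag_lt u w : u != w -> southwest (phi u) (phi w) ->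
  (phi u).1 + (phi u).2 < (phi w).1 + (phi w).2.
Proof.
move=> uw [x y]; rewrite lt_neqAle lerD // andbT; apply: contraNneq uw => e; apply/eqP.
apply: (drawing_vertex_inj DP).
by rewrite (surjective_pairing (phi u)) (surjective_pairing (phi w)); congr (_, _); lra.
Qed.

Lemma diag_monotone u w : adj u w -> southwest (phi u) (phi w) \/ southwest (phi w) (phi u) ->
  monotone_on (fun t => (shear (c u w t)).1).
Proof.
move=> uw [sw|sw]; [left|right] => s t s0 st t1 /=.
  by have [? ?] := southwest_edge uw sw s0 st t1; rewrite lerD.
have wu : adj w u by rewrite adj_sym.
have rv r : 0 <= r -> r <= 1 -> c u w r = c w u (1 - r).
  by move=> r0 r1; rewrite (drawing_reverse DP wu) //= in_itv /= r0.
have [||| ? ?] := @southwest_edge w u (1 - t) (1 - s) wu sw; try lra.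
by rewrite !rv ?lerD //; lra.
Qed.

Lemma diag_fiber u w (y : R) : adj u w -> southwest (phi u) (phi w) ->
  (phi u).1 + (phi u).2 <= y -> y <= (phi w).1 + (phi w).2 ->
  exists2 t, 0 <= t <= 1 & (c u w t).1 + (c u w t).2 = y.
Proof.
move=> uw sw y0 y1.
have hc := continuous_fst_on (shear_cont (drawing_continuous DP uw)).
have [|t tI e] := monotone_on_ivt (y := y) hc (lexx 0) ler01 (lexx 1); last by exists t.
by left; rewrite /= (drawing_start DP uw) (drawing_end DP uw) y0.
Qed.

(** In sheared coordinates, passing below a point means passing southeast of it on the same
    antidiagonal. *)
Lemma crosses_diag u w t p : adj u w -> southwest (phi u) (phi w) ->
  (phi u).1 + (phi u).2 <= p.1 + p.2 -> p.1 + p.2 < (phi w).1 + (phi w).2 ->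
  0 <= t <= 1 -> (c u w t).1 + (c u w t).2 = p.1 + p.2 ->
  crosses_below (shear \o c u w) (shear p) = (p.1 < (c u w t).1).
Proof.
move=> uw sw pu pw tI et; rewrite /crosses_below /= (drawing_start DP uw) (drawing_end DP uw) pu.
rewrite leNgt pw /=; apply/asboolP/idP => [[s [sI /= es]]|lt]; last first.
  by exists t; split=> //=; rewrite ltrN2.
rewrite ltrN2 => lt.
have [s0 s1] := andP sI; have [t0 t1] := andP tI.
have [le|/ltW le] := leP s t.
  by have [? ?] := southwest_edge uw sw s0 le t1; lra.
by have [? ?] := southwest_edge uw sw t0 le s1; lra.
Qed.

Lemma crosses_diag_out u w p : adj u w ->
  ((phi u).1 + (phi u).2 <= p.1 + p.2) = ((phi w).1 + (phi w).2 <= p.1 + p.2) ->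
  crosses_below (shear \o c u w) (shear p) = false.
Proof.
by move=> uw e; rewrite /crosses_below /= (drawing_start DP uw) (drawing_end DP uw) e addbb.
Qed.

Section AtVertex.
Variables v a b : G.
Hypotheses (av : adj a v) (vb : adj v b) (ba : adj b a).
Hypotheses (swa : southwest (phi a) (phi v)) (swb : southwest (phi v) (phi b)).

(* The side of the chain [a v b] on which [p] lies, along its antidiagonal. *)
Definition above_chain p : bool :=
  crosses_below (shear \o c a v) (shear p) (+) crosses_below (shear \o c v b) (shear p).

(** The far ends of all other spokes are on one side of the triangle [avb]. Near [v] the third edge
    [ba] contributes a constant, since [v] is not on it; what remains of the parity is the side of
    the chain. *)
Lemma lens_side : exists2 e, 0 < e & forall w w' t t',
  adj v w -> adj v w' -> w \notin [:: a; b] -> w' \notin [:: a; b] ->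
  0 < t <= 1 -> 0 < t' <= 1 -> near_box e (c v w t) (phi v) -> near_box e (c v w' t') (phi v) ->
  above_chain (c v w t) = above_chain (c v w' t').
Proof.
have swab : southwest (phi a) (phi b).
  by case: swa => ? ?; case: swb => ? ?; split; apply: le_trans; eassumption.
have T : x_monotone_triangle c shear a v b.
  by split=> //; split; apply: diag_monotone => //; [left|left|right].
have la := southwest_diag_lt (adj_neq av) swa.
have lb := southwest_diag_lt (adj_neq vb) swb.
have off : ~ curve_image (shear \o c b a) (shear (phi v)).
  case=> t tI /= /shear_inj e.
  by apply: (vertex_off_edge DP ba (adj_neq vb)); [rewrite eq_sym adj_neq|exists t].
have [d d0 dP] := crosses_below_near (shear_cont (drawing_continuous DP ba))
  (diag_monotone ba (or_intror swab)) off.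
(* Within [m / 2] in each coordinate the coordinate sum changes by less than [m], so the
   antidiagonal stays strictly between those of [a] and [b], and the ends of [ba] cause no
   correction. *)
pose m := Num.min d (Num.min ((phi v).1 + (phi v).2 - ((phi a).1 + (phi a).2))
  ((phi b).1 + (phi b).2 - ((phi v).1 + (phi v).2))).
have m0 : 0 < m by rewrite /m !lt_min d0 !subr_gt0 la lb.
have base p : near_box (m / 2) p (phi v) ->
    crosses_below (shear \o c b a) (shear p) = crosses_below (shear \o c b a) (shear (phi v)).
  move=> /andP[b1 b2].
  have [[h1 h2] [h3 h4]] : (- (m/2) < p.1 - (phi v).1 /\ p.1 - (phi v).1 < m/2) /\
      (- (m/2) < p.2 - (phi v).2 /\ p.2 - (phi v).2 < m/2).
    by move: b1 b2; rewrite !ltr_norml => /andP[-> ->] /andP[-> ->].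
  have [md ma mb] : [/\ m <= d, m <= (phi v).1 + (phi v).2 - ((phi a).1 + (phi a).2) &
      m <= (phi b).1 + (phi b).2 - ((phi v).1 + (phi v).2)].
    by rewrite /m !ge_min !lexx !orbT.
  have nb : near_box d (shear p) (shear (phi v)).
    by rewrite /near_box /= !ltr_norml; apply/andP; split; apply/andP; split; lra.
  have := dP _ nb; rewrite /= (drawing_start DP ba) (drawing_end DP ba).
  have -> : ((phi b).1 + (phi b).2 <= p.1 + p.2) = false by apply/negbTE; rewrite -ltNge; lra.
  have -> : ((phi b).1 + (phi b).2 <= (phi v).1 + (phi v).2) = false by apply/negbTE; rewrite -ltNge; lra.
  have -> : ((phi a).1 + (phi a).2 <= p.1 + p.2) = true by lra.
  have -> : ((phi a).1 + (phi a).2 <= (phi v).1 + (phi v).2) = true by lra.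
  by case: (crosses_below _ _); case: (crosses_below _ _).
exists (m / 2); first lra.
have side w t : adj v w -> w \notin [:: a; b] -> 0 < t <= 1 -> near_box (m / 2) (c v w t) (phi v) ->
    w \notin [:: a; v; b] /\ above_chain (c v w t) = triangle_side c shear a v b (phi w) (+)
      crosses_below (shear \o c b a) (shear (phi v)).
  move=> vw wab /andP[t0 t1] nb.
  have wT : w \notin [:: a; v; b].
    by move: wab; rewrite !inE !negb_or => /andP[-> ->]; rewrite eq_sym adj_neq.
  split=> //.
  have tI : 0 <= t <= 1 by rewrite (ltW t0).
  rewrite -(triangle_side_path DP shear_inj shear_cont T vw wT tI (fun=> t0)).
  by rewrite /triangle_side /triangle_parity base // /above_chain -addbA addbb addbF.
move=> w w' t t' vw vw' wab wab' tI tI' nb nb'.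
have [wT ->] := side w t vw wab tI nb; have [wT' ->] := side w' t' vw' wab' tI' nb'.
by rewrite (triangle_side_const DP shear_inj shear_cont conn T wT wT').
Qed.

Lemma above_right t p : 0 <= t <= 1 -> (c v b t).1 + (c v b t).2 = p.1 + p.2 ->
  (phi v).1 + (phi v).2 <= p.1 + p.2 -> p.1 + p.2 < (phi b).1 + (phi b).2 ->
  above_chain p = (p.1 < (c v b t).1).
Proof.
move=> tI e h1 h2; rewrite /above_chain (crosses_diag_out av); last first.
  by have := southwest_diag_lt (adj_neq av) swa; rewrite h1; lra.
by rewrite (crosses_diag vb swb h1 h2 tI e).
Qed.

Lemma above_left t p : 0 <= t <= 1 -> (c a v t).1 + (c a v t).2 = p.1 + p.2 ->
  (phi a).1 + (phi a).2 <= p.1 + p.2 -> p.1 + p.2 < (phi v).1 + (phi v).2 ->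
  above_chain p = (p.1 < (c a v t).1).
Proof.
move=> tI e h1 h2; rewrite /above_chain (crosses_diag_out vb); last first.
  have := southwest_diag_lt (adj_neq vb) swb; rewrite leNgt h2 => lt.
  by symmetry; apply/negbTE; rewrite -ltNge; lra.
by rewrite (crosses_diag av swa h1 h2 tI e) addbF.
Qed.

Lemma diag_range_near : exists2 e, 0 < e & forall p, near_box e p (phi v) ->
  (phi a).1 + (phi a).2 <= p.1 + p.2 /\ p.1 + p.2 < (phi b).1 + (phi b).2.
Proof.
have la := southwest_diag_lt (adj_neq av) swa.
have lb := southwest_diag_lt (adj_neq vb) swb.
exists (Num.min ((phi v).1 + (phi v).2 - ((phi a).1 + (phi a).2))
  ((phi b).1 + (phi b).2 - ((phi v).1 + (phi v).2)) / 2).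
  by rewrite divr_gt0 // lt_min !subr_gt0 la.
set m := Num.min _ _.
have [ma mb] : m <= (phi v).1 + (phi v).2 - ((phi a).1 + (phi a).2) /\
    m <= (phi b).1 + (phi b).2 - ((phi v).1 + (phi v).2).
  by rewrite /m !ge_min !lexx !orbT.
by move=> p /andP[]; rewrite !ltr_norml => /andP[? ?] /andP[? ?]; split; lra.
Qed.

Lemma spoke_off_chain w t : adj v w -> w \notin [:: a; b] -> 0 < t <= 1 ->
  (forall s, 0 <= s <= 1 -> c a v s <> c v w t) /\ (forall s, 0 <= s <= 1 -> c v b s <> c v w t).
Proof.
rewrite !inE negb_or => vw /andP[wa wb] /andP[t0 t1].
have wv : w != v by rewrite eq_sym adj_neq.
have tI : 0 <= t <= 1 by rewrite (ltW t0).
split=> s sI e.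
  by apply: (edge_avoid DP vw av wa wv tI (fun=> t0)); exists s => //; exact: in_I01.
by apply: (edge_avoid DP vw vb wv wb tI (fun=> t0)); exists s => //; exact: in_I01.
Qed.

Lemma northwest_spoke w t : adj v w -> northwest (phi w) (phi v) -> 0 <= t <= 1 ->
  northwest (c v w t) (phi v).
Proof.
move=> vw [x y] tI; split.
  by apply: (monotone_on_max (mdrawing_x D vw)) => //; rewrite ?(drawing_start DP vw) ?(drawing_end DP vw).
by apply: (monotone_on_min (mdrawing_y D vw)) => //; rewrite ?(drawing_start DP vw) ?(drawing_end DP vw).
Qed.

Lemma southeast_spoke w t : adj v w -> northwest (phi v) (phi w) -> 0 <= t <= 1 ->
  northwest (phi v) (c v w t).
Proof.
move=> vw [x y] tI; split.
  by apply: (monotone_on_min (mdrawing_x D vw)) => //; rewrite ?(drawing_start DP vw) ?(drawing_end DP vw).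
by apply: (monotone_on_max (mdrawing_y D vw)) => //; rewrite ?(drawing_start DP vw) ?(drawing_end DP vw).
Qed.

(** A point of the chain on the antidiagonal of [p] decides the side; its position relative to [v]
    is what makes the comparison with northwest and southeast spokes possible. *)
Lemma chain_fiber p : (phi a).1 + (phi a).2 <= p.1 + p.2 -> p.1 + p.2 < (phi b).1 + (phi b).2 ->
  exists q, [/\ q.1 + q.2 = p.1 + p.2, above_chain p = (p.1 < q.1),
    southwest q (phi v) \/ southwest (phi v) q &
    exists2 s, 0 <= s <= 1 & q = c a v s \/ q = c v b s].
Proof.
move=> pa pb; have [h|/ltW h] := leP ((phi v).1 + (phi v).2) (p.1 + p.2).
  have [s sI es] := diag_fiber vb swb h (ltW pb).
  exists (c v b s); split=> //; [exact: above_right|right|by exists s => //; right].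
  have [s0 s1] := andP sI; have [? ?] := southwest_edge vb swb (lexx 0) s0 s1.
  by rewrite -(drawing_start DP vb).
have [e|ne] := eqVneq (p.1 + p.2) ((phi v).1 + (phi v).2).
  have [|s sI es] := diag_fiber vb swb _ (ltW pb); first by rewrite e.
  exists (c v b s); split=> //; [by apply: above_right => //; rewrite e|right|by exists s => //; right].
  have [s0 s1] := andP sI; have [? ?] := southwest_edge vb swb (lexx 0) s0 s1.
  by rewrite -(drawing_start DP vb).
have lt : p.1 + p.2 < (phi v).1 + (phi v).2 by rewrite lt_neqAle ne.
have [s sI es] := diag_fiber av swa pa h.
exists (c a v s); split=> //; [exact: above_left|left|by exists s => //; left].
have [s0 s1] := andP sI; have [? ?] := southwest_edge av swa s0 s1 (lexx 1).
by rewrite -(drawing_end DP av).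
Qed.

Lemma above_northwest w t : adj v w -> w \notin [:: a; b] -> northwest (phi w) (phi v) ->
  0 < t <= 1 -> (phi a).1 + (phi a).2 <= (c v w t).1 + (c v w t).2 ->
  (c v w t).1 + (c v w t).2 < (phi b).1 + (phi b).2 -> above_chain (c v w t) = true.
Proof.
move=> vw wab nw tI pa pb; have [off1 off2] := spoke_off_chain vw wab tI.
have tI' : 0 <= t <= 1 by case/andP: tI => /ltW ->.
have [x y] := northwest_spoke vw nw tI'.
have [q [eq -> sw [s sI qs]]] := chain_fiber pa pb.
rewrite lt_neqAle; apply/andP; split; last by case: sw => -[? ?]; lra.
apply/eqP => e; have {}e : q = c v w t.
  by rewrite (surjective_pairing q) (surjective_pairing (c v w t)) e; congr (_, _); lra.
by case: qs => qs; [apply: (off1 s)|apply: (off2 s)] => //; rewrite -qs.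
Qed.

Lemma below_southeast w t : adj v w -> northwest (phi v) (phi w) ->
  0 < t <= 1 -> (phi a).1 + (phi a).2 <= (c v w t).1 + (c v w t).2 ->
  (c v w t).1 + (c v w t).2 < (phi b).1 + (phi b).2 -> above_chain (c v w t) = false.
Proof.
move=> vw se tI pa pb.
have tI' : 0 <= t <= 1 by case/andP: tI => /ltW ->.
have [x y] := southeast_spoke vw se tI'.
have [q [eq -> sw _]] := chain_fiber pa pb.
by apply/negbTE; rewrite -leNgt; case: sw => -[? ?]; lra.
Qed.

Lemma point_near w e : adj v w -> 0 < e -> exists2 t, 0 < t <= 1 & near_box e (c v w t) (phi v).
Proof.
move=> vw e0; have [|d d0 dP] := curve_near (r := 0) (drawing_continuous DP vw) _ e0.
  by rewrite lexx ler01.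
exists (Num.min 1 (d / 2)); first by rewrite lt_min ltr01 ge_min lexx /= divr_gt0.
rewrite -(drawing_start DP vw); apply: dP.
  by rewrite ge_min lexx /= le_min ler01 /= divr_ge0 // ltW.
rewrite sub0r normrN ger0_norm; last by rewrite le_min ler01 /= divr_ge0 // ltW.
by rewrite gt_min; apply/orP; right; lra.
Qed.

(** Near [v], a northwest spoke is above the chain and a southeast spoke is not, against
    [lens_side]. *)
Lemma no_opposite_spokes w w' : adj v w -> adj v w' -> w \notin [:: a; b] -> w' \notin [:: a; b] ->
  northwest (phi w) (phi v) -> northwest (phi v) (phi w') -> False.
Proof.
move=> vw vw' wab wab' nw se.
have [e1 e10 side] := lens_side; have [e2 e20 range] := diag_range_near.
have e0 : 0 < Num.min e1 e2 by rewrite lt_min e10.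
have [t tI /near_box_min[nb1 /range[ra rb]]] := point_near vw e0.
have [t' tI' /near_box_min[nb1' /range[ra' rb']]] := point_near vw' e0.
have := side w w' t t' vw vw' wab wab' tI tI' nb1 nb1'.
by rewrite above_northwest // below_southeast.
Qed.

End AtVertex.
Lemma small_positive (s : seq R) : all (fun x => 0 < x) s ->
  exists2 tau, 0 < tau & all (fun x => tau < x) s.
Proof.
elim: s => [_|x s IHs /= /andP[x0 /IHs[tau tau0 taus]]]; first by exists 1.
exists (Num.min tau (x / 2)); first by rewrite lt_min tau0 divr_gt0.
rewrite gt_min; apply/andP; split; first by apply/orP; right; lra.
by apply: sub_all taus => y ty; rewrite gt_min ty.
Qed.

Lemma southwest_near (p q : plane) tau e : southwest q p -> p.1 + p.2 = q.1 + q.2 + tau ->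
  tau < e -> near_box e p q.
Proof.
move=> [x y] eq te; rewrite /near_box !ger0_norm ?subr_ge0 //; apply/andP; split; lra.
Qed.

Lemma northeast_near (p q : plane) tau e : southwest p q -> p.1 + p.2 = q.1 + q.2 - tau ->
  tau < e -> near_box e p q.
Proof.
move=> [x y] eq te; rewrite /near_box [`|p.1 - _|]distrC [`|p.2 - _|]distrC !ger0_norm ?subr_ge0 //; apply/andP; split; lra.
Qed.

Lemma level_near v b tau t e : adj v b -> southwest (phi v) (phi b) ->
  level_point phi c v b tau t -> tau < e -> near_box e (c v b t) (phi v).
Proof.
move=> vb swb [/andP[t0 t1] et]; apply: southwest_near et.
by have := southwest_edge vb swb (lexx 0) t0 t1; rewrite (drawing_start DP vb).
Qed.

Lemma level_pos v x tau t : adj v x -> 0 < tau -> level_point phi c v x tau t -> 0 < t <= 1.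
Proof.
move=> vx tau0 [/andP[t0 t1] et]; rewrite t1 andbT lt_neqAle t0 andbT.
by apply: contraTneq tau0 => t00; move: et; rewrite -t00 (drawing_start DP vx) -leNgt; lra.
Qed.

(** The spoke to [w] is above both chains, so by [lens_side] the edge [vb'] is above the chain [avb]
    and [vb] is above [avb']. On a common antidiagonal each of the two would precede the other. *)
Lemma no_fork v a b b' w : adj a v -> adj v b -> adj v b' -> adj b a -> adj b' a -> b != b' ->
  southwest (phi a) (phi v) -> southwest (phi v) (phi b) -> southwest (phi v) (phi b') ->
  adj v w -> w \notin [:: a; b; b'] -> northwest (phi w) (phi v) -> False.
Proof.
move=> av vb vb' ba b'a bb' swa swb swb' vw; rewrite !inE !negb_or => /and3P[wa wb wb'] nw.
have wab : w \notin [:: a; b] by rewrite !inE negb_or wa.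
have wab' : w \notin [:: a; b'] by rewrite !inE negb_or wa.
have bab' : b \notin [:: a; b'] by rewrite !inE negb_or adj_neq.
have b'ab : b' \notin [:: a; b] by rewrite !inE negb_or [b' == b]eq_sym adj_neq.
have [e1 e10 side1] := lens_side av vb ba swa swb.
have [e2 e20 side2] := lens_side av vb' b'a swa swb'.
have [e3 e30 range1] := diag_range_near av vb swa swb.
have [e4 e40 range2] := diag_range_near av vb' swa swb'.
have [e e0 eP] : exists2 e, 0 < e & forall p q, near_box e p q ->
    [/\ near_box e1 p q, near_box e2 p q, near_box e3 p q & near_box e4 p q].
  exists (Num.min (Num.min e1 e2) (Num.min e3 e4)); first by rewrite !lt_min e10 e20 e30.
  by move=> p q /near_box_min[/near_box_min[? ?] /near_box_min[? ?]].
have lb := southwest_diag_lt (adj_neq vb) swb.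
have lb' := southwest_diag_lt (adj_neq vb') swb'.
have [tau tau0 /and4P[taue taub taub' _]] := @small_positive [:: e;
    (phi b).1 + (phi b).2 - ((phi v).1 + (phi v).2);
    (phi b').1 + (phi b').2 - ((phi v).1 + (phi v).2)] ltac:(by rewrite /= e0 !subr_gt0 lb lb').
have pos := level_pos _ tau0.
have [t lt] := level_point_exists D vb (ltW tau0) (ltW taub).
have [t' lt'] := level_point_exists D vb' (ltW tau0) (ltW taub').
rewrite ltrBrDl in taub; rewrite ltrBrDl in taub'.
have /eP[n1 n2 n3 n4] := level_near vb swb lt taue.
have /eP[n1' n2' n3' n4'] := level_near vb' swb' lt' taue.
have [s sI /eP[m1 m2 m3 m4]] := point_near vw e0.
have [[tI et] [tI' et']] := (lt, lt').
have [r1 r1'] := range1 _ m3; have [r2 r2'] := range2 _ m4.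
have A1 := above_northwest av vb swa swb vw wab nw sI r1 r1'.
have A2 := above_northwest av vb' swa swb' vw wab' nw sI r2 r2'.
have V : (phi v).1 + (phi v).2 <= (phi v).1 + (phi v).2 + tau by rewrite lerDl ltW.
have B1 : above_chain v a b (c v b' t') = ((c v b' t').1 < (c v b t).1).
  by apply: (above_right av vb swa swb tI); rewrite ?et ?et'.
have B2 : above_chain v a b' (c v b t) = ((c v b t).1 < (c v b' t').1).
  by apply: (above_right av vb' swa swb' tI'); rewrite ?et ?et'.
have := side1 w b' s t' vw vb' wab b'ab sI (pos _ _ _ vb' lt') m1 n1'.
have := side2 w b s t vw vb wab' bab' sI (pos _ _ _ vb lt) m2 n2.
rewrite A1 A2 B1 B2 => /esym h1 /esym /(lt_trans h1).
by rewrite ltxx.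
Qed.

(** Both chains [avb] and [a'vb] are compared with [vb']. The first says that [b'] precedes [b]
    exactly when [a'] precedes [a], the second exactly when [a] precedes [a']; hence the edges from
    [a] and [a'] meet before [v]. *)
Lemma no_square v a a' b b' : adj a v -> adj a' v -> adj v b -> adj v b' ->
  adj b a -> adj b a' -> adj b' a -> adj b' a' -> a != a' -> b != b' ->
  southwest (phi a) (phi v) -> southwest (phi a') (phi v) ->
  southwest (phi v) (phi b) -> southwest (phi v) (phi b') -> False.
Proof.
move=> av a'v vb vb' ba ba' b'a b'a' aa' bb' swa swa' swb swb'.
have va : adj v a by rewrite adj_sym.
have va' : adj v a' by rewrite adj_sym.
have b'ab : b' \notin [:: a; b] by rewrite !inE negb_or [b' == b]eq_sym adj_neq.
have a'ab : a' \notin [:: a; b] by rewrite !inE negb_or [a' == a]eq_sym aa' eq_sym adj_neq.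
have b'a'b : b' \notin [:: a'; b] by rewrite !inE negb_or [b' == b]eq_sym adj_neq.
have aa'b : a \notin [:: a'; b] by rewrite !inE negb_or aa' eq_sym adj_neq.
have [e1 e10 side1] := lens_side av vb ba swa swb.
have [e2 e20 side2] := lens_side a'v vb ba' swa' swb.
have [e e0 eP] : exists2 e, 0 < e & forall p q, near_box e p q ->
    near_box e1 p q /\ near_box e2 p q.
  by exists (Num.min e1 e2); [rewrite lt_min e10|move=> p q /near_box_min].
have lb := southwest_diag_lt (adj_neq vb) swb.
have lb' := southwest_diag_lt (adj_neq vb') swb'.
have la := southwest_diag_lt (adj_neq av) swa.
have la' := southwest_diag_lt (adj_neq a'v) swa'.
have [tau tau0 /and5P[taue taub taub' taua /andP[taua' _]]] := @small_positive [:: e;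
    (phi b).1 + (phi b).2 - ((phi v).1 + (phi v).2);
    (phi b').1 + (phi b').2 - ((phi v).1 + (phi v).2);
    (phi v).1 + (phi v).2 - ((phi a).1 + (phi a).2);
    (phi v).1 + (phi v).2 - ((phi a').1 + (phi a').2)]
    ltac:(by rewrite /= e0 !subr_gt0 lb lb' la la').
have [t lt] := level_point_exists D vb (ltW tau0) (ltW taub).
have [t' lt'] := level_point_exists D vb' (ltW tau0) (ltW taub').
rewrite ltrBrDl in taub; rewrite ltrBrDl in taub'.
rewrite ltrBrDl -ltrBrDr in taua; rewrite ltrBrDl -ltrBrDr in taua'.
have /eP[n1 n2] := level_near vb' swb' lt' taue.
have pos' := level_pos vb' tau0 lt'.
have V : (phi v).1 + (phi v).2 <= (phi v).1 + (phi v).2 + tau by rewrite lerDl ltW.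
have V' : (phi v).1 + (phi v).2 - tau < (phi v).1 + (phi v).2 by rewrite ltrBlDr ltrDl.
(* Lower spokes are met on the antidiagonal before [v]; the same point is also read on the edge
   leaving [v], as [lens_side] requires. *)
have lower x : adj x v -> southwest (phi x) (phi v) ->
    (phi x).1 + (phi x).2 < (phi v).1 + (phi v).2 - tau ->
    exists s, [/\ 0 <= s <= 1, (c x v s).1 + (c x v s).2 = (phi v).1 + (phi v).2 - tau,
      near_box e (c x v s) (phi v) & 0 < 1 - s <= 1 /\ c v x (1 - s) = c x v s].
  move=> xv swx tx; have [s sI es] := diag_fiber xv swx (ltW tx) (ltW V').
  have [s0 s1] := andP sI.
  exists s; split=> //.
    apply: northeast_near es taue.
    by have := southwest_edge xv swx s0 s1 (lexx 1); rewrite (drawing_end DP xv).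
  have s1' : s != 1.
    by apply/eqP => s1'; move: V'; rewrite -es s1' (drawing_end DP xv) ltxx.
  have lt1 : s < 1 by rewrite lt_neqAle s1'.
  have vx : adj v x by rewrite adj_sym.
  split; first by rewrite subr_gt0 lt1 gerBl.
  by rewrite (drawing_reverse DP xv) ?subKr //=; rewrite in_itv /= subr_ge0 s1 gerBl.
have [s [sI es /eP[m1 m2] [pos1 rs]]] := lower a av swa taua.
have [s' [sI' es' /eP[m1' m2'] [pos1' rs']]] := lower a' a'v swa' taua'.
have [[tI et] [tI' et']] := (lt, lt').
have B1 : above_chain v a b (c v b' t') = ((c v b' t').1 < (c v b t).1).
  by apply: (above_right av vb swa swb tI); rewrite ?et ?et'.
have B2 : above_chain v a' b (c v b' t') = ((c v b' t').1 < (c v b t).1).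
  by apply: (above_right a'v vb swa' swb tI); rewrite ?et ?et'.
have B3 : above_chain v a b (c a' v s') = ((c a' v s').1 < (c a v s).1).
  by apply: (above_left av vb swa swb sI); rewrite ?es ?es' ?(ltW taua).
have B4 : above_chain v a' b (c a v s) = ((c a v s).1 < (c a' v s').1).
  by apply: (above_left a'v vb swa' swb sI'); rewrite ?es ?es' ?(ltW taua').
have := side1 b' a' t' (1 - s') vb' va' b'ab a'ab pos' pos1'.
rewrite rs' => /(_ n1 m1').
have := side2 b' a t' (1 - s) vb' va b'a'b aa'b pos' pos1.
rewrite rs => /(_ n2 m2).
rewrite B1 B2 B3 B4 => -> eq.
have xeq : (c a v s).1 = (c a' v s').1 by move: eq; case: ltgtP.
have yeq : (c a v s).2 = (c a' v s').2 by apply: (@addrI _ (c a v s).1); rewrite es xeq es'.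
have sa'I : 0 <= 1 - s <= 1 by case/andP: pos1 => /ltW -> ->.
apply: (edge_avoid DP va a'v aa' _ sa'I); first by rewrite adj_neq.
  by case/andP: pos1.
exists s'; first exact: in_I01.
by rewrite rs (surjective_pairing (c a v s)) (surjective_pairing (c a' v s')) xeq yeq.
Qed.

End Lens.

(** * The directions of the edges at a vertex *)

Section LocalStructure.
Context {R : realType} {G : sgraph}.
Local Open Scope classical_set_scope.
Local Open Scope ring_scope.
Notation plane := (R * R)%type.
Implicit Types (phi : G -> plane) (c : G -> G -> R -> plane) (u v w a b : G).

Hypothesis conn : forall S : {set G}, (#|S| < 4)%N ->
  forall x y : G, x \notin S -> y \notin S -> connect (adj_avoid S) x y.
Hypothesis link_inj : forall v w x y z, adj v w -> adj v x -> adj v y -> adj v z ->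
  adj w x -> adj w y -> adj w z -> [|| x == y, y == z | x == z].
Hypothesis degree4 : forall v x y z, exists w, adj v w /\ w \notin [:: x; y; z].

(** A second northeast neighbour [b'] is refuted with a fourth neighbour [w]. To the northeast, [w]
    would give [v] and [a] three common neighbours; to the southwest it contradicts [no_square];
    otherwise [no_fork] applies, after an exchange of the axes if [w] is southeast. Abstract classes
    instead of quadrants allow reuse in reflected drawings, with the points on the axes still
    assigned as before. *)
Lemma single_source phi c v a b (P0 P1 P2 P3 : pred G) : monotone_drawing phi c ->
  (forall w, adj v w -> [|| P0 w, P1 w, P2 w | P3 w]) ->
  (forall w, adj v w -> P0 w -> southwest (phi v) (phi w)) ->
  (forall w, adj v w -> P1 w -> northwest (phi w) (phi v)) ->
  (forall w, adj v w -> P2 w -> southwest (phi w) (phi v)) ->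
  (forall w, adj v w -> P3 w -> northwest (phi v) (phi w)) ->
  (forall x y, adj v x -> adj v y -> P0 x -> P2 y -> adj x y) ->
  adj v a -> P2 a -> adj v b -> P0 b -> forall b', adj v b' -> P0 b' -> b' = b.
Proof.
move=> D cov h0 h1 h2 h3 h02 va a2 vb b0 b' vb' b'0; apply/eqP; apply/negPn/negP => nb.
have bb' : b != b' by rewrite eq_sym.
have [w [vw wT]] := degree4 v a b b'.
have [wa wb wb'] : [/\ w != a, w != b & w != b'].
  by move: wT; rewrite !inE !negb_or => /and3P[].
have av : adj a v by rewrite adj_sym.
have ba := h02 _ _ vb va b0 a2; have b'a := h02 _ _ vb' va b'0 a2.
case/or4P: (cov w vw) => wP.
- have wa' := h02 _ _ vw va wP a2.
  have := link_inj va vb vb' vw; rewrite ![adj a _]adj_sym => /(_ ba b'a wa').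
  by rewrite (negPf bb') ![_ == w]eq_sym (negPf wb) (negPf wb').
- exact: (no_fork conn D av vb vb' ba b'a bb' (h2 _ va a2) (h0 _ vb b0) (h0 _ vb' b'0) vw wT (h1 _ vw wP)).
- have wv : adj w v by rewrite adj_sym.
  have bw := h02 _ _ vb vw b0 wP; have b'w := h02 _ _ vb' vw b'0 wP.
  have aw : a != w by rewrite eq_sym.
  exact: (no_square conn D av wv vb vb' ba bw b'a b'w aw bb' (h2 _ va a2) (h2 _ vw wP) (h0 _ vb b0) (h0 _ vb' b'0)).
- have sw x y : southwest (phi x) (phi y) ->
    southwest (map_vertices swap_xy phi x) (map_vertices swap_xy phi y) by case.
  apply: (no_fork conn (monotone_swap_xy D) av vb vb' ba b'a bb' _ _ _ vw wT).
  + exact: sw (h2 _ va a2).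
  + exact: sw (h0 _ vb b0).
  + exact: sw (h0 _ vb' b'0).
  + by have [? ?] := h3 _ vw wP.
Qed.

Lemma chain_structure phi c v a b (P0 P1 P2 P3 : pred G) : monotone_drawing phi c ->
  (forall w, adj v w -> [|| P0 w, P1 w, P2 w | P3 w]) ->
  (forall w, adj v w -> P0 w -> southwest (phi v) (phi w)) ->
  (forall w, adj v w -> P1 w -> northwest (phi w) (phi v)) ->
  (forall w, adj v w -> P2 w -> southwest (phi w) (phi v)) ->
  (forall w, adj v w -> P3 w -> northwest (phi v) (phi w)) ->
  (forall x y, adj v x -> adj v y -> P0 x -> P2 y -> adj x y) ->
  adj v a -> P2 a -> adj v b -> P0 b ->
  (forall w, adj v w -> w \notin [:: a; b] -> P1 w) \/
  (forall w, adj v w -> w \notin [:: a; b] -> P3 w).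
Proof.
move=> D cov h0 h1 h2 h3 h02 va a2 vb b0.
have u0 := single_source D cov h0 h1 h2 h3 h02 va a2 vb b0.
(* A half turn exchanges the roles of [a] and [b]. *)
have D' := monotone_flip_y (monotone_flip_x D).
have cov' w : adj v w -> [|| P2 w, P3 w, P0 w | P1 w].
  by move/cov; case: (P0 w); case: (P1 w); case: (P2 w); case: (P3 w).
have h20 x y : adj v x -> adj v y -> P2 x -> P0 y -> adj x y.
  by move=> vx vy px py; rewrite adj_sym; apply: h02.
have u2 : forall a', adj v a' -> P2 a' -> a' = a.
  apply: (single_source D' cov' _ _ _ _ h20 vb b0 va a2) => w vw Pw.
  - by have [? ?] := h2 w vw Pw; split; rewrite /= lerN2.
  - by have [? ?] := h3 w vw Pw; split; rewrite /= lerN2.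
  - by have [? ?] := h0 w vw Pw; split; rewrite /= lerN2.
  - by have [? ?] := h1 w vw Pw; split; rewrite /= lerN2.
have P13 w : adj v w -> w \notin [:: a; b] -> P1 w || P3 w.
  move=> vw; rewrite !inE negb_or => /andP[wa wb].
  case/or4P: (cov w vw) => h; rewrite ?h ?orbT //.
    by rewrite (u0 w vw h) eqxx in wb.
  by rewrite (u2 w vw h) eqxx in wa.
have [[w3 [vw3 wab3 nw3]]|all3] := pselect (exists w, [/\ adj v w, w \notin [:: a; b] & ~~ P1 w]); last first.
  by left=> w vw wab; apply/negPn/negP => n1; apply: all3; exists w.
right=> w vw wab; have := P13 w vw wab; case E: (P3 w); rewrite ?orbT // orbF => w1.
have := P13 w3 vw3 wab3; rewrite (negPf nw3) /= => p3.
have av : adj a v by rewrite adj_sym.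
have ba := h02 _ _ vb va b0 a2.
by have := no_opposite_spokes conn D av vb ba (h2 _ va a2) (h0 _ vb b0) vw vw3 wab wab3
  (h1 _ vw w1) (h3 _ vw3 p3).
Qed.

(* The axes are shared out between 0 and 2, so that antipodal directions differ by 2. *)
Definition compass (p q : plane) : nat :=
  if (p.1 <= q.1) && (p.2 <= q.2) then 0%N
  else if (q.1 <= p.1) && (q.2 <= p.2) then 2%N
  else if q.1 < p.1 then 1%N else 3%N.

Lemma compass_opp p q : p != q -> compass q p = ((compass p q + 2) %% 4)%N.
Proof.
move=> pq; rewrite /compass.
case: (ltgtP p.1 q.1) => h1; case: (ltgtP p.2 q.2) => h2 //=.
by case/eqP: pq; rewrite (surjective_pairing p) (surjective_pairing q) h1 h2.
Qed.

Lemma compassP (p q : plane) :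
  [/\ compass p q = 0%N -> southwest p q, compass p q = 1%N -> northwest q p,
      compass p q = 2%N -> southwest q p & compass p q = 3%N -> northwest p q].
Proof.
by rewrite /compass /southwest /northwest; split; case: (ltgtP p.1 q.1) => h1; case: (ltgtP p.2 q.2) => h2 //= _;
  rewrite ?h1 ?h2 ?lexx.
Qed.

Lemma compass_lt4 p q : [|| compass p q == 0%N, compass p q == 1%N, compass p q == 2%N | compass p q == 3%N].
Proof. by rewrite /compass; case: ifP => //; case: ifP => //; case: ifP. Qed.

Lemma local_structure phi c v : monotone_drawing phi c -> ~ extreme phi v ->
  (forall u w, adj u v -> adj v w -> u != w ->
    southwest (phi u) (phi v) -> southwest (phi v) (phi w) -> adj u w) ->
  (forall u w, adj u v -> adj v w -> u != w ->
    northwest (phi u) (phi v) -> northwest (phi v) (phi w) -> adj u w) ->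
  exists a b i j, [/\ adj v a, adj v b, adj a b &
    [/\ i \in [:: 0%N; 1%N], j = (i + 1)%N \/ j = ((i + 3) %% 4)%N,
    compass (phi v) (phi a) = ((i + 2) %% 4)%N, compass (phi v) (phi b) = i &
    forall w, adj v w -> w \notin [:: a; b] -> compass (phi v) (phi w) = j]].
Proof.
move=> D next hsw hnw.
have ne w : adj v w -> phi v != phi w.
  move=> vw; apply: contraTneq (adj_neq vw) => /(drawing_vertex_inj (mdrawing_plane D)) ->.
  by rewrite eqxx.
pose P i w := compass (phi v) (phi w) == i.
have cov w : adj v w -> [|| P 0%N w, P 1%N w, P 2%N w | P 3%N w] by move=> _; apply: compass_lt4.
have cP w := compassP (phi v) (phi w).
have witness (Q : G -> bool) : ~ (forall w, adj v w -> Q w) -> exists2 w, adj v w & ~~ Q w.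
  move=> nQ; have [//|h] := pselect (exists2 w, adj v w & ~~ Q w).
  by case: nQ => w vw; apply/negPn/negP => nq; apply: h; exists w.
have [w1 vw1 l1] : exists2 w, adj v w & (phi w).2 < (phi v).2.
  have [|w vw] := witness (fun w => (phi v).2 <= (phi w).2); last by rewrite -ltNge; exists w.
  by move=> h; apply: next; constructor 1.
have [w2 vw2 l2] : exists2 w, adj v w & (phi v).2 < (phi w).2.
  have [|w vw] := witness (fun w => (phi w).2 <= (phi v).2); last by rewrite -ltNge; exists w.
  by move=> h; apply: next; constructor 2 => w vw; rewrite /= lerN2; apply: h.
have [w3 vw3 l3] : exists2 w, adj v w & (phi w).1 < (phi v).1.
  have [|w vw] := witness (fun w => (phi v).1 <= (phi w).1); last by rewrite -ltNge; exists w.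
  by move=> h; apply: next; constructor 3 => w vw; apply: h.
have [w4 vw4 l4] : exists2 w, adj v w & (phi v).1 < (phi w).1.
  have [|w vw] := witness (fun w => (phi w).1 <= (phi v).1); last by rewrite -ltNge; exists w.
  by move=> h; apply: next; constructor 4 => w vw; rewrite /= lerN2; apply: h.
have c1 : P 2%N w1 || P 3%N w1.
  by rewrite /P /compass [(phi v).2 <= _]leNgt l1 andbF (ltW l1) andbT; case: ltgtP.
have c2 : P 0%N w2 || P 1%N w2.
  by rewrite /P /compass (ltW l2) andbT leNgt; case: ltP => //= h; rewrite [_ <= (phi v).2]leNgt l2 andbF.
have c3 : P 1%N w3 || P 2%N w3.
  by rewrite /P /compass [(phi v).1 <= _]leNgt l3 (ltW l3) /=; case: ifP.
have c4 : P 0%N w4 || P 3%N w4.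
  rewrite /P /compass (ltW l4) [_ <= (phi v).1]leNgt l4 /= [_ < (phi v).1]ltNge (ltW l4) /=.
  by case: ifP.
(* If the neighbours below and above are not in opposite quadrants, they are both to the left or
   both to the right, and the neighbour found on the other side completes an opposite pair. *)
have : (exists a b, [/\ adj v a, adj v b, P 2%N a & P 0%N b]) \/
       (exists a b, [/\ adj v a, adj v b, P 3%N a & P 1%N b]).
  case/orP: c1 => c1; case/orP: c2 => c2.
  - by left; exists w1, w2.
  - case/orP: c4 => c4; first by left; exists w1, w4.
    by right; exists w4, w2.
  - case/orP: c3 => c3; first by right; exists w1, w3.
    by left; exists w3, w2.
  - by right; exists w1, w2.
case=> -[a [b [va vb Pa Pb]]].
- have h02 x y : adj v x -> adj v y -> P 0%N x -> P 2%N y -> adj x y.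
    move=> vx vy /eqP px /eqP py; have yv : adj y v by rewrite adj_sym.
    rewrite adj_sym; apply: (hsw _ _ yv vx).
    + by apply/eqP => e; move: px; rewrite -e py.
    + by have [_ _ h _] := cP y; apply: h.
    + by have [h _ _ _] := cP x; apply: h.
  have ab : adj a b by rewrite adj_sym; apply: h02.
  have [j hj hw] : exists2 j, j = 1%N \/ j = 3%N & forall w, adj v w -> w \notin [:: a; b] -> P j w.
    have [||||h|h] := @chain_structure phi c v a b (P 0%N) (P 1%N) (P 2%N) (P 3%N) D cov _ _ _ _ h02 va Pa vb Pb.
    + by move=> w _ /eqP e; have [h _ _ _] := cP w; apply: h.
    + by move=> w _ /eqP e; have [_ h _ _] := cP w; apply: h.
    + by move=> w _ /eqP e; have [_ _ h _] := cP w; apply: h.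
    + by move=> w _ /eqP e; have [_ _ _ h] := cP w; apply: h.
    + by exists 1%N => //; left.
    + by exists 3%N => //; right.
  exists a, b, 0%N, j; split=> //; split=> //; try exact/eqP.
  by move=> w vw wab; apply/eqP; apply: hw.
- have h02 x y : adj v x -> adj v y -> P 1%N x -> P 3%N y -> adj x y.
    move=> vx vy /eqP px /eqP py; have xv : adj x v by rewrite adj_sym.
    apply: (hnw _ _ xv vy).
    + by apply/eqP => e; move: px; rewrite e py.
    + by have [_ h _ _] := cP x; apply: h.
    + by have [_ _ _ h] := cP y; apply: h.
  have ab : adj a b by rewrite adj_sym; apply: h02.
  have cov' w : adj v w -> [|| P 1%N w, P 0%N w, P 3%N w | P 2%N w].
    by move/cov; case: (P 0%N w); case: (P 1%N w); case: (P 2%N w); case: (P 3%N w).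
  (* The reflection turns this diagonal into the previous one; the classes keep their labels and
     only exchange roles, 0 with 1 and 2 with 3. *)
  have [j hj hw] : exists2 j, j = 0%N \/ j = 2%N & forall w, adj v w -> w \notin [:: a; b] -> P j w.
    have [||||h|h] := @chain_structure (map_vertices flip_x phi) (map_edges flip_x c) v a b
      (P 1%N) (P 0%N) (P 3%N) (P 2%N) (monotone_flip_x D) cov' _ _ _ _ h02 va Pa vb Pb.
    + by move=> w _ /eqP e; have [_ h _ _] := cP w; have [? ?] := h e; split; rewrite /= ?lerN2.
    + by move=> w _ /eqP e; have [h _ _ _] := cP w; have [? ?] := h e; split; rewrite /= ?lerN2.
    + by move=> w _ /eqP e; have [_ _ _ h] := cP w; have [? ?] := h e; split; rewrite /= ?lerN2.
    + by move=> w _ /eqP e; have [_ _ h _] := cP w; have [? ?] := h e; split; rewrite /= ?lerN2.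
    + by exists 0%N => //; left.
    + by exists 2%N => //; right.
  exists a, b, 1%N, j; split=> //; split=> //; try exact/eqP.
    by case: hj => ->; [right|left].
  by move=> w vw wab; apply/eqP; apply: hw.
Qed.

End LocalStructure.

(** * Closed quadrants as sign conditions *)

Section Quadrants.
Context {R : realType}.
Local Open Scope classical_set_scope.
Local Open Scope ring_scope.
Notation plane := (R * R)%type.

Definition quadrant_sign (i : nat) (p q : plane) : Prop :=
  match i with
  | 0 => p.1 <= q.1 /\ p.2 <= q.2
  | 1 => q.1 <= p.1 /\ p.2 <= q.2
  | 2 => q.1 <= p.1 /\ q.2 <= p.2
  | _ => p.1 <= q.1 /\ q.2 <= p.2
  end.

Lemma first_quadrant (t : R) : 0 <= t <= pi / 2 -> 0 <= cos t /\ 0 <= sin t.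
Proof.
move=> /andP[t0 t1]; have := pi_gt0 R => pi0; split.
  by apply: cos_ge0_pihalf; apply/andP; split; lra.
by apply: sin_ge0_pi; apply/andP; split; lra.
Qed.

Lemma polar_first_quadrant (x y : R) : 0 <= x -> 0 <= y ->
  exists r t, [/\ 0 <= r, 0 <= t <= pi / 2, x = r * cos t & y = r * sin t].
Proof.
move=> x0 y0; have pi0 := pi_gt0 R.
have [xy|nz] := eqVneq (x ^+ 2 + y ^+ 2) 0.
  exists 0, 0; have [-> ->] : x = 0 /\ y = 0.
    move: xy => /eqP; rewrite paddr_eq0 ?sqr_ge0 // !sqrf_eq0 => /andP[/eqP -> /eqP ->] //.
  by rewrite !mul0r; split=> //; rewrite lexx /=; lra.
pose r := Num.sqrt (x ^+ 2 + y ^+ 2).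
have s0 : 0 <= x ^+ 2 + y ^+ 2 by rewrite addr_ge0 ?sqr_ge0.
have r2 : r ^+ 2 = x ^+ 2 + y ^+ 2 by rewrite sqr_sqrtr.
have r0 : 0 < r by rewrite sqrtr_gt0 lt_neqAle eq_sym nz.
have xr : x <= r.
  by rewrite -(@ler_pXn2r _ 2) ?nnegrE ?(ltW r0) // r2 lerDl sqr_ge0.
have q0 : 0 <= x / r by rewrite divr_ge0 // ltW.
have q1 : x / r <= 1 by rewrite ler_pdivrMr // mul1r.
have qI : -1 <= x / r <= 1 by apply/andP; split; lra.
have cE : cos (acos (x / r)) = x / r by rewrite acosK // in_itv.
have yE : sin (acos (x / r)) = y / r.
  rewrite sin_acos //.
  have -> : 1 - (x / r) ^+ 2 = (y / r) ^+ 2.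
    have rn : r != 0 by rewrite gt_eqF.
    by rewrite !expr_div_n -[1](@divff _ (r ^+ 2)) ?expf_neq0 // -mulrBl r2 addrAC subrr add0r.
  by rewrite sqrtr_sqr ger0_norm // divr_ge0 // ltW.
exists r, (acos (x / r)); split; first exact: ltW.
(* A larger angle would have a negative cosine. *)
- rewrite acos_ge0 //= leNgt; apply/negP => lt.
  have := acos_lepi qI => lepi.
  have : cos (acos (x / r)) < 0.
    rewrite -[acos _](subrK (pi / 2)) cosDpihalf oppr_lt0.
    by apply: sin_gt0_pi; apply/andP; split; lra.
  by rewrite cE ltNge q0.
- by rewrite cE mulrC divfK // gt_eqF.
- by rewrite yE mulrC divfK // gt_eqF.
Qed.

(** With the angle counted from the start of the quadrant, the quarter turns can be removed one at a
    time by the addition formulas. *)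
Lemma quadrant_shift (i : 'I_4) (p q : plane) : quadrant i p q <-> exists r t,
  [/\ 0 <= r, 0 <= t <= pi / 2 &
    q = (p.1 + r * cos (t + i%:R * (pi / 2)), p.2 + r * sin (t + i%:R * (pi / 2)))].
Proof.
have sh : i.+1%:R * (pi / 2) = pi / 2 + i%:R * (pi / 2) :> R.
  by rewrite -natr1 mulrDl mul1r addrC.
split=> -[r [t [r0 tI ->]]].
  exists r, (t - i%:R * (pi / 2)); rewrite subrK; split=> //.
  by move: tI; rewrite sh subr_ge0 lerBlDr.
exists r, (t + i%:R * (pi / 2)); split=> //.
by rewrite sh lerD2r lerDr.
Qed.

Lemma quadrantP (i : 'I_4) (p q : plane) : quadrant i p q <-> quadrant_sign i p q.
Proof.
have two : 2%:R * (pi / 2) = pi / 2 + pi / 2 :> R by lra.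
have three : 3%:R * (pi / 2) = pi / 2 + pi / 2 + pi / 2 :> R by lra.
apply: (iff_trans (quadrant_shift i p q)); move: i => [[|[|[|[|//]]]] i4] /=; split.
- case=> r [t [r0 /first_quadrant[c0 s0] ->]].
  by rewrite mul0r addr0 /= !lerDl !mulr_ge0.
- case=> hx hy; have [||r [t [r0 tI ex ey]]] := @polar_first_quadrant (q.1 - p.1) (q.2 - p.2);
    rewrite ?subr_ge0 //.
  by exists r, t; rewrite mul0r addr0 -ex -ey !subrKC -surjective_pairing.
- case=> r [t [r0 /first_quadrant[c0 s0] ->]].
  by rewrite mul1r cosDpihalf sinDpihalf /= lerDl gerDl mulrN oppr_le0 !mulr_ge0.
- case=> hx hy; have [||r [t [r0 tI ex ey]]] := @polar_first_quadrant (q.2 - p.2) (p.1 - q.1);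
    rewrite ?subr_ge0 //.
  exists r, t; rewrite mul1r cosDpihalf sinDpihalf mulrN -ex -ey; split=> //.
  by rewrite opprB !subrKC -surjective_pairing.
- case=> r [t [r0 /first_quadrant[c0 s0] ->]].
  by rewrite two addrA !(cosDpihalf, sinDpihalf) /= !gerDl !mulrN !oppr_le0 !mulr_ge0.
- case=> hx hy; have [||r [t [r0 tI ex ey]]] := @polar_first_quadrant (p.1 - q.1) (p.2 - q.2);
    rewrite ?subr_ge0 //.
  exists r, t; rewrite two addrA !(cosDpihalf, sinDpihalf) !mulrN -ex -ey; split=> //.
  by rewrite !opprB !subrKC -surjective_pairing.
- case=> r [t [r0 /first_quadrant[c0 s0] ->]].
  by rewrite three !addrA !(cosDpihalf, sinDpihalf) /= opprK lerDl gerDl mulrN oppr_le0 !mulr_ge0.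
- case=> hx hy; have [||r [t [r0 tI ex ey]]] := @polar_first_quadrant (p.2 - q.2) (q.1 - p.1);
    rewrite ?subr_ge0 //.
  exists r, t; rewrite three !addrA !(cosDpihalf, sinDpihalf) !opprK !mulrN -ex -ey; split=> //.
  by rewrite opprB !subrKC -surjective_pairing.
Qed.

Lemma monotone_curve_on (f : R -> plane) : monotone_curve f ->
  monotone_on (fun t => (f t).1) /\ monotone_on (fun t => (f t).2).
Proof.
case=> i mf.
have {}mf s t : 0 <= s -> s <= t -> t <= 1 -> quadrant_sign i (f s) (f t).
  by move=> s0 st t1; apply/quadrantP; apply: mf.
by move: i mf => [[|[|[|[|//]]]] i4] /= mf; split; (left + right) => s t s0 st t1;
  have [] := mf s t s0 st t1.
Qed.

Lemma southwest_monotone_curve (f : R -> plane) :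
  (forall s t, 0 <= s -> s <= t -> t <= 1 -> southwest (f s) (f t)) -> monotone_curve f.
Proof.
by move=> mf; exists ord0 => s t s0 st t1; apply/quadrantP; apply: mf.
Qed.

Lemma northwest_monotone_curve (f : R -> plane) :
  (forall s t, 0 <= s -> s <= t -> t <= 1 -> northwest (f s) (f t)) -> monotone_curve f.
Proof.
by move=> mf; exists (Ordinal (isT : 3 < 4)%N) => s t s0 st t1; apply/quadrantP; apply: mf.
Qed.

(** An arbitrary transitive relation covers both diagonal directions. *)
Lemma concat_homo (T : plane -> plane -> Prop) (f g : R -> plane) :
  (forall p q r, T p q -> T q r -> T p r) -> f 1 = g 0 ->
  (forall s t, 0 <= s -> s <= t -> t <= 1 -> T (f s) (f t)) ->
  (forall s t, 0 <= s -> s <= t -> t <= 1 -> T (g s) (g t)) ->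
  forall s t, 0 <= s -> s <= t -> t <= 1 -> T (concat_curve f g s) (concat_curve f g t).
Proof.
move=> tr fg hf hg s t s0 st t1; rewrite /concat_curve.
case: (leP s (1 / 2)) => hs; case: (leP t (1 / 2)) => ht.
- by apply: hf; lra.
- by apply: (tr _ (f 1)); [apply: hf|rewrite fg; apply: hg]; lra.
- by have := le_lt_trans (le_trans st ht) hs; rewrite ltxx.
- by apply: hg; lra.
Qed.

End Quadrants.

(** * Consequences of the obstacle condition *)

Section ObstacleEmbeddings.
Context {R : realType} {G : sgraph}.
Local Open Scope classical_set_scope.
Local Open Scope ring_scope.
Notation plane := (R * R)%type.
Variables (phi : G -> plane) (c : G -> G -> R -> plane).
Hypothesis E : plane_obstacle_embedding phi c.

Lemma obstacle_monotone_drawing : monotone_drawing phi c.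
Proof. by case: E => D mono _; split=> // u w /mono/monotone_curve_on[]. Qed.

Let D := obstacle_monotone_drawing.

(** The obstacle condition enters the argument only through paths with two edges. *)
Lemma obstacle_two_path u v w : adj u v -> adj v w -> u != w ->
  monotone_curve (concat_curve (c u v) (c v w)) -> adj u w.
Proof.
move=> uv vw uw mono; case: E => _ _ /(_ u [:: v; w]) /=; apply=> //.
  by rewrite uv vw.
by rewrite !inE negb_or (adj_neq uv) uw (adj_neq vw).
Qed.

Lemma obstacle_southwest u v w : adj u v -> adj v w -> u != w ->
  southwest (phi u) (phi v) -> southwest (phi v) (phi w) -> adj u w.
Proof.
move=> uv vw uw swu swv; apply: (obstacle_two_path uv vw uw).
apply: southwest_monotone_curve; apply: concat_homo.
- by move=> p q r [? ?] [? ?]; split; apply: le_trans; eassumption.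
- by rewrite (drawing_end (mdrawing_plane D) uv) (drawing_start (mdrawing_plane D) vw).
- by move=> s t; apply: (southwest_edge D uv swu).
- by move=> s t; apply: (southwest_edge D vw swv).
Qed.

Lemma northwest_edge u w s t : adj u w -> northwest (phi u) (phi w) ->
  0 <= s -> s <= t -> t <= 1 -> northwest (c u w s) (c u w t).
Proof.
move=> uw [x y] s0 st t1; split; first exact: (spoke_x D uw).
rewrite -lerN2; apply: (monotone_on_nondecreasing (monotone_on_opp (mdrawing_y D uw))) => //.
by rewrite (drawing_start (mdrawing_plane D) uw) (drawing_end (mdrawing_plane D) uw) lerN2.
Qed.

Lemma obstacle_northwest u v w : adj u v -> adj v w -> u != w ->
  northwest (phi u) (phi v) -> northwest (phi v) (phi w) -> adj u w.
Proof.
move=> uv vw uw nwu nwv; apply: (obstacle_two_path uv vw uw).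
apply: northwest_monotone_curve; apply: concat_homo.
- by move=> p q r [? ?] [? ?]; split; apply: le_trans; eassumption.
- by rewrite (drawing_end (mdrawing_plane D) uv) (drawing_start (mdrawing_plane D) vw).
- by move=> s t; apply: (northwest_edge uv nwu).
- by move=> s t; apply: (northwest_edge vw nwv).
Qed.

End ObstacleEmbeddings.

(** * Graphs given by a list of triangles *)

Section FaceGraph.
Variables (n : nat) (F : seq (nat * nat * nat)).

Definition in_face (t : nat * nat * nat) (v : nat) : bool :=
  [|| v == t.1.1, v == t.1.2 | v == t.2].

Definition face_adj (u v : nat) : bool :=
  (u != v) && has (fun t => in_face t u && in_face t v) F.

Lemma face_adj_sym : symmetric face_adj.
Proof. by move=> u v; rewrite /face_adj eq_sym; congr (_ && _); apply: eq_has => t; rewrite andbC. Qed.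

Lemma face_adj_irrefl : irreflexive face_adj.
Proof. by move=> u; rewrite /face_adj eqxx. Qed.

Definition face_graph : sgraph :=
  @SGraph 'I_n (fun u v => face_adj u v) (fun u v => face_adj_sym u v)
    (fun u => face_adj_irrefl u).

Definition nbrs (u : nat) : seq nat := [seq v <- iota 0 n | face_adj u v].

Lemma mem_nbrs (u v : 'I_n) : ((v : nat) \in nbrs u) = @adj face_graph u v.
Proof. by rewrite mem_filter mem_iota leq0n add0n ltn_ord !andbT. Qed.

Lemma nbrs_ord (u v : nat) : v \in nbrs u -> exists v' : 'I_n, v' = v :> nat.
Proof. by rewrite mem_filter mem_iota add0n => /andP[_ vn]; exists (Ordinal vn). Qed.

Lemma face_degree (u : 'I_n) : @degree face_graph u = size (nbrs u).
Proof.
rewrite /degree /nbrs -val_enum_ord filter_map size_map cardE; congr (size _).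
by rewrite enumT; apply: eq_filter.
Qed.

Section Tables.
(** Precomputed adjacency lists, so that the checks look neighbours up instead of scanning the
    faces. *)
Variable table : seq (seq nat).
Hypothesis tableE : table = [seq nbrs u | u <- iota 0 n].

Lemma nth_table (u : 'I_n) : nth [::] table u = nbrs u.
Proof. by rewrite tableE (nth_map 0%N) ?size_iota // nth_iota. Qed.

Definition grow (S : seq nat) (vis : seq bool) : seq bool :=
  mkseq (fun v => (v \notin S) && (nth false vis v || has (nth false vis) (nth [::] table v))) n.

Definition start (S : seq nat) : nat := find (fun v => v \notin S) (iota 0 n).

(** Breadth-first search from the first vertex off [S]. Marked vertices are reachable after any
    number of rounds; the choice [n./2] only has to be large enough for the test to succeed. *)
Definition connected_off (S : seq nat) : bool :=
  let vis := iter n./2 (grow S) (mkseq (fun v => v == start S) n) in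
  all (fun v => (v \in S) || nth false vis v) (iota 0 n).

Lemma connected_offP (S : {set 'I_n}) (l : seq nat) :
  (forall v : 'I_n, (v \in S) = (nat_of_ord v \in l)) -> connected_off l ->
  forall x y : face_graph, x \notin S -> y \notin S -> connect (@adj_avoid face_graph S) x y.
Proof.
move=> Sl /allP con.
pose e := @adj_avoid face_graph S.
have e_sym : connect_sym e.
  by apply: sym_connect_sym => u v; rewrite /e /adj_avoid /= face_adj_sym andbCA.
move=> x y xS yS.
have hs : has (fun v => v \notin l) (iota 0 n).
  by apply/hasP; exists (nat_of_ord x); rewrite ?mem_iota ?leq0n ?add0n ?ltn_ord // -Sl.
have sn : (start l < n)%N by move: hs; rewrite has_find size_iota.
pose s := Ordinal sn : face_graph.
have sS : s \notin S.
  by rewrite Sl; have := nth_find 0%N hs; rewrite nth_iota.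
have inv k (v : 'I_n) : nth false (iter k (grow l) (mkseq (fun v => v == start l) n)) v ->
    v \notin S /\ connect e s v.
  elim: k v => [|k IHk] v.
    by rewrite nth_mkseq // => /eqP vs; have -> : v = s by apply: val_inj.
  rewrite iterS nth_mkseq // -Sl => /andP[vS /orP[/IHk//|/hasP[u]]].
  rewrite nth_table => uv; have [u' u'E] := nbrs_ord uv; rewrite -u'E in uv *.
  move=> /IHk[u'S su']; split=> //; apply: connect_trans su' (connect1 _).
  by rewrite /e /adj_avoid /= vS u'S /= face_adj_sym; move: uv; rewrite mem_nbrs.
have reach (v : 'I_n) : v \notin S -> connect e s v.
  move=> vS; have := con v; rewrite mem_iota leq0n add0n ltn_ord => /(_ isT).
  by rewrite -Sl (negPf vS) => /inv[].
by apply: connect_trans (reach y yS); rewrite e_sym; apply: reach.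
Qed.

(** Runs through the sublists of length at most [k] without building their list. The chosen elements
    pile up in [acc] in reverse order, so correctness is stated up to [=i]. *)
Fixpoint all_subsets (P : seq nat -> bool) (l : seq nat) (k : nat) (acc : seq nat) : bool :=
  match k, l with
  | k'.+1, x :: l' => all_subsets P l' k' (x :: acc) && all_subsets P l' k acc
  | _, _ => P acc
  end.

Lemma all_subsetsP (P : seq nat -> bool) l k acc s :
  all_subsets P l k acc -> subseq s l -> (size s <= k)%N ->
  exists2 s', s' =i s ++ acc & P s'.
Proof.
elim: l k acc s => [|x l IHl] [|k] acc s /=.
- by move=> Pacc /eqP -> _; exists acc.
- by move=> Pacc /eqP -> _; exists acc.
- by move=> Pacc _; rewrite leqn0 => /nilP ->; exists acc.
move=> /andP[h1 h2]; case: s => [|y s].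
  by move=> _ _; apply: (IHl _ _ [::] h2) => //; apply: sub0seq.
case: eqP => [->|_] sub sz; last exact: (IHl _ _ _ h2).
have [s' s'E Ps'] := IHl _ _ _ h1 sub sz.
by exists s' => // z; rewrite s'E !(inE, mem_cat) orbCA.
Qed.

Lemma four_connected : all_subsets connected_off (iota 0 n) 3 [::] -> (4 < n)%N ->
  k_connected 4 face_graph.
Proof.
move=> chk n4; split; first by rewrite card_ord.
move=> S S3; pose l := [seq nat_of_ord v | v <- enum S].
have sub : subseq l (iota 0 n).
  by rewrite -val_enum_ord; apply: map_subseq; rewrite [in X in subseq _ X]enumT; apply: filter_subseq.
have sz : (size l <= 3)%N by rewrite size_map -cardE.
have [l' l'E con] := all_subsetsP chk sub sz.
apply: connected_offP con => v; rewrite l'E cats0.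
by rewrite /l mem_map ?mem_enum //; apply: val_inj.
Qed.

(** Degree at least four and exactly two common neighbours for each edge: besides connectivity, this
    is all that the geometric part uses about $G$. *)
Definition link_check : bool :=
  all (fun v => (3 < size (nth [::] table v))%N &&
    all (fun u => size [seq w <- nth [::] table v | w \in nth [::] table u] == 2)
      (nth [::] table v)) (iota 0 n).

Lemma link_checkP : link_check -> forall v : 'I_n, (3 < size (nbrs v))%N /\
  forall u : 'I_n, @adj face_graph v u -> size [seq w <- nbrs v | w \in nbrs u] = 2.
Proof.
move=> /allP chk v; have := chk v; rewrite mem_iota leq0n add0n ltn_ord => /(_ isT) /andP[].
rewrite nth_table => sz /allP h; split=> // u vu.
by have := h u; rewrite mem_nbrs => /(_ vu) /eqP; rewrite nth_table.
Qed.

Hypothesis chk : link_check.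

Lemma nbrs_uniq v : uniq (nbrs v).
Proof. exact/filter_uniq/iota_uniq. Qed.

Lemma face_link (v u : face_graph) : adj v u -> exists u1 u2 : face_graph,
  [/\ u1 != u2, adj v u1, adj v u2, adj u u1 & adj u u2].
Proof.
move=> vu; have [_ /(_ u vu)] := link_checkP chk v.
have := filter_uniq (fun w => w \in nbrs u) (nbrs_uniq v).
have mem w : w \in [seq w <- nbrs v | w \in nbrs u] -> exists w' : 'I_n,
    [/\ w = w' :> nat, @adj face_graph v w' & @adj face_graph u w'].
  rewrite mem_filter => /andP[wu wv]; have [w' w'E] := nbrs_ord wu.
  by exists w'; rewrite -!mem_nbrs w'E.
case: [seq _ <- _ | _] mem => [|w1 [|w2 [|]]] //= mem; rewrite inE andbT => w12 _.
have [|u1 [e1 a1 b1]] := mem w1; first by rewrite inE eqxx.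
have [|u2 [e2 a2 b2]] := mem w2; first by rewrite !inE eqxx orbT.
exists u1, u2; split=> //; apply: contraNneq w12 => u12.
by rewrite e1 e2 u12.
Qed.

Lemma face_link_inj (v w x y z : face_graph) : adj v w -> adj v x -> adj v y -> adj v z ->
  adj w x -> adj w y -> adj w z -> [|| x == y, y == z | x == z].
Proof.
move=> vw vx vy vz wx wy wz; have [_ /(_ w vw) sz] := link_checkP chk v.
apply/negPn/negP; rewrite !negb_or => /and3P[xy yz xz].
have un : uniq [:: nat_of_ord x; nat_of_ord y; nat_of_ord z].
  by rewrite /= !inE negb_or -!(inj_eq val_inj) /= in xy yz xz *; rewrite xy xz yz.
have sub : {subset [:: nat_of_ord x; nat_of_ord y; nat_of_ord z] <= [seq u <- nbrs v | u \in nbrs w]}.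
  by move=> u; rewrite !inE mem_filter => /or3P[] /eqP ->; rewrite !mem_nbrs; apply/andP; split.
by have := uniq_leq_size un sub; rewrite sz.
Qed.

Lemma face_degree4 (v x y z : face_graph) : exists w : face_graph, adj v w /\ w \notin [:: x; y; z].
Proof.
have [sz _] := link_checkP chk v.
have [/hasP[u uv nu]|/hasPn all3] := boolP (has (fun u => u \notin [:: nat_of_ord x; nat_of_ord y; nat_of_ord z]) (nbrs v)).
  have [w wE] := nbrs_ord uv; exists w; split; first by rewrite -mem_nbrs wE.
  by move: nu; rewrite -wE !inE.
have sub : {subset nbrs v <= [:: nat_of_ord x; nat_of_ord y; nat_of_ord z]}.
  by move=> u /all3; rewrite negbK.
by have := leq_trans sz (uniq_leq_size (nbrs_uniq v) sub).
Qed.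

End Tables.
End FaceGraph.

(** * Search for a labelling *)

Section LabelSearch.
Variable table : seq (seq nat).
Local Notation nb v := (nth [::] table v).

Definition star_labels (v a b i j : nat) : seq nat :=
  [seq if w == a then (i + 2) %% 4 else if w == b then i else j | w <- nb v].

(** As [(a, b)] runs over ordered pairs, [i] in 0, 1 covers both diagonals in both directions; [j]
    is one of the two quadrants off the diagonal. *)
Definition star_options (v : nat) : seq (seq nat) :=
  flatten [seq flatten [seq
    [:: star_labels v a b 0 1; star_labels v a b 0 3; star_labels v a b 1 2; star_labels v a b 1 0]
    | b <- nb v & b \in nb a] | a <- nb v].

(** Forward checking: a later vertex keeps only the options that give the common edge the antipodal
    direction. *)
Definition restrict_star (v : nat) (lab : seq nat) (d : nat * seq (seq nat)) :
    nat * seq (seq nat) :=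
  if d.1 \in nb v then
    let l := (nth 0 lab (index d.1 (nb v)) + 2) %% 4 in
    let p := index v (nb d.1) in
    (d.1, [seq x <- d.2 | nth 0 x p == l])
  else d.

(* The conditional, unlike [&&], keeps [vm_compute] from exploring the pruned branches. *)
Fixpoint search_labels (fuel : nat) (doms : seq (nat * seq (seq nat))) : bool :=
  match fuel, doms with
  | fuel'.+1, (v, D) :: ds =>
    has (fun lab =>
      let ds' := map (restrict_star v lab) ds in
      if has (fun d => nilp d.2) ds' then false else search_labels fuel' ds') D
  | _, _ => true
  end.

Definition labelling_exists (order : seq nat) : bool :=
  search_labels (size order) [seq (v, star_options v) | v <- order].

Variable q : nat -> nat -> nat.

Definition star_labelled (v : nat) : Prop :=
  exists a b i j, [/\ a \in nb v, b \in nb v, b \in nb a &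
    [/\ i \in [:: 0; 1], j = i + 1 \/ j = (i + 3) %% 4, q v a = (i + 2) %% 4, q v b = i &
      forall w, w \in nb v -> w \notin [:: a; b] -> q v w = j]].

Lemma star_labelled_option v : star_labelled v -> map (q v) (nb v) \in star_options v.
Proof.
move=> [a [b [i [j [av bv ba [iP jP qa qb qw]]]]]].
have -> : map (q v) (nb v) = star_labels v a b i j.
  apply/eq_in_map => w wv; have [->//|wa] := eqVneq w a.
  by have [->//|wb] := eqVneq w b; apply: qw; rewrite // !inE negb_or wa.
apply/flattenP; eexists; first by apply/mapP; exists a; [exact: av|reflexivity].
apply/flattenP; eexists; first by apply/mapP; exists b; [rewrite mem_filter ba bv|reflexivity].
by move: iP; rewrite !inE => /orP[] /eqP iE; case: jP => jE; rewrite jE iE eqxx ?orbT.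
Qed.

(** An actual labelling survives every filter, so a failed search refutes it. The answer [true] on
    exhausted fuel is on the safe side. *)
Lemma search_labelsP fuel (doms : seq (nat * seq (seq nat))) :
  (forall u v, u \in nb v -> v \in nb u /\ q v u = (q u v + 2) %% 4) ->
  (forall d, d \in doms -> map (q d.1) (nb d.1) \in d.2) ->
  search_labels fuel doms.
Proof.
move=> opp; elim: fuel doms => [//|fuel IH] [//|[v D] ds] inD /=.
apply/hasP; exists (map (q v) (nb v)); first by apply: (inD (v, D)); rewrite inE eqxx.
have inD' d : d \in map (restrict_star v (map (q v) (nb v))) ds -> map (q d.1) (nb d.1) \in d.2.
  move=> /mapP[d' d'ds ->]; have d'D : map (q d'.1) (nb d'.1) \in d'.2.
    by apply: inD; rewrite inE d'ds orbT.
  rewrite /restrict_star; case: ifP => //= d'v; rewrite mem_filter d'D andbT.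
  have [vd' qe] := opp _ _ d'v; have [_ qv] := opp _ _ vd'.
  by rewrite !(nth_map 0) ?index_mem // !nth_index // qv.
case: ifP => [/hasP[d /inD']|_]; last exact: IH.
by case: (d.2).
Qed.

Lemma labelling_existsP order :
  (forall v, v \in order -> star_labelled v) ->
  (forall u v, u \in nb v -> v \in nb u /\ q v u = (q u v + 2) %% 4) ->
  labelling_exists order.
Proof.
move=> star opp; apply: search_labelsP opp _ => d /mapP[v vo ->].
by apply: star_labelled_option; apply: star.
Qed.

End LabelSearch.

(** * From the failed searches to nonexistence *)

Section NoEmbedding.
Context {R : realType}.
Variables (n : nat) (F : seq (nat * nat * nat)) (table : seq (seq nat)).
Hypothesis tableE : table = [seq nbrs n F u | u <- iota 0 n].
Local Notation G := (face_graph n F).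
Local Notation nb v := (nth [::] table v).

Definition separated (c1 c2 : seq nat) : bool :=
  all (fun x => all (fun y => (x != y) && (y \notin nb x)) c2) c1.

Lemma no_obstacle_embedding (c1 c2 : seq nat) : (0 < n)%N ->
  k_connected 4 G -> link_check n table ->
  all (fun v => (v < n)%N) c1 -> all (fun v => (v < n)%N) c2 -> separated c1 c2 ->
  ~~ labelling_exists table c1 -> ~~ labelling_exists table c2 ->
  ~ exists (phi : G -> (R * R)%type) (c : G -> G -> R -> (R * R)%type),
      plane_obstacle_embedding phi c.
Proof.
move=> n0 [_ conn] chk c1n c2n sep no1 no2 [phi [c E]].
have D := obstacle_monotone_drawing E.
have link := face_link tableE chk.
have deg4 := face_degree4 tableE chk.
pose x0 : G := Ordinal n0.
have hasn v : exists w : G, adj v w by have [w [vw _]] := deg4 v v v v; exists w.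
have [a [b [d [ab bd da ext]]]] := extremes_in_triangle conn link hasn x0 D.
(* Indices beyond [n] are sent to the default vertex [x0]; the entries of the table are all below
   [n]. *)
pose p (u : nat) := phi (insubd x0 u).
pose q (u w : nat) := compass (p u) (p w).
have pE (v : 'I_n) : p v = phi v by rewrite /p valKd.
have nbE (u v : 'I_n) : (nat_of_ord v \in nb u) = @adj G u v.
  by rewrite (nth_table tableE) mem_nbrs.
have nb_ord (u v : nat) : v \in nb u -> exists u' v' : 'I_n, u = u' /\ v = v'.
  have [un|nu] := ltnP u n; last by rewrite nth_default // tableE size_map size_iota.
  have e := nth_table tableE (Ordinal un); rewrite /= in e; rewrite e => /nbrs_ord[v' v'E].
  by exists (Ordinal un), v'.
have opp u v : u \in nb v -> v \in nb u /\ q v u = (q u v + 2) %% 4.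
  move=> uv; have [v' [u' [vE uE]]] := nb_ord _ _ uv; move: uv.
  rewrite vE uE !nbE => vu; split; first by rewrite adj_sym.
  rewrite /q !pE; apply: compass_opp; apply: contraTneq vu => /(drawing_vertex_inj (mdrawing_plane D)) ->.
  by rewrite adj_irrefl.
have star (v : 'I_n) : v \notin [:: a; b; d] -> star_labelled table q v.
  move=> vT.
  have [a' [b' [i [j [va vb ab' [iP jP qa qb qw]]]]]] :=
    local_structure conn (face_link_inj tableE chk) deg4 D (fun ex => negP vT (ext v ex))
      (fun u w => @obstacle_southwest _ _ _ _ E u v w) (fun u w => @obstacle_northwest _ _ _ _ E u v w).
  exists (nat_of_ord (a' : 'I_n)), (nat_of_ord (b' : 'I_n)), i, j; rewrite !nbE; split=> //.
  rewrite /q !pE; split=> // w wv wab; have [v' [w' [_ wE]]] := nb_ord _ _ wv.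
  by rewrite wE pE; apply: qw; move: wv wab; rewrite wE ?nbE // !inE !(inj_eq val_inj).
have core cc : all (fun v => (v < n)%N) cc -> ~~ labelling_exists table cc ->
    exists2 v : 'I_n, nat_of_ord v \in cc & v \in [:: a; b; d].
  move=> /allP ccn no; have [[v vc vT]|all0] :=
      pselect (exists2 v : 'I_n, nat_of_ord v \in cc & v \in [:: a; b; d]); first by exists v.
  case/negP: no; apply: (labelling_existsP (q := q)) => // v vc.
  have := star (Ordinal (ccn v vc)); apply; apply/negP => vT.
  by apply: all0; exists (Ordinal (ccn v vc)).
have [v1 v1c v1T] := core c1 c1n no1; have [v2 v2c v2T] := core c2 c2n no2.
(* Two vertices of the exceptional triangle are equal or adjacent, and [separated] excludes both. *)
have /andP[v12] := allP (allP sep _ v1c) _ v2c.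
rewrite nbE => /negP; apply.
have ba : adj b a by rewrite adj_sym.
have db : adj d b by rewrite adj_sym.
have ad : adj a d by rewrite adj_sym.
move: v1T v2T v12; rewrite !inE.
by case/or3P=> /eqP ->; case/or3P=> /eqP ->; rewrite ?eqxx.
Qed.

End NoEmbedding.

(** * The graph *)

(* The inner faces, counterclockwise in the drawing below; the outer face is 0, 1, 2. *)
Definition faces26 : seq (nat * nat * nat) :=
  [:: (0, 1, 3); (0, 3, 4); (0, 4, 5); (0, 5, 6); (0, 6, 7);
   (0, 7, 2); (1, 2, 8); (1, 8, 9); (1, 9, 10); (1, 10, 11);
   (1, 11, 3); (2, 7, 12); (2, 12, 8); (3, 11, 13); (3, 13, 4);
   (4, 13, 14); (4, 14, 15); (4, 15, 5); (5, 15, 16); (5, 16, 17);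
   (5, 17, 6); (6, 13, 7); (6, 14, 13); (6, 17, 14); (7, 11, 12);
   (7, 13, 11); (8, 12, 18); (8, 18, 19); (8, 19, 9); (9, 19, 21);
   (9, 20, 10); (9, 21, 20); (10, 18, 11); (10, 20, 18); (11, 18, 12);
   (14, 16, 15); (14, 17, 16); (18, 20, 22); (18, 22, 19); (19, 22, 23);
   (19, 23, 21); (20, 21, 24); (20, 24, 22); (21, 23, 25); (21, 25, 24);
   (22, 24, 25); (22, 25, 23)].

Definition table26 : seq (seq nat) := Eval vm_compute in [seq nbrs 26 faces26 u | u <- iota 0 26].

Lemma table26E : table26 = [seq nbrs 26 faces26 u | u <- iota 0 26].
Proof. vm_compute; reflexivity. Qed.

Lemma graph26_four_connected : k_connected 4 (face_graph 26 faces26).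
Proof. apply: (four_connected table26E); [vm_compute; reflexivity|by []]. Qed.

Lemma graph26_link_check : link_check 26 table26.
Proof. vm_compute; reflexivity. Qed.

(* The interiors of the two discs, ordered so that the search fails early. *)
Definition core1 : seq nat := [:: 6; 14; 17; 16; 5; 15; 4; 0; 13; 7; 3].
Definition core2 : seq nat := [:: 19; 22; 23; 25; 21; 24; 20; 18; 8; 9; 10].

Lemma core1_unlabellable : ~~ labelling_exists table26 core1.
Proof. vm_compute; reflexivity. Qed.

Lemma core2_unlabellable : ~~ labelling_exists table26 core2.
Proof. vm_compute; reflexivity. Qed.

Lemma cores_separated : separated table26 core1 core2.
Proof. vm_compute; reflexivity. Qed.

(** * Projections of convex surfaces *)

Section ConvexLift.
Context {R : realType} {G : sgraph}.
Local Open Scope classical_set_scope.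
Local Open Scope ring_scope.
Notation plane := (R * R)%type.
Notation I01 := `[0%R, 1%R]%classic.
Variables (phi : G -> plane) (H : G -> R) (face : G -> G -> G -> bool).

Definition det (p q r : plane) : R := (q.1 - p.1) * (r.2 - p.2) - (q.2 - p.2) * (r.1 - p.1).

(* The affine function that interpolates the heights on a triangle, multiplied by
   [det]; a lifted face supports the convex surface from below. *)
Definition lift a b d (p : plane) : R :=
  H a * det (phi b) (phi d) p + H b * det (phi d) (phi a) p + H d * det (phi a) (phi b) p.

Hypothesis face_rot : forall a b d, face a b d -> face b d a.
Hypothesis face_det : forall a b d, face a b d -> 0 < det (phi a) (phi b) (phi d).
Hypothesis face_support : forall a b d z, face a b d -> z \notin [:: a; b; d] ->
  lift a b d (phi z) < H z * det (phi a) (phi b) (phi d).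
Hypothesis vertex_face : forall u, exists a b, face u a b.
Hypothesis adj_face : forall u w, adj u w -> exists z, face u w z \/ face w u z.
Hypothesis face_edge : forall a b d, face a b d -> adj a b.

Definition combination (mu : G -> R) : plane :=
  (\sum_v mu v * (phi v).1, \sum_v mu v * (phi v).2).

Definition weights (mu : G -> R) : Prop := (forall v, 0 <= mu v) /\ \sum_v mu v = 1.

Lemma affine_combination (al be ga : R) mu : weights mu ->
  al * (combination mu).1 + be * (combination mu).2 + ga =
  \sum_v mu v * (al * (phi v).1 + be * (phi v).2 + ga).
Proof.
case=> _ s1; rewrite /combination /= !mulr_sumr -[in LHS](mulr1 ga) -s1 mulr_sumr -!big_split /=.
by apply: eq_bigr => v _; ring.
Qed.

Lemma det_affine3 (p q : plane) : exists al be ga : R, forall r, det p q r = al * r.1 + be * r.2 + ga.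
Proof.
exists (- (q.2 - p.2)), (q.1 - p.1), ((q.2 - p.2) * p.1 - (q.1 - p.1) * p.2) => r.
by rewrite /det; ring.
Qed.

Lemma det_combination p q mu : weights mu ->
  det p q (combination mu) = \sum_v mu v * det p q (phi v).
Proof.
move=> w; have [al [be [ga e]]] := det_affine3 p q.
by rewrite e affine_combination //; apply: eq_bigr => v _; rewrite e.
Qed.

Lemma det_rot p q r : det p q r = det q r p.
Proof. by rewrite /det; ring. Qed.

Lemma lift_combination a b d mu : weights mu ->
  lift a b d (combination mu) = \sum_v mu v * lift a b d (phi v).
Proof.
move=> w; rewrite /lift !det_combination // !mulr_sumr -!big_split /=.
by apply: eq_bigr => v _; ring.
Qed.

Lemma lift_vertex a b d v : v \in [:: a; b; d] ->
  lift a b d (phi v) = H v * det (phi a) (phi b) (phi d).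
Proof. by rewrite !inE => /or3P[] /eqP ->; rewrite /lift /det; ring. Qed.

Lemma lift_le a b d v : face a b d -> lift a b d (phi v) <= H v * det (phi a) (phi b) (phi d).
Proof.
move=> f; have [vT|vT] := boolP (v \in [:: a; b; d]); first by rewrite lift_vertex.
exact/ltW/face_support.
Qed.

Definition supported (mu : G -> R) a b d : Prop := forall v, v \notin [:: a; b; d] -> mu v = 0.

Lemma lift_supported mu a b d : weights mu -> supported mu a b d ->
  lift a b d (combination mu) = det (phi a) (phi b) (phi d) * \sum_v mu v * H v.
Proof.
move=> w sup; rewrite lift_combination // mulr_sumr; apply: eq_bigr => v _.
have [vT|/sup ->] := boolP (v \in [:: a; b; d]); last by rewrite !mul0r mulr0.
by rewrite lift_vertex //; ring.
Qed.

(** The weight of a corner is a ratio of areas, hence determined by the point. *)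
Lemma combination_det mu a b d : face a b d -> weights mu -> supported mu a b d ->
  mu d * det (phi a) (phi b) (phi d) = det (phi a) (phi b) (combination mu).
Proof.
move=> f w sup; rewrite det_combination // (bigD1 d) //= big1 ?addr0 // => v vd.
have [|/sup ->] := boolP (v \in [:: a; b; d]); last by rewrite mul0r.
by rewrite !inE (negPf vd) orbF => /orP[] /eqP ->; rewrite /det; ring.
Qed.

Lemma supported_rot mu a b d : supported mu a b d -> supported mu b d a.
Proof. by move=> sup v; rewrite !inE orbA orbC => vT; apply: sup; rewrite !inE. Qed.

(** Among all combinations with a given value, one supported on a face has the least mean height.
    Two such combinations therefore have equal heights, and the strict inequality in [face_support]
    leaves no weight off the first face. *)
Lemma weights_supported mu nu a b d a' b' d' : face a b d -> face a' b' d' ->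
  weights mu -> weights nu -> supported mu a b d -> supported nu a' b' d' ->
  combination mu = combination nu -> supported nu a b d.
Proof.
move=> f f' wm wn sm sn e.
have low t mu' nu' x y z : face x y z -> weights mu' -> weights nu' -> supported mu' x y z ->
    combination mu' = combination nu' -> t = det (phi x) (phi y) (phi z) ->
    t * \sum_v mu' v * H v = \sum_v nu' v * lift x y z (phi v).
  by move=> fx wm' wn' sm' e' ->; rewrite -lift_supported // e' lift_combination.
have le x y z mu' nu' : face x y z -> weights mu' -> weights nu' -> supported mu' x y z ->
    combination mu' = combination nu' -> \sum_v mu' v * H v <= \sum_v nu' v * H v.
  move=> fx wm' wn' sm' e'; have d0 := face_det fx.
  rewrite -(ler_pM2l d0) (low _ _ nu' x y z) // mulr_sumr; apply: ler_sum => v _.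
  by rewrite mulrCA; apply: ler_wpM2l; [case: wn'|rewrite mulrC lift_le].
have eqH : \sum_v mu v * H v = \sum_v nu v * H v.
  by apply/eqP; rewrite eq_le (le a b d) // (le a' b' d').
have tot : \sum_v nu v * (H v * det (phi a) (phi b) (phi d) - lift a b d (phi v)) = 0.
  rewrite (eq_bigr (fun v => det (phi a) (phi b) (phi d) * (nu v * H v) - nu v * lift a b d (phi v))).
    by rewrite sumrB -mulr_sumr -eqH (low _ mu nu a b d) // subrr.
  by move=> v _; ring.
move=> v vT.
have nn u : 0 <= nu u * (H u * det (phi a) (phi b) (phi d) - lift a b d (phi u)).
  by apply: mulr_ge0; [case: wn|rewrite subr_ge0 lift_le].
have /eqP := tot; rewrite psumr_eq0 // => /allP/(_ v (mem_index_enum v)) /=.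
rewrite mulf_eq0 => /orP[/eqP //|]; rewrite subr_eq0 => /eqP e0.
by have := face_support f vT; rewrite e0 ltxx.
Qed.

(** Vertices and edges lie on faces, so every incidence in the drawing becomes an equality of weight
    functions, from which planarity is read off. *)
Lemma weights_unique mu nu a b d a' b' d' : face a b d -> face a' b' d' ->
  weights mu -> weights nu -> supported mu a b d -> supported nu a' b' d' ->
  combination mu = combination nu -> forall v, mu v = nu v.
Proof.
move=> f f' wm wn sm sn e v; have sn' := weights_supported f f' wm wn sm sn e.
have third x y z : face x y z -> supported mu x y z -> supported nu x y z -> mu z = nu z.
  move=> fx smx snx; have d0 := face_det fx.
  by apply: (mulIf (lt0r_neq0 d0)); rewrite !combination_det // e.
have [vT|vT] := boolP (v \in [:: a; b; d]); last by rewrite sm // sn'.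
have f2 := face_rot f; have f3 := face_rot f2.
have s2 := supported_rot sm; have s3 := supported_rot s2.
have t2 := supported_rot sn'; have t3 := supported_rot t2.
by move: vT; rewrite !inE => /or3P[] /eqP ->; [exact: third f2 _ _|exact: third f3 _ _|exact: third f _ _].
Qed.

Definition edge_weights u w (t : R) : G -> R :=
  fun v => (1 - t) * (v == u)%:R + t * (v == w)%:R.

Definition segment u w : R -> plane := fun t =>
  ((phi u).1 + t * ((phi w).1 - (phi u).1), (phi u).2 + t * ((phi w).2 - (phi u).2)).

Lemma sum_delta u (h : G -> R) : \sum_v (v == u)%:R * h v = h u.
Proof.
rewrite (bigD1 u) //= eqxx mul1r big1 ?addr0 // => v /negPf ->.
by rewrite mul0r.
Qed.

Lemma sum_edge_weights u w t (h : G -> R) :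
  \sum_v edge_weights u w t v * h v = (1 - t) * h u + t * h w.
Proof.
rewrite -(sum_delta u h) -(sum_delta w h) !mulr_sumr -big_split /=.
by apply: eq_bigr => v _; rewrite /edge_weights; ring.
Qed.

Lemma edge_weightsP u w t : 0 <= t <= 1 -> weights (edge_weights u w t).
Proof.
move=> /andP[t0 t1]; split=> [v|].
  by rewrite addr_ge0 // mulr_ge0 ?subr_ge0 // ler0n.
rewrite (eq_bigr (fun v => edge_weights u w t v * 1)); first by rewrite sum_edge_weights; ring.
by move=> v _; rewrite mulr1.
Qed.

Lemma segment_combination u w t : segment u w t = combination (edge_weights u w t).
Proof. by rewrite /segment /combination !sum_edge_weights; congr (_, _); ring. Qed.

Lemma vertex_combination u : phi u = combination (edge_weights u u 0).
Proof. by rewrite -segment_combination /segment !mul0r !addr0 -surjective_pairing. Qed.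

Lemma edge_face u w t : adj u w -> exists a b d, face a b d /\ supported (edge_weights u w t) a b d.
Proof.
move=> /adj_face[z [f|f]]; [exists u, w, z|exists w, u, z]; split=> // v;
  rewrite !inE !negb_or => /and3P[/negPf h1 /negPf h2 _];
  by rewrite /edge_weights h1 h2 !mulr0 addr0.
Qed.

Lemma vertex_supported u : exists a b d, face a b d /\ supported (edge_weights u u 0) a b d.
Proof.
have [a [b f]] := vertex_face u; exists u, a, b; split=> // v; rewrite !inE negb_or => /andP[/negPf h _].
by rewrite /edge_weights h !mulr0 addr0.
Qed.

Lemma edge_weights_eq u w t u' w' t' : adj u w -> adj u' w' -> 0 <= t <= 1 -> 0 <= t' <= 1 ->
  segment u w t = segment u' w' t' -> forall v, edge_weights u w t v = edge_weights u' w' t' v.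
Proof.
move=> uw uw' tI tI'; rewrite !segment_combination => e.
have [a [b [d [f s]]]] := edge_face t uw; have [a' [b' [d' [f' s']]]] := edge_face t' uw'.
exact: weights_unique f f' (edge_weightsP _ _ tI) (edge_weightsP _ _ tI') s s' e.
Qed.

Lemma affine_continuous (a b : R) : {within I01, continuous (fun t : R => a + t * b)}.
Proof.
apply: continuous_subspaceT => t; apply: cvgD; first exact: cvg_cst.
by apply: cvgMl; exact: cvg_id.
Qed.

Lemma straight_line_drawing : plane_drawing phi segment.
Proof.
split.
- move=> u w e; apply/eqP/negPn/negP => uw.
  have [a [b [d [f s]]]] := vertex_supported u; have [a' [b' [d' [f' s']]]] := vertex_supported w.
  have I0 : 0 <= (0 : R) <= 1 by rewrite lexx ler01.
  rewrite (vertex_combination u) (vertex_combination w) in e.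
  have := weights_unique f f' (edge_weightsP u u I0) (edge_weightsP w w I0) s s' e u.
  by rewrite /edge_weights eqxx (negPf uw) /= subr0 mul0r addr0 mulr1 mulr0 mul0r addr0 => /eqP; rewrite oner_eq0.
- by move=> u w uw; apply: pair_cont; apply: affine_continuous.
- by move=> u w uw; rewrite /segment !mul0r !addr0 -surjective_pairing.
- by move=> u w uw; rewrite /segment !mul1r ![_ + (_ - _)]addrC !subrK -surjective_pairing.
- by move=> u w uw t _; rewrite /segment; congr (_, _); ring.
- move=> u w uw s t /= ; rewrite !in_itv /= => sI tI e.
  have := edge_weights_eq uw uw sI tI e w; rewrite /edge_weights eqxx.
  by rewrite eq_sym (negPf (adj_neq uw)) !mulr0 !add0r !mulr1.
- move=> u w uw t z /=; rewrite in_itv /= => tI e.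
  have [a [b [d [f s]]]] := edge_face t uw; have [a' [b' [d' [f' s']]]] := vertex_supported z.
  have I0 : 0 <= (0 : R) <= 1 by rewrite lexx ler01.
  rewrite segment_combination (vertex_combination z) in e.
  have := weights_unique f f' (edge_weightsP u w tI) (edge_weightsP z z I0) s s' e z.
  rewrite /edge_weights eqxx; case: eqP => [|_]; first by left.
  case: eqP => [|_]; first by right.
  by rewrite /= !mulr0 !mulr1 !addr0 subr0 => /eqP; rewrite eq_sym oner_eq0.
- move=> u w u' w' uw uw' neq s t /=; rewrite !in_itv /= => sI tI e.
  have E := edge_weights_eq uw uw' sI tI e.
  have uw0 := negPf (adj_neq uw); have wu0 : (w == u) = false by rewrite eq_sym.
  have pos v : 0 < edge_weights u' w' t v -> v \in [set u'; w']%SET.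
    rewrite !inE /edge_weights; case: eqP => // _; case: eqP => // _.
    by rewrite !mulr0 addr0 ltxx.
  have Eu : 1 - s = edge_weights u' w' t u.
    by rewrite -E /edge_weights eqxx uw0 mulr0 mulr1 addr0.
  have Ew : s = edge_weights u' w' t w.
    by rewrite -E /edge_weights eqxx wu0 mulr0 mulr1 add0r.
  have [s0|s0] := eqVneq s 0.
    exists u; split; first by rewrite !inE eqxx.
      by apply: pos; rewrite -Eu s0 subr0.
    by rewrite s0 /segment !mul0r !addr0 -surjective_pairing.
  have [s1|s1] := eqVneq s 1.
    exists w; split; first by rewrite !inE eqxx orbT.
      by apply: pos; rewrite -Ew s1.
    by rewrite s1 /segment !mul1r ![_ + (_ - _)]addrC !subrK -surjective_pairing.
  have {s0 s1} sI' : 0 < s < 1.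
    by case/andP: sI => h0 h1; rewrite !lt_neqAle h0 h1 eq_sym s0 s1.
  (* At an inner parameter both ends carry positive weight, so the two edges have the same ends,
     against [neq]. *)
  have uE : u \in [set u'; w']%SET by apply: pos; rewrite -Eu subr_gt0; case/andP: sI'.
  have wE : w \in [set u'; w']%SET by apply: pos; rewrite -Ew; case/andP: sI'.
  case/eqP: neq; apply/setP => v; apply/idP/idP; rewrite !inE.
    by case/orP=> /eqP ->; rewrite -in_set2.
  move: uE wE; rewrite !inE => uE wE vE; apply/negPn/negP; rewrite negb_or => /andP[vu vw].
  move: uE wE vE vu vw uw0; case/orP=> /eqP ->; case/orP=> /eqP ->; case/orP=> /eqP ->; rewrite ?eqxx //.
Qed.

Variables o1 o2 o3 : G.
Definition outer_edge u w : bool := (u, w) \in [:: (o1, o2); (o2, o3); (o3, o1)].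
Hypothesis outer_adj : forall u w, outer_edge u w -> adj u w.
Hypothesis outer_hull : forall u w z, outer_edge u w -> 0 <= det (phi u) (phi w) (phi z).
Hypothesis outer_det : 0 < det (phi o1) (phi o2) (phi o3).
Hypothesis face_next : forall a b d, face a b d -> outer_edge a b \/ exists z, face b a z.

Definition open_triangle a b d : set plane := [set p |
  [/\ 0 < det (phi a) (phi b) p, 0 < det (phi b) (phi d) p & 0 < det (phi d) (phi a) p]].

Definition closed_triangle a b d : set plane := [set p |
  [/\ 0 <= det (phi a) (phi b) p, 0 <= det (phi b) (phi d) p & 0 <= det (phi d) (phi a) p]].

(** The outer face, as a union of three open half planes. *)
Definition outside : set plane := [set p | exists u w, outer_edge u w /\ det (phi u) (phi w) p < 0].

Definition lift_at a b d (p : plane) : R := lift a b d p / det (phi a) (phi b) (phi d).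

Lemma lift_at_rot a b d p : lift_at a b d p = lift_at b d a p.
Proof. by rewrite /lift_at [det (phi b) _ _]det_rot [in RHS]det_rot; congr (_ / _); rewrite /lift; ring. Qed.

(* Crossing an interior edge in the direction of [p] strictly increases the lift at [p]. *)
Lemma lift_at_next a b d z p : face a b d -> face b a z -> det (phi a) (phi b) p < 0 ->
  lift_at a b d p < lift_at b a z p.
Proof.
move=> f f' lt; have d0 := face_det f; have d0' := face_det f'.
have zT : z \notin [:: a; b; d].
  rewrite !inE !negb_or; apply/and3P; split; apply/eqP => e; move: d0'; rewrite e.
  - by rewrite /det; lra.
  - by rewrite /det; lra.
  - by move: d0; rewrite /det; lra.
have sz := face_support f zT.
have key : lift b a z p * det (phi a) (phi b) (phi d) - lift a b d p * det (phi b) (phi a) (phi z) =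
    - det (phi a) (phi b) p * (H z * det (phi a) (phi b) (phi d) - lift a b d (phi z)).
  by rewrite /lift /det; ring.
rewrite /lift_at ltr_pdivrMr // mulrAC ltr_pdivlMr // -subr_gt0 key.
by apply: mulr_gt0; rewrite ?oppr_gt0 ?subr_gt0.
Qed.

(** A face with the greatest lift at [p] contains [p] unless [p] is outside: an inner edge with [p]
    on its far side leads to a face with a greater lift. Maximality stands in for a walk across the
    faces towards [p]. *)
Lemma covering p : outside p \/ exists a b d, face a b d /\ closed_triangle a b d p.
Proof.
have [a0 [b0 f0]] := vertex_face o1.
pose P (t : G * G * G) := face t.1.1 t.1.2 t.2.
have P0 : P (o1, a0, b0) by [].
case: (@Order.TotalTheory.arg_maxP _ _ _ (o1, a0, b0) P (fun t => lift_at t.1.1 t.1.2 t.2 p) P0).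
move=> [[a b] d] f max; rewrite /P /= in f max.
have [out|nout] := pselect (outside p); [by left|right; exists a, b, d; split=> //].
have nonneg x y z : face x y z -> lift_at x y z p = lift_at a b d p -> 0 <= det (phi x) (phi y) p.
  move=> fx e; rewrite leNgt; apply/negP => lt.
  have [oe|[w fw]] := face_next fx; first by apply: nout; exists x, y.
  have := lift_at_next fx fw lt; rewrite e ltNge => /negP; apply.
  exact: (max (y, x, w)).
have f2 := face_rot f; have f3 := face_rot f2.
split; first exact: nonneg f _.
  by apply: nonneg f2 _; rewrite -lift_at_rot.
by apply: nonneg f3 _; rewrite [LHS]lift_at_rot.
Qed.

Lemma det_sum (p q r s : plane) : det p q s + det q r s + det r p s = det p q r.
Proof. by rewrite /det; ring. Qed.

Lemma on_segment a b d p : 0 < det (phi a) (phi b) (phi d) -> closed_triangle a b d p ->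
  det (phi a) (phi b) p = 0 -> curve_image (segment a b) p.
Proof.
move=> d0 [_ h2 h3] e.
have dn := lt0r_neq0 d0.
have tot := det_sum (phi a) (phi b) (phi d) p; rewrite e add0r in tot.
(* This is the barycentric coordinate of [p] at [b]. *)
exists (det (phi d) (phi a) p / det (phi a) (phi b) (phi d)).
  by rewrite /= in_itv /= divr_ge0 ?(ltW d0) //= ler_pdivrMr // mul1r -tot lerDr.
rewrite [RHS](surjective_pairing p) /segment; congr (_, _).
  apply: (mulfI dn); rewrite mulrDr mulrA [_ * (_ / _)]mulrC divfK //.
  by apply/eqP; rewrite -subr_eq0 -[X in _ == X](mulr0 ((phi a).1 - (phi d).1)) -e; apply/eqP; rewrite /det; ring.
apply: (mulfI dn); rewrite mulrDr mulrA [_ * (_ / _)]mulrC divfK //.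
by apply/eqP; rewrite -subr_eq0 -[X in _ == X](mulr0 ((phi a).2 - (phi d).2)) -e; apply/eqP; rewrite /det; ring.
Qed.

Lemma closed_not_open a b d p : 0 < det (phi a) (phi b) (phi d) -> closed_triangle a b d p ->
  ~ open_triangle a b d p ->
  (curve_image (segment a b) `|` curve_image (segment b d) `|` curve_image (segment d a)) p.
Proof.
move=> d0 T nO; have [h1 h2 h3] := T.
have d0' : 0 < det (phi b) (phi d) (phi a) by rewrite -det_rot.
have d0'' : 0 < det (phi d) (phi a) (phi b) by rewrite -det_rot.
have [e1|n1] := eqVneq (det (phi a) (phi b) p) 0; first by left; left; exact: (on_segment d0 T e1).
have [e2|n2] := eqVneq (det (phi b) (phi d) p) 0.
  by left; right; apply: (on_segment d0' _ e2); split.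
have [e3|n3] := eqVneq (det (phi d) (phi a) p) 0.
  by right; apply: (on_segment d0'' _ e3); split.
by case: nO; split; rewrite lt_neqAle eq_sym ?n1 ?n2 ?n3.
Qed.

Lemma segment_closed a b d p : 0 < det (phi a) (phi b) (phi d) ->
  curve_image (segment a b) p -> closed_triangle a b d p /\ det (phi a) (phi b) p = 0.
Proof.
move=> d0 /curve_imageP[t /andP[t0 t1] <-].
have e1 : det (phi a) (phi b) (segment a b t) = 0 by rewrite /det /segment /=; ring.
have e2 : det (phi b) (phi d) (segment a b t) = (1 - t) * det (phi a) (phi b) (phi d).
  by rewrite /det /segment /=; ring.
have e3 : det (phi d) (phi a) (segment a b t) = t * det (phi a) (phi b) (phi d).
  by rewrite /det /segment /=; ring.
split=> //; split; first by rewrite e1 lexx.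
  by rewrite e2; apply: mulr_ge0; [rewrite subr_ge0|exact: ltW].
by rewrite e3; apply: mulr_ge0 => //; exact: ltW.
Qed.

Lemma open_triangleP a b d p : 0 < det (phi a) (phi b) (phi d) ->
  open_triangle a b d p <-> exists mu,
    [/\ weights mu, supported mu a b d, combination mu = p & forall v, v \in [:: a; b; d] -> 0 < mu v].
Proof.
move=> d0; have dn := lt0r_neq0 d0.
have [nab nbd nda] : [/\ a != b, b != d & d != a].
  by split; apply/eqP => e; move: d0; rewrite e /det; lra.
split=> [[h1 h2 h3]|[mu [w sup <- pos]]].
  pose D := det (phi a) (phi b) (phi d).
  (* Barycentric coordinates of [p], extended by zero to the other vertices. *)
  pose mu v : R := (v == a)%:R * (det (phi b) (phi d) p / D) +
    ((v == b)%:R * (det (phi d) (phi a) p / D) + (v == d)%:R * (det (phi a) (phi b) p / D)).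
  have muE (h : G -> R) : \sum_v mu v * h v = (det (phi b) (phi d) p * h a +
      det (phi d) (phi a) p * h b + det (phi a) (phi b) p * h d) / D.
    transitivity (\sum_v ((v == a)%:R * (det (phi b) (phi d) p / D * h v) +
      ((v == b)%:R * (det (phi d) (phi a) p / D * h v) + (v == d)%:R * (det (phi a) (phi b) p / D * h v)))).
      by apply: eq_bigr => v _; rewrite /mu; ring.
    rewrite !big_split /= (sum_delta a (fun v => _ * h v)) (sum_delta b (fun v => _ * h v)).
    by rewrite (sum_delta d (fun v => _ * h v)); ring.
  exists mu; split.
  - split=> [v|].
      by rewrite /mu !addr_ge0 // mulr_ge0 ?ler0n // divr_ge0 // ltW.
    rewrite (eq_bigr (fun v => mu v * 1)) ?muE ?mulr1; last by move=> v _; rewrite mulr1.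
    by rewrite addrAC [X in X + _]addrC det_sum divff.
  - move=> v; rewrite !inE !negb_or => /and3P[/negPf va /negPf vb /negPf vd].
    by rewrite /mu va vb vd !mul0r !addr0.
  - rewrite /combination !muE [RHS](surjective_pairing p); congr (_, _).
      by apply: (mulIf dn); rewrite divfK // /det; ring.
    by apply: (mulIf dn); rewrite divfK // /det; ring.
  - have neq (x y : G) : x != y -> ((x == y) = false) * ((y == x) = false).
      by move=> /negPf h; split; rewrite // eq_sym.
    move=> v; rewrite !inE => /or3P[] /eqP ->; rewrite /mu ?eqxx ?(neq _ _ nab) ?(neq _ _ nbd) ?(neq _ _ nda) /=.
    + by rewrite mul1r !mul0r !addr0 divr_gt0.
    + by rewrite mul1r !mul0r addr0 add0r divr_gt0.
    + by rewrite mul1r !mul0r !add0r divr_gt0.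
have cd x y z : 0 < det (phi x) (phi y) (phi z) -> (forall v, v \notin [:: x; y; z] -> mu v = 0) -> 0 < mu z ->
    0 < det (phi x) (phi y) (combination mu).
  move=> xyz su mz; rewrite det_combination // (bigD1 z) //= big1 ?addr0 ?mulr_gt0 // => v vz.
  have [|/su ->] := boolP (v \in [:: x; y; z]); last by rewrite mul0r.
  by rewrite !inE (negPf vz) orbF => /orP[] /eqP ->; rewrite /det; ring.
have s2 := supported_rot sup; have s3 := supported_rot s2.
split.
- by apply: (cd a b d) => //; apply: pos; rewrite !inE eqxx !orbT.
- by apply: (cd b d a) => //; [rewrite -det_rot|apply: pos; rewrite !inE eqxx].
- by apply: (cd d a b) => //; [rewrite det_rot|apply: pos; rewrite !inE eqxx orbT].
Qed.

Lemma combination_inside mu u w : weights mu -> outer_edge u w ->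
  0 <= det (phi u) (phi w) (combination mu).
Proof.
move=> wm oe; rewrite det_combination //; apply: sumr_ge0 => v _.
by apply: mulr_ge0; [case: wm|exact: outer_hull].
Qed.

Lemma outside_combination mu : weights mu -> ~ outside (combination mu).
Proof.
by move=> wm [u [w [oe]]]; rewrite ltNge => /negP; apply; apply: combination_inside.
Qed.

(** A common point has only one weight function, whose support is the corner set of either face. The
    first alternative occurs for rotations of one face. *)
Lemma open_triangles_disjoint a b d a' b' d' : face a b d -> face a' b' d' ->
  open_triangle a b d = open_triangle a' b' d' \/
  open_triangle a b d `&` open_triangle a' b' d' = set0.
Proof.
move=> f f'; have d0 := face_det f; have d0' := face_det f'.
have [[p [Tp Tp']]|none] := pselect (exists p, open_triangle a b d p /\ open_triangle a' b' d' p); last first.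
  by right; apply/seteqP; split=> // p [Tp Tp']; apply: none; exists p.
left.
have [mu [wm sm em pm]] := (open_triangleP p d0).1 Tp.
have [nu [wn sn en pn]] := (open_triangleP p d0').1 Tp'.
have E : forall v, mu v = nu v by apply: (weights_unique f f') => //; rewrite em en.
have mem v : (v \in [:: a; b; d]) = (v \in [:: a'; b'; d']).
  apply/idP/idP => vT; apply/negPn/negP => nT.
    by have := pm v vT; rewrite E sn ?ltxx.
  by have := pn v vT; rewrite -E sm ?ltxx.
apply/seteqP; split=> q.
  move=> /(open_triangleP q d0)[la [wl sl el pl]]; apply/(open_triangleP q d0'); exists la; split=> //.
    by move=> v; rewrite -mem; apply: sl.
  by move=> v; rewrite -mem; apply: pl.
move=> /(open_triangleP q d0')[la [wl sl el pl]]; apply/(open_triangleP q d0); exists la; split=> //.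
  by move=> v; rewrite mem; apply: sl.
by move=> v; rewrite mem; apply: pl.
Qed.

Lemma open_triangle_inside a b d : face a b d -> open_triangle a b d `&` outside = set0.
Proof.
move=> f; apply/seteqP; split=> // p [/(open_triangleP p (face_det f))[mu [wm _ <- _]]].
exact: outside_combination.
Qed.

Lemma drawing_supportP p : drawing_support phi segment p <->
  exists u w t, [/\ u = w \/ adj u w, 0 <= t <= 1 & p = segment u w t].
Proof.
split=> [[[u _ <-]|[u [w [uw /curve_imageP[t tI <-]]]]]|[u [w [t [h tI ->]]]]].
- exists u, u, 0; split; [by left|by rewrite lexx ler01|].
  by rewrite /segment !mul0r !addr0 -surjective_pairing.
- by exists u, w, t; split=> //; right.
case: h => [->|uw]; last by right; exists u, w; split=> //; exists t => //; exact: in_I01.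
by left; exists w => //; rewrite /segment !subrr !mulr0 !addr0 -surjective_pairing.
Qed.

Lemma support_not_outside p : drawing_support phi segment p -> ~ outside p.
Proof.
move=> /drawing_supportP[u [w [t [_ tI ->]]]]; rewrite segment_combination.
exact/outside_combination/edge_weightsP.
Qed.

(** A point of an edge has at most two positive weights, an inner point of a face has three. *)
Lemma support_not_open a b d p : face a b d -> drawing_support phi segment p ->
  ~ open_triangle a b d p.
Proof.
move=> f; have d0 := face_det f.
have [nab nbd nda] : [/\ a != b, b != d & d != a].
  by split; apply/eqP => e; move: d0; rewrite e /det; lra.
move=> /drawing_supportP[u [w [t [h tI ->]]]] /(open_triangleP _ d0)[mu [wm sm em pm]].
have [a' [b' [d' [f' s']]]] : exists a' b' d', face a' b' d' /\ supported (edge_weights u w t) a' b' d'.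
  case: h => [->|uw]; last exact: edge_face.
  have [a' [b' [d' [f' s']]]] := vertex_supported w; exists a', b', d'; split=> // v vT.
  by rewrite -(s' v vT) /edge_weights -!mulrDl; congr (_ * _); ring.
rewrite segment_combination in em.
have E := weights_unique f f' wm (edge_weightsP u w tI) sm s' em.
have pos v : v \in [:: a; b; d] -> v \in [:: u; w].
  move=> /pm; rewrite E /edge_weights !inE; case: eqP => // _; case: eqP => // _.
  by rewrite !mulr0 addr0 ltxx.
have sub : {subset [:: a; b; d] <= [:: u; w]} by move=> v; apply: pos.
have un : uniq [:: a; b; d] by rewrite /= !inE negb_or nab nbd eq_sym nda.
by have := uniq_leq_size un sub.
Qed.

Definition line (p q : plane) : R -> plane := fun t =>
  (p.1 + t * (q.1 - p.1), p.2 + t * (q.2 - p.2)).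

Lemma det_line a b p q t :
  det (phi a) (phi b) (line p q t) = (1 - t) * det (phi a) (phi b) p + t * det (phi a) (phi b) q.
Proof. by rewrite /det /line /=; ring. Qed.

Lemma det_continuous a b : continuous (fun p : plane => det (phi a) (phi b) p).
Proof.
move=> p; apply: cvgB; apply: cvgM; try exact: cvg_cst.
  by apply: cvgB; [exact: cvg_snd|exact: cvg_cst].
by apply: cvgB; [exact: cvg_fst|exact: cvg_cst].
Qed.

Lemma line_continuous p q : {within I01, continuous (line p q)}.
Proof. by apply: pair_cont; apply: affine_continuous. Qed.

Lemma convex_connected (A : set plane) :
  (forall p q t, A p -> A q -> 0 <= t <= 1 -> A (line p q t)) -> connected A.
Proof.
move=> conv; have [[p Ap]|nA] := pselect (A !=set0); last first.
  have -> : A = set0 by apply/seteqP; split=> // q Aq; apply: nA; exists q.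
  exact: connected0.
have -> : A = \bigcup_(q in A) (line p q @` I01).
  apply/seteqP; split=> [q Aq|_ [q Aq [t /= tI <-]]].
    exists q => //; exists 1; first by rewrite /= in_itv /= lexx ler01.
    by rewrite /line !mul1r ![_ + (_ - _)]addrC !subrK -surjective_pairing.
  by apply: conv => //; move: tI; rewrite in_itv.
apply: bigcup_connected.
  exists p => q Aq; exists 0; first by rewrite /= in_itv /= lexx ler01.
  by rewrite /line !mul0r !addr0 -surjective_pairing.
move=> q Aq; apply: connected_continuous_connected; first exact: segment_connected.
exact: line_continuous.
Qed.

Lemma open_halfplane a b : open [set p | 0 < det (phi a) (phi b) p].
Proof.
apply: (@open_comp _ _ (fun p : plane => det (phi a) (phi b) p) [set x : R | x > 0]).
  by move=> p _; exact: det_continuous.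
exact: open_gt.
Qed.

Lemma open_open_triangle a b d : open (open_triangle a b d).
Proof.
have -> : open_triangle a b d = [set p | 0 < det (phi a) (phi b) p] `&`
    ([set p | 0 < det (phi b) (phi d) p] `&` [set p | 0 < det (phi d) (phi a) p]).
  by apply/seteqP; split=> p; [case=> ? ? ?; split=> //; split|case=> ? [? ?]; split].
by apply: openI; [|apply: openI]; exact: open_halfplane.
Qed.

Definition halfplane u w : set plane := [set p | det (phi u) (phi w) p < 0].

Lemma outsideE : outside = halfplane o1 o2 `|` halfplane o2 o3 `|` halfplane o3 o1.
Proof.
apply/seteqP; split=> [p [u [w [oe lt]]]|p].
  by move: oe; rewrite /outer_edge !inE => /or3P[] /eqP[uE wE]; move: lt; rewrite uE wE => lt; [left; left|left; right|right].
by case=> [[]|] lt; [exists o1, o2|exists o2, o3|exists o3, o1]; rewrite /outer_edge !inE eqxx ?orbT.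
Qed.

Lemma open_outside : open outside.
Proof.
have oh u w : open (halfplane u w).
  apply: (@open_comp _ _ (fun p : plane => det (phi u) (phi w) p) [set x : R | x < 0]).
    by move=> p _; exact: det_continuous.
  exact: open_lt.
by rewrite outsideE; apply: openU; [apply: openU|].
Qed.

Lemma triangle_connected a b d : connected (open_triangle a b d).
Proof.
apply: convex_connected => p q t [p1 p2 p3] [q1 q2 q3] /andP[t0 t1].
have pos (x y : R) : 0 < x -> 0 < y -> 0 < (1 - t) * x + t * y.
  move=> x0 y0; have [->|nt] := eqVneq t 0; first by rewrite subr0 mul1r mul0r addr0.
  by apply: ltr_wpDl; [rewrite mulr_ge0 ?subr_ge0 // ltW|rewrite mulr_gt0 // lt_neqAle eq_sym nt].
by split; rewrite det_line pos.
Qed.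

Lemma halfplane_connected u w : connected (halfplane u w).
Proof.
apply: convex_connected => p q t; rewrite /halfplane /= det_line => p0 q0 /andP[t0 t1].
have [->|nt] := eqVneq t 0; first by rewrite subr0 mul1r mul0r addr0.
apply: ltr_wnDl; first by rewrite mulr_ge0_le0 ?subr_ge0 // ltW.
by rewrite nmulr_llt0 // lt_neqAle eq_sym nt.
Qed.

Lemma outside_connected : connected outside.
Proof.
(* The witness has barycentric coordinates -1, 3, -1: it lies beyond [b], across both sides at that
   corner. *)
have corner a b d : 0 < det (phi a) (phi b) (phi d) -> exists p, halfplane a b p /\ halfplane b d p.
  move=> d0; exists (3 * (phi b).1 - (phi a).1 - (phi d).1, 3 * (phi b).2 - (phi a).2 - (phi d).2).
  by split; rewrite /halfplane /=; move: d0; rewrite /det /=; lra.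
rewrite outsideE; apply: connectedU; first last.
- exact: halfplane_connected.
- apply: connectedU; try exact: halfplane_connected.
  by have [p [h1 h2]] := corner _ _ _ outer_det; exists p.
- have [p [h1 h2]] : exists p, halfplane o2 o3 p /\ halfplane o3 o1 p.
    by apply: corner; rewrite -det_rot.
  by exists p; split=> //; right.
Qed.

(** Within the component, [A] is open, and it is closed as the complement of the open set [B]. *)
Lemma component_piece (U A B : set plane) p : A p -> open A -> connected A -> A `<=` U ->
  open B -> U `<=` A `|` B -> A `&` B = set0 -> connected_component U p = A.
Proof.
move=> Ap Ao Ac AU Bo UAB AB; apply/seteqP; split; last exact: connected_component_max.
have CA : connected_component U p `&` A = connected_component U p.
  apply: (@component_connected _ U p).
  - by exists p; split=> //; apply: connected_component_refl; apply: AU.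
  - by exists A.
  - exists (~` B); first exact: open_closedC.
    apply/seteqP; split=> q [Cq h]; split=> //.
      by move=> Bq; have : (A `&` B) q by []; rewrite AB.
    by case: (UAB q (connected_component_sub Cq)).
by move=> q; rewrite -CA => -[].
Qed.

Lemma closure_line (A : set plane) p q :
  (forall t, 0 < t <= 1 -> A (line p q t)) -> closure A p.
Proof.
move=> h B /nbhs_ballP[d d0 dB].
have [|e e0 eP] := curve_near (r := 0) (@line_continuous p q) _ (d0 : 0 < d); first by rewrite lexx ler01.
pose m := Num.min 1 (e / 2).
have m0 : 0 < m by rewrite lt_min ltr01 divr_gt0.
have m1 : m <= 1 by rewrite ge_min lexx.
have mI : 0 <= m <= 1 by rewrite (ltW m0).
have me : `|0 - m| < e.
  by rewrite sub0r normrN gtr0_norm // gt_min; apply/orP; right; lra.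
exists (line p q m); split; first by apply: h; rewrite m0.
have := eP m mI me; have -> : line p q 0 = p by rewrite /line !mul0r !addr0 -surjective_pairing.
by move=> /andP[b1 b2]; apply: dB; split; rewrite /ball /= distrC.
Qed.

Lemma closed_closed_triangle a b d : closed (closed_triangle a b d).
Proof.
have -> : closed_triangle a b d = ~` (halfplane a b `|` halfplane b d `|` halfplane d a).
  apply/seteqP; split=> p.
    by case=> h1 h2 h3; case=> [[]|]; rewrite /halfplane /= ltNge ?h1 ?h2 ?h3.
  move=> n; split; rewrite leNgt; apply/negP => lt; apply: n;
    [by left; left|by left; right|by right].
apply: open_closedC; apply: openU; [apply: openU|];
  apply: (@open_comp _ _ (fun p : plane => det _ _ p) [set x : R | x < 0]);
  by [move=> p _; exact: det_continuous|exact: open_lt].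
Qed.

Lemma boundary_edge a b d p : 0 < det (phi a) (phi b) (phi d) -> open_triangle a b d p ->
  curve_image (segment a b) `<=` closure (open_triangle a b d) `\` open_triangle a b d.
Proof.
move=> d0 [p1 p2 p3] q /(segment_closed d0)[[q1 q2 q3] e]; split; last by case; rewrite e ltxx.
apply: (@closure_line _ q p) => t /andP[t0 t1].
have pos (x y : R) : 0 <= x -> 0 < y -> 0 < (1 - t) * x + t * y.
  by move=> x0 y0; apply: ltr_wpDl; rewrite ?mulr_gt0 // mulr_ge0 ?subr_ge0.
by split; rewrite det_line pos.
Qed.

Lemma open_triangle_rot a b d : open_triangle a b d = open_triangle b d a.
Proof. by apply/seteqP; split=> p []; split. Qed.

Lemma open_triangle_boundary a b d p : 0 < det (phi a) (phi b) (phi d) -> open_triangle a b d p ->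
  closure (open_triangle a b d) `\` interior (open_triangle a b d) =
  curve_image (segment a b) `|` curve_image (segment b d) `|` curve_image (segment d a).
Proof.
move=> d0 Tp; rewrite ((interior_id _).1 (@open_open_triangle a b d)).
have d0' : 0 < det (phi b) (phi d) (phi a) by rewrite -det_rot.
have d0'' : 0 < det (phi d) (phi a) (phi b) by rewrite det_rot.
apply/seteqP; split=> q.
  move=> [clq nq]; apply: closed_not_open => //.
  have sub : open_triangle a b d `<=` closed_triangle a b d by move=> r [? ? ?]; split; apply: ltW.
  by have := closure_subset sub clq; rewrite -((closure_id _).1 (@closed_closed_triangle a b d)).
case=> [[]|] h.
- exact: (boundary_edge d0 Tp h).
- by rewrite open_triangle_rot in Tp *; exact: (boundary_edge d0' Tp h).
- by rewrite -(open_triangle_rot d a b) in Tp *; exact: (boundary_edge d0'' Tp h).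
Qed.

Lemma inside_not_outside p : closed_triangle o1 o2 o3 p -> ~ outside p.
Proof.
by move=> [h1 h2 h3]; rewrite outsideE => -[[]|]; rewrite /halfplane /= ltNge ?h1 ?h2 ?h3.
Qed.

Lemma outside_boundary :
  closure outside `\` interior outside =
  curve_image (segment o1 o2) `|` curve_image (segment o2 o3) `|` curve_image (segment o3 o1).
Proof.
rewrite ((interior_id _).1 open_outside).
have d0' : 0 < det (phi o2) (phi o3) (phi o1) by rewrite -det_rot.
have d0'' : 0 < det (phi o3) (phi o1) (phi o2) by rewrite det_rot.
apply/seteqP; split=> q.
  move=> [clq nq]; apply: closed_not_open outer_det _ _.
    split; rewrite leNgt; apply/negP => lt; apply: nq; rewrite outsideE;
    [by left; left|by left; right|by right].
  move=> Tq; have sub : outside `<=` ~` open_triangle o1 o2 o3.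
    move=> r out [h1 h2 h3]; apply: (inside_not_outside _ out); split; exact: ltW.
  have cl : closed (~` open_triangle o1 o2 o3) by apply: open_closedC; exact: open_open_triangle.
  by have := closure_subset sub clq; rewrite -((closure_id _).1 cl); apply.
have edge a b d : outer_edge a b -> 0 < det (phi a) (phi b) (phi d) ->
    (closed_triangle a b d `<=` closed_triangle o1 o2 o3) -> curve_image (segment a b) q ->
    (closure outside `\` outside) q.
  move=> oe abd sub /(segment_closed abd)[cq e]; split; last exact: inside_not_outside (sub _ cq).
  (* The reflection of the opposite corner [d] in [q] lies across the edge, so the half-open segment
     from [q] to it is outside. *)
  apply: (@closure_line _ q (line q (phi d) (-1))) => t /andP[t0 t1].
  exists a, b; split=> //; rewrite !det_line e !mulr0 !add0r mulN1r mulrN oppr_lt0.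
  exact: mulr_gt0.
by case=> [[]|]; [apply: (edge o1 o2 o3)|apply: (edge o2 o3 o1)|apply: (edge o3 o1 o2)] => //;
  rewrite /outer_edge ?inE ?eqxx ?orbT // => r [? ? ?]; split.
Qed.

(** The open faces and [outside] are open and connected, two of them are equal or disjoint, and they
    cover the complement of the drawing; hence they are its components. *)
Theorem convex_lift_triangulation : planar_triangulation R G.
Proof.
exists phi, segment; split; first exact: straight_line_drawing.
set U := ~` drawing_support phi segment.
pose tri : set plane := \bigcup_(t in [set t : G * G * G | face t.1.1 t.1.2 t.2])
  open_triangle t.1.1 t.1.2 t.2.
have Ucover : U `<=` outside `|` tri.
  move=> p nS; have [out|[a [b [d [f Tp]]]]] := covering p; [by left|right].
  exists (a, b, d) => //=; have [//|nO] := pselect (open_triangle a b d p).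
  have f2 := face_rot f; have f3 := face_rot f2.
  case: nS; right; have := closed_not_open (face_det f) Tp nO.
  by case=> [[]|] h; [exists a, b|exists b, d|exists d, a]; split=> //; apply: face_edge; eassumption.
have tri_open : open tri by apply: bigcup_open => t _; exact: open_open_triangle.
move=> F [p Up ->]; have [out|[[[a b] d] /= f Tp]] := Ucover p Up.
  have -> : connected_component U p = outside.
    apply: (component_piece out open_outside outside_connected _ tri_open Ucover).
      by move=> q oq /support_not_outside.
    apply/seteqP; split=> // q [oq [[[a b] d] /= f Tq]].
    by have : (open_triangle a b d `&` outside) q by []; rewrite open_triangle_inside.
  exists o1, o2, o3; split; last exact: outside_boundary.
  - by apply: outer_adj; rewrite /outer_edge !inE eqxx.
  - by apply: outer_adj; rewrite /outer_edge !inE eqxx orbT.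
  - by apply: outer_adj; rewrite /outer_edge !inE eqxx !orbT.
(* The disjointness condition drops the rotations of the face [abd], which have the same open
   triangle. *)
pose B : set plane := outside `|` \bigcup_(t in [set t : G * G * G | face t.1.1 t.1.2 t.2 /\
  open_triangle a b d `&` open_triangle t.1.1 t.1.2 t.2 = set0]) open_triangle t.1.1 t.1.2 t.2.
have -> : connected_component U p = open_triangle a b d.
  apply: (@component_piece U _ B) => //.
  - exact: open_open_triangle.
  - exact: triangle_connected.
  - by move=> q Tq /support_not_open; apply; first exact: f.
  - by apply: openU; [exact: open_outside|apply: bigcup_open => t _; exact: open_open_triangle].
  - move=> q /Ucover[oq|[[[a' b'] d'] /= f' Tq]]; first by right; left.
    have [e|e] := open_triangles_disjoint f f'; first by left; rewrite e.
    by right; right; exists (a', b', d').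
  - apply/seteqP; split=> // q [Tq [oq|[[[a' b'] d'] /= [f' e] Tq']]].
      by have : (open_triangle a b d `&` outside) q by []; rewrite open_triangle_inside.
    by have : (open_triangle a b d `&` open_triangle a' b' d') q by []; rewrite e.
have f2 := face_rot f; have f3 := face_rot f2.
exists a, b, d; split; try (apply: face_edge; eassumption).
exact: open_triangle_boundary (face_det f) Tp.
Qed.

End ConvexLift.

(** * Integer certificates for convex surfaces *)

Section IntegerPolyhedron.
Context {R : realType}.
Local Open Scope ring_scope.
Variables (n : nat) (F : seq (nat * nat * nat)) (pts : seq (Z * Z * Z)) (o1 o2 o3 : nat).

(** All inequalities are decided by computation with binary integers and transferred to [R] by this
    map, which respects the ring operations. *)
Definition to_real (z : Z) : R := (int_of_Z z)%:~R.

Lemma to_realB x y : to_real (x - y) = to_real x - to_real y.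
Proof. by rewrite /to_real !rmorphB. Qed.

Lemma to_realD x y : to_real (x + y) = to_real x + to_real y.
Proof. by rewrite /to_real !rmorphD. Qed.

Lemma to_realM x y : to_real (x * y) = to_real x * to_real y.
Proof. by rewrite /to_real !rmorphM. Qed.

Lemma to_real_ge0 z : Z.leb 0 z -> 0 <= to_real z.
Proof. by case: z => // p _; rewrite /to_real ler0z. Qed.

Lemma to_real_gt0 z : Z.ltb 0 z -> 0 < to_real z.
Proof.
case: z => // p _; rewrite /to_real ltr0z /=.
by have [k ->] := Pos2Nat.is_succ p.
Qed.

Definition int_point (v : nat) : Z * Z := (nth (0, 0, 0) pts v).1.
Definition int_height (v : nat) : Z := (nth (0, 0, 0) pts v).2.

Definition int_det (p q r : Z * Z) : Z := (q.1 - p.1) * (r.2 - p.2) - (q.2 - p.2) * (r.1 - p.1).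

Definition int_lift (a b d z : nat) : Z :=
  int_height a * int_det (int_point b) (int_point d) (int_point z) +
  int_height b * int_det (int_point d) (int_point a) (int_point z) +
  int_height d * int_det (int_point a) (int_point b) (int_point z).

(** Each face is listed once for each of its edges, so conditions on the first edge of a triple
    reach all edges. *)
Definition rotations : seq (nat * nat * nat) :=
  flatten [seq [:: t; (t.1.2, t.2, t.1.1); (t.2, t.1.1, t.1.2)] | t <- F].

Definition outer_pairs : seq (nat * nat) := [:: (o1, o2); (o2, o3); (o3, o1)].

Definition faces_convex : bool := all (fun t : nat * nat * nat =>
  [&& t.1.1 != t.1.2, t.1.1 < n, t.1.2 < n, t.2 < n,
    Z.ltb 0 (int_det (int_point t.1.1) (int_point t.1.2) (int_point t.2)) &
    all (fun z => in_face t z || Z.ltb 0 (int_height z *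
      int_det (int_point t.1.1) (int_point t.1.2) (int_point t.2) -
      int_lift t.1.1 t.1.2 t.2 z)) (iota 0 n)])%N rotations.

(** The surface has no boundary besides the outer cycle: every other directed edge is reversed in
    some face. *)
Definition faces_closed : bool := all (fun t : nat * nat * nat =>
  ((t.1.1, t.1.2) \in outer_pairs) ||
  has (fun t' => (t'.1.1 == t.1.2) && (t'.1.2 == t.1.1)) rotations) rotations.

Definition faces_cover : bool :=
  all (fun u => has (fun t : nat * nat * nat => t.1.1 == u) rotations) (iota 0 n).

Definition outer_convex : bool :=
  [&& (o1 < n)%N, (o2 < n)%N, (o3 < n)%N,
    Z.ltb 0 (int_det (int_point o1) (int_point o2) (int_point o3)) &
    all (fun e : nat * nat => face_adj F e.1 e.2 &&
      all (fun z => Z.leb 0 (int_det (int_point e.1) (int_point e.2) (int_point z))) (iota 0 n))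
      outer_pairs].

Local Notation G := (face_graph n F).

Let phi (v : G) : R * R :=
  (to_real (int_point (v : 'I_n)).1, to_real (int_point (v : 'I_n)).2).
Let H (v : G) : R := to_real (int_height (v : 'I_n)).
Let face (a b d : G) : bool :=
  (nat_of_ord (a : 'I_n), nat_of_ord (b : 'I_n), nat_of_ord (d : 'I_n)) \in rotations.

Lemma det_int (a b d : G) : det (phi a) (phi b) (phi d) =
  to_real (int_det (int_point (a : 'I_n)) (int_point (b : 'I_n)) (int_point (d : 'I_n))).
Proof. by rewrite /det /int_det !(to_realB, to_realM). Qed.

Lemma lift_int (a b d z : G) : lift phi H a b d (phi z) =
  to_real (int_lift (a : 'I_n) (b : 'I_n) (d : 'I_n) (z : 'I_n)).
Proof. by rewrite /lift /int_lift !to_realD !to_realM !det_int. Qed.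

Lemma rotationsP (t : nat * nat * nat) : reflect
  (exists2 f, f \in F & t \in [:: f; (f.1.2, f.2, f.1.1); (f.2, f.1.1, f.1.2)]) (t \in rotations).
Proof. exact: flatten_mapP. Qed.

Lemma polyhedron_triangulation :
  faces_convex -> faces_closed -> faces_cover -> outer_convex -> planar_triangulation R G.
Proof.
move=> /allP conv /allP closed /allP cover /and5P[n1 n2 n3 odet /allP oconv].
have ord (t : nat * nat * nat) : t \in rotations -> exists a b d : 'I_n,
    t = (nat_of_ord a, nat_of_ord b, nat_of_ord d).
  case: t => [[a b] d] /conv /= /and5P[_ an bn dn _].
  by exists (Ordinal an), (Ordinal bn), (Ordinal dn).
have oP (v : 'I_n) : nat_of_ord v \in iota 0 n by rewrite mem_iota ltn_ord.
have outerE (u w : 'I_n) : @outer_edge G (Ordinal n1) (Ordinal n2) (Ordinal n3) u w =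
    ((nat_of_ord u, nat_of_ord w) \in outer_pairs).
  by rewrite /outer_edge !inE.
have rot a b d : (a, b, d) \in rotations -> (b, d, a) \in rotations.
  move=> /rotationsP[[[x y] z] f /=]; rewrite !inE => h; apply/rotationsP; exists (x, y, z) => //.
  by case/or3P: h => /eqP[-> -> ->]; rewrite /= !inE eqxx ?orbT.
apply: (@convex_lift_triangulation R G phi H face _ _ _ _ _ _ (Ordinal n1) (Ordinal n2) (Ordinal n3)).
- by move=> a b d; apply: rot.
- by move=> a b d /conv /and5P[_ _ _ _ /andP[h _]]; rewrite det_int to_real_gt0.
- move=> a b d z /conv /and5P[_ _ _ _ /andP[_ /allP/(_ _ (oP z)) h]] zT.
  rewrite -subr_gt0 lift_int det_int -to_realM -to_realB to_real_gt0 //.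
  by case/orP: h => //; move: zT; rewrite !inE /in_face /= => /negPf ->.
- move=> u; have /hasP[[[a b] d] tr /eqP /= e] := cover _ (oP u).
  have [a' [b' [d' [aE bE dE]]]] := ord _ tr; exists b', d'.
  by rewrite /face -e -bE -dE.
- move=> u w /andP[uw /hasP[[[a b] d] f /andP[fu fw]]].
  have ro t : t \in [:: (a, b, d); (b, d, a); (d, a, b)] -> t \in rotations.
    by move=> h; apply/rotationsP; exists (a, b, d).
  have [r1 r2 r3] : [/\ (a, b, d) \in rotations, (b, d, a) \in rotations & (d, a, b) \in rotations].
    by split; apply: ro; rewrite !inE eqxx ?orbT.
  have [a' [b' [d' [aE bE dE]]]] := ord _ r1.
  move: fu fw uw; rewrite /in_face /= => /or3P[] /eqP uE /or3P[] /eqP wE; rewrite uE wE ?eqxx // => _.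
  + by exists d'; left; rewrite /face uE wE -dE.
  + by exists b'; right; rewrite /face uE wE -bE.
  + by exists d'; right; rewrite /face uE wE -dE.
  + by exists a'; left; rewrite /face uE wE -aE.
  + by exists b'; left; rewrite /face uE wE -bE.
  + by exists a'; right; rewrite /face uE wE -aE.
- move=> a b d f; have /and5P[ab _ _ _ _] := conv _ f.
  apply/andP; split=> //.
  move/rotationsP: f => [[[x y] z] f h]; apply/hasP; exists (x, y, z) => //.
  by move: h; rewrite /in_face !inE /= => /or3P[] /eqP[-> -> _]; rewrite !eqxx ?orbT.
- by move=> u w; rewrite outerE => /oconv /andP[].
- move=> u w z; rewrite outerE => /oconv /andP[_ /allP/(_ _ (oP z)) h].
  by rewrite det_int to_real_ge0.
- by rewrite det_int to_real_gt0.
- move=> a b d f; case/orP: (closed _ f) => [oe|/hasP[[[x y] z] tr /andP[/eqP /= e1 /eqP /= e2]]].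
    by left; rewrite outerE.
  right; have [x' [y' [z' [xE yE zE]]]] := ord _ tr; exists z'.
  by rewrite /face -e1 -e2 -zE.
Qed.

End IntegerPolyhedron.

Section Heights.
Local Open Scope Z_scope.

(* The third coordinate is the height above the plane. *)
Definition points26 : seq (Z * Z * Z) :=
  [:: (0, 0, 4864); (608, 0, 1897); (304, 547, 3098); (164, 9, 1783); (130, 9, 2143);
   (7, 5, 4403); (124, 205, 3106); (279, 500, 3079); (382, 405, 1928); (568, 55, 454);
   (454, 25, 0); (344, 23, 198); (306, 540, 3040); (145, 11, 1945); (101, 101, 2897);
   (100, 11, 2611); (50, 16, 3558); (94, 144, 3237); (382, 26, 0); (493, 185, 211);
   (474, 35, 0); (566, 57, 411); (501, 155, 162); (563, 61, 391); (503, 59, 59);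
   (559, 61, 366)].

End Heights.

Lemma graph26_triangulation (R : realType) : planar_triangulation R (face_graph 26 faces26).
Proof.
apply: (@polyhedron_triangulation R 26 faces26 points26 0 1 2).
- vm_compute; reflexivity.
- vm_compute; reflexivity.
- vm_compute; reflexivity.
- vm_compute; reflexivity.
Qed.

Lemma graph26_max_degree : max_degree (face_graph 26 faces26) = 7%N.
Proof.
have sizes : all (fun l => size l <= 7)%N table26 by [].
have nb (v : 'I_26) := nth_table table26E v.
apply/eqP; rewrite eqn_leq; apply/andP; split.
  apply/bigmax_leqP => v _; rewrite face_degree -nb.
  by apply: (allP sizes); rewrite mem_nth // size_map size_iota.
(* Vertex 0 attains the bound; its neighbours are 1 to 7. *)
by have := leq_bigmax (F := @degree (face_graph 26 faces26)) (@ord0 25); rewrite face_degree -nb.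
Qed.

Theorem theorem20 (R : realType) :
  exists G : sgraph,
    [/\ k_connected 4 G,
        planar_triangulation R G,
        max_degree G = 7%N &
        ~ exists (phi : G -> (R * R)%type) (c : G -> G -> R -> (R * R)%type),
            plane_obstacle_embedding phi c].
Proof.
exists (face_graph 26 faces26); split.
- exact: graph26_four_connected.
- exact: graph26_triangulation.
- exact: graph26_max_degree.
- apply: (no_obstacle_embedding table26E (c1 := core1) (c2 := core2)).
  + by [].
  + exact: graph26_four_connected.
  + exact: graph26_link_check.
  + by [].
  + by [].
  + exact: cores_separated.
  + exact: core1_unlabellable.
  + exact: core2_unlabellable.
Qed.
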